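(* Let $\epsilon>0$ be fixed (sufficiently small), let $C:=(1/\epsilon)^{1/\epsilon}$ and $\Gamma:=32\pi C^3/\epsilon^5$. There is a polynomial-time algorithm for the unsplittable Euclidean capacitated vehicle routing problem which, on every instance for which an optimal solution $\mathrm{OPT}$ consists of at most $2\Gamma$ tours, outputs a feasible solution of cost at most $(2+O(\epsilon))\cdot\mathrm{opt}$, where $\mathrm{opt}$ is the optimal cost and the constant in $O(\epsilon)$ is absolute.
   Context: The unsplittable Euclidean capacitated vehicle routing problem: the input consists of a point $O\in\mathbb{R}^2$ called the depot and a finite set $V$ of $n$ points in $\mathbb{R}^2$ called terminals, each terminal $v\in V$ having a demand $\mathrm{demand}(v)\in(0,1]$. A tour is a closed walk starting and ending at $O$; its cost is its total Euclidean length. A feasible solution is a finite collection of tours together with an assignment of each terminal to a single tour visiting it, such that for every tour the total demand of the terminals assigned to it is at most $1$. The cost of a solution is the sum of the costs of its tours, to be minimized; $\mathrm{opt}$ denotes the minimum cost and $\mathrm{OPT}$ an optimal solution. *)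

(* Defs.v *)
From HB Require Import structures.
From mathcomp Require Import all_boot all_order all_algebra.
From mathcomp Require Import all_classical all_reals all_analysis.

Set Implicit Arguments.
Unset Strict Implicit.
Unset Printing Implicit Defensive.

Import Order.TTheory GRing.Theory Num.Theory.
Local Open Scope ring_scope.

(** * The unsplittable Euclidean capacitated vehicle routing problem *)

(* [R * R] carries the sup norm in the library, hence an explicit distance. *)
Definition edist (R : realType) (p q : R * R) : R :=
  Num.sqrt ((p.1 - q.1) ^+ 2 + (p.2 - q.2) ^+ 2).

(* The set of terminals is given by an injective enumeration. *)
Record instance (R : realType) := Instance {
  nterm : nat;
  depot : R * R;
  pos : 'I_nterm -> R * R;
  demand : 'I_nterm -> R;
  pos_inj : injective pos;
  demand_bounds : forall v, 0 < demand v <= 1 }.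

(* [None] is the depot, [Some v] is the terminal [v]. *)
Definition vertex (n : nat) := option 'I_n.

Definition loc (R : realType) (I : instance R) (x : vertex (nterm I)) : R * R :=
  if x is Some v then pos v else depot I.

(* The closed walk O, x_1, ..., x_k, O is represented by [:: x_1; ...; x_k];
   it may pass through O, or repeat a terminal, along the way. *)
Definition tour (n : nat) := seq (vertex n).

Definition tour_cost (R : realType) (I : instance R) (w : tour (nterm I)) : R :=
  \sum_(l <- pairmap (@edist R) (depot I) (rcons (map (@loc R I) w) (depot I))) l.

Record solution (n : nat) := Solution {
  ntours : nat;
  tour_of : 'I_ntours -> tour n;
  assign : 'I_n -> 'I_ntours }.

Definition feasible (R : realType) (I : instance R)
    (S : solution (nterm I)) : Prop :=
  (forall v, Some v \in tour_of (assign S v)) /\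
  (forall k, \sum_(v | assign S v == k) demand v <= 1).

Definition cost (R : realType) (I : instance R)
    (S : solution (nterm I)) : R :=
  \sum_(k < ntours S) tour_cost (tour_of k).

Definition optimal (R : realType) (I : instance R)
    (S : solution (nterm I)) : Prop :=
  feasible S /\ forall S' : solution (nterm I), feasible S' -> cost S <= cost S'.

Definition bigC (R : realType) (eps : R) : R := eps^-1 `^ eps^-1.

Definition Gamma (R : realType) (eps : R) : R :=
  32 * pi * bigC eps ^+ 3 / eps ^+ 5.

(** * Real RAM programs *)

(* Inputs are real numbers, so the machine model is the real RAM with square
   roots: an unbounded memory of natural numbers (used for counters and
   addresses) and an unbounded memory of exact reals, both addressed
   indirectly, at unit cost per operation. Programs are finite syntactic objects
   that do not depend on the instance. Three usual restrictions keep unit cost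
   honest: the only real constants are natural numbers (an arbitrary one could
   encode infinite advice), there is no rounding from reals to integers, and
   integers are only added and subtracted. *)

Inductive iexp : Type :=
| INat of nat
| ILoad of iexp
| IAdd of iexp & iexp
| ISub of iexp & iexp. (* truncated *)

(* Division by zero and the square root of a negative number yield 0. *)
Inductive rexp : Type :=
| RNat of nat
| RLoad of iexp
| RAdd of rexp & rexp
| RSub of rexp & rexp
| RMul of rexp & rexp
| RDiv of rexp & rexp
| RSqrt of rexp.

Inductive bexp : Type :=
| BILe of iexp & iexp
| BRLe of rexp & rexp
| BNot of bexp
| BAnd of bexp & bexp.

Inductive cmd : Type :=
| Skip
| IStore of iexp & iexp (* address, value *)
| RStore of iexp & rexp
| Seq of cmd & cmd
| If of bexp & cmd & cmd
| While of bexp & cmd.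

Record state (R : realType) := State { imem : nat -> nat; rmem : nat -> R }.

Fixpoint ieval (R : realType) (s : state R) (e : iexp) : nat :=
  match e with
  | INat k => k
  | ILoad a => imem s (ieval s a)
  | IAdd a b => (ieval s a + ieval s b)%N
  | ISub a b => (ieval s a - ieval s b)%N
  end.

Fixpoint reval (R : realType) (s : state R) (e : rexp) : R :=
  match e with
  | RNat k => k%:R
  | RLoad a => rmem s (ieval s a)
  | RAdd a b => reval s a + reval s b
  | RSub a b => reval s a - reval s b
  | RMul a b => reval s a * reval s b
  | RDiv a b => reval s a / reval s b
  | RSqrt a => Num.sqrt (reval s a)
  end.

Fixpoint beval (R : realType) (s : state R) (e : bexp) : bool :=
  match e with
  | BILe a b => (ieval s a <= ieval s b)%N
  | BRLe a b => reval s a <= reval s b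
  | BNot a => ~~ beval s a
  | BAnd a b => beval s a && beval s b
  end.

Definition istore (R : realType) (s : state R) (a v : nat) : state R :=
  State [eta imem s with a |-> v] (rmem s).

Definition rstore (R : realType) (s : state R) (a : nat) (v : R) : state R :=
  State (imem s) [eta rmem s with a |-> v].

(* [exec c s t s']: started in [s], the command [c] halts in [s'] after [t]
   steps. Stores and tests count for one step each: the expressions occurring
   in a program have bounded size, so this is the number of elementary
   operations up to a factor depending on the program only. *)
Inductive exec (R : realType) : cmd -> state R -> nat -> state R -> Prop :=
| ExecSkip s : exec Skip s 1 s
| ExecIStore a e s : exec (IStore a e) s 1 (istore s (ieval s a) (ieval s e))
| ExecRStore a e s : exec (RStore a e) s 1 (rstore s (ieval s a) (reval s e))
| ExecSeq c1 c2 s1 s2 s3 t1 t2 :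
    exec c1 s1 t1 s2 -> exec c2 s2 t2 s3 -> exec (Seq c1 c2) s1 (t1 + t2) s3
| ExecIf b c1 c2 s s' t :
    exec (if beval s b then c1 else c2) s t s' -> exec (If b c1 c2) s t.+1 s'
| ExecWhileF b c s : ~~ beval s b -> exec (While b c) s 1 s
| ExecWhileT b c s1 s2 s3 t1 t2 :
    beval s1 b -> exec c s1 t1 s2 -> exec (While b c) s2 t2 s3 ->
    exec (While b c) s1 (t1 + t2).+1 s3.

Lemma exec_det (R : realType) (c : cmd) (s : state R) (t1 t2 : nat)
    (s1 s2 : state R) :
  exec c s t1 s1 -> exec c s t2 s2 -> t1 = t2 /\ s1 = s2.
Proof.
move=> e1; elim: e1 t2 s2 => {c s t1 s1}
  [s|a e s|a e s|c1 c2 s1 s2 s3 t1 t2 _ IH1 _ IH2|b c1 c2 s s' t _ IH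
  |b c s /negPf nb|b c s1 s2 s3 t1 t2 hb _ IH1 _ IH2] t' u e'.
- by inversion e'.
- by inversion e'.
- by inversion e'.
- inversion e' as [| | |? ? ? ? ? ? ? f1 f2| | |]; subst.
  by have [? ?] := IH1 _ _ f1; subst; have [-> ->] := IH2 _ _ f2.
- inversion e' as [| | | |? ? ? ? ? ? f| |]; subst.
  by have [-> ->] := IH _ _ f.
- inversion e' as [| | | | | |? ? ? ? ? ? ? hb]; subst => //.
  by rewrite hb in nb.
- inversion e' as [| | | | |? ? ? nb|? ? ? ? ? ? ? _ f1 f2]; subst.
    by rewrite hb in nb.
  by have [? ?] := IH1 _ _ f1; subst; have [-> ->] := IH2 _ _ f2.
Qed.

(** * Input and output conventions *)

Definition input_seq (R : realType) (I : instance R) : seq R :=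
  [:: (depot I).1; (depot I).2] ++
  flatten [seq [:: (pos v).1; (pos v).2; demand v] | v <- enum 'I_(nterm I)].

Definition input_state (R : realType) (I : instance R) : state R :=
  State [eta (fun=> 0%N) with 0%N |-> nterm I] (nth 0 (input_seq I)).

Definition vertex_code (n : nat) (x : vertex n) : nat :=
  if x is Some v then (val v).+1 else 0%N.

(* The number of tours, then the tour assigned to each terminal, then the tours,
   each preceded by its length; this is a prefix code for a given [n]. *)
Definition solution_code (n : nat) (S : solution n) : seq nat :=
  ntours S :: [seq val (assign S v) | v <- enum 'I_n] ++
  flatten [seq size (tour_of k) :: map (@vertex_code n) (tour_of k)
          | k <- enum 'I_(ntours S)].

Definition outputs (R : realType) (n : nat) (s : state R) (S : solution n) :
    Prop :=
  mkseq (imem s) (size (solution_code S)) = solution_code S.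

(* Main.v *)
(** After rescaling, the tours of an optimal solution can be modified, by
    patching their crossings with the lines of a suitably shifted dyadic
    dissection, so that their total length grows by a factor at most [1 + eps]
    while the terminals of any dissection square or half square form boundedly
    many runs on each tour. The pieces of the tours inside a square are then
    described by boundedly many pairs of end points. Loads of real demands
    cannot be enumerated, so every demand [d] is rounded up to an integer
    between [2 n d] and [2 n d + 1]: a feasible tour has rounded load at most
    [3 n], and it splits into two tours of rounded load at most [2 n], which are
    truly feasible; this is the factor [2]. As the number of tours is bounded,
    a dynamic program over the combinatorial rectangles spanned by the terminal
    coordinates finds the cheapest family of pieces for each of polynomially
    many keys (rectangle, rounded loads, end points of the pieces); it is
    complete for the dissection although it never computes the dissection. *)
From Pilot Require Import Defs.
From HB Require Import structures.
From mathcomp Require Import all_boot all_order all_algebra.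
From mathcomp Require Import all_classical all_reals all_analysis.
From mathcomp Require Import zify ring lra.

Set Implicit Arguments.
Unset Strict Implicit.
Unset Printing Implicit Defensive.

Import Order.TTheory GRing.Theory Num.Theory.
Local Open Scope ring_scope.

Local Notation edist := Pilot.Defs.edist.

Local Notation filter := seq.filter.

(** * Path lengths in the plane *)

Section Distance.
Variable R : realType.
Implicit Types (p q z : R * R) (s t : seq (R * R)).

(** The machine cannot round reals and the ratio of distances is unbounded, so neither the shift nor
    the squares can be computed, and the depth of the dissection is not bounded in terms of [n].
    Hence regions are named by terminals, pieces end at terminals instead of portals, and cuts that
    separate no terminal are contracted, which keeps the number of rounds linear in [n]. Each tour
    is patched on its own. Patching a segment of length [2 ^ h] costs [4 * 2 ^ h] and is done only
    when it removes at least [r] groups of crossings; as a line bounds squares of level [h] for a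
    fraction [2 ^ - h] of the shifts, the average cost is [4 / r] per crossing. With three crossings
    per unit of length this is [12 / r], and one shift serves the sum over all tours. A tour owns
    [2 c] slots so that two children with at most [c] pieces each fit side by side. Under a given
    key the table may hold another family than the wanted one; every later test and change of cost
    depends on the key only, so the stored family is as good. *)

Lemma edist_ge0 p q : 0 <= edist p q.
Proof. exact: sqrtr_ge0. Qed.

Lemma edistC p q : edist p q = edist q p.
Proof. by rewrite /edist -sqrrN opprB -[X in _ + X]sqrrN opprB. Qed.

Lemma edistpp p : edist p p = 0.
Proof. by rewrite /edist !subrr expr0n addr0 sqrtr0. Qed.

Lemma sqrt_le_of_sqr (x y : R) : 0 <= y -> x <= y ^+ 2 -> Num.sqrt x <= y.
Proof. by move=> y0 xy; rewrite -(ger0_norm y0) -sqrtr_sqr ler_wsqrtr. Qed.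

Lemma edist_sqr p q : edist p q ^+ 2 = (p.1 - q.1) ^+ 2 + (p.2 - q.2) ^+ 2.
Proof. by rewrite sqr_sqrtr // addr_ge0 ?sqr_ge0. Qed.

Lemma edist_triangle z p q : edist p q <= edist p z + edist z q.
Proof.
apply: sqrt_le_of_sqr; first by rewrite addr_ge0 ?edist_ge0.
rewrite [leRHS]sqrrD !edist_sqr.
have : (p.1 - z.1) * (z.1 - q.1) + (p.2 - z.2) * (z.2 - q.2) <=
  edist p z * edist z q.
  apply: le_trans (ler_norm _) _; rewrite -sqrtr_sqr.
  apply: sqrt_le_of_sqr; first by rewrite mulr_ge0 ?edist_ge0.
  rewrite exprMn !edist_sqr.
  (* Lagrange's identity: this squared determinant is the gap in the Cauchy-Schwarz inequality. *)
  have := sqr_ge0 ((p.1 - z.1) * (z.2 - q.2) - (p.2 - z.2) * (z.1 - q.1)).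
  nra.
nra.
Qed.

Lemma edist_coord p q : `|p.1 - q.1| <= edist p q /\ `|p.2 - q.2| <= edist p q.
Proof.
split; rewrite -sqrtr_sqr /edist ler_wsqrtr //.
  by rewrite lerDl sqr_ge0.
by rewrite lerDr sqr_ge0.
Qed.

Lemma edist_between p q (u : R) : 0 <= u <= 1 ->
  let z := (p.1 + u * (q.1 - p.1), p.2 + u * (q.2 - p.2)) in
  edist p z + edist z q = edist p q.
Proof.
move=> /andP[u0 u1] z; rewrite /edist /z /=.
have -> : (p.1 - (p.1 + u * (q.1 - p.1))) ^+ 2 +
  (p.2 - (p.2 + u * (q.2 - p.2))) ^+ 2 =
  u ^+ 2 * ((p.1 - q.1) ^+ 2 + (p.2 - q.2) ^+ 2) by ring.
have -> : (p.1 + u * (q.1 - p.1) - q.1) ^+ 2 +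
  (p.2 + u * (q.2 - p.2) - q.2) ^+ 2 =
  (1 - u) ^+ 2 * ((p.1 - q.1) ^+ 2 + (p.2 - q.2) ^+ 2) by ring.
have sqrtZ v y : 0 <= v -> Num.sqrt (v ^+ 2 * y) = v * Num.sqrt y.
  by move=> v0; rewrite sqrtrM ?sqr_ge0 // sqrtr_sqr ger0_norm.
rewrite !sqrtZ ?subr_ge0 //; ring.
Qed.

Fixpoint plen p s : R := if s is q :: s' then edist p q + plen q s' else 0.

Lemma plenE p s : plen p s = \sum_(l <- pairmap (@edist R) p s) l.
Proof. by elim: s p => [|q s IH] p /=; rewrite ?big_nil // big_cons IH. Qed.

Lemma plen_ge0 p s : 0 <= plen p s.
Proof. by elim: s p => //= q s IH p; rewrite addr_ge0 ?edist_ge0. Qed.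

Lemma plen_cat p s t : plen p (s ++ t) = plen p s + plen (last p s) t.
Proof. by elim: s p => [|q s IH] p /=; rewrite ?add0r // IH addrA. Qed.

Lemma plen_rcons p s q : plen p (rcons s q) = plen p s + edist (last p s) q.
Proof. by rewrite -cats1 plen_cat /= addr0. Qed.

Lemma plen_rev p s q : plen p (rcons s q) = plen q (rcons (rev s) p).
Proof.
elim: s p q => [|x s IH] p q /=; first by rewrite edistC.
by rewrite IH rev_cons [RHS]plen_rcons last_rcons edistC addrC.
Qed.

Lemma plen_drop p q s : plen p s <= edist p q + plen q s.
Proof.
case: s => [|x s] /=; first by rewrite addr0 edist_ge0.
by rewrite addrA lerD2r edist_triangle.
Qed.

(** Shortcutting: by the triangle inequality, skipping a point never lengthens a path. *)
Lemma plen_subseq p s t : subseq s t -> plen p s <= plen p t.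
Proof.
elim: t p s => [|q t IH] p [|x s] //= st; first by rewrite addr_ge0 ?edist_ge0 ?plen_ge0.
move: st; case: eqP => [-> st|_ st]; first by rewrite lerD2l IH.
exact: le_trans (IH p _ st) (plen_drop p q t).
Qed.

Lemma edist_axis (d : bool) (x y y' : R) :
  edist (if d then (x, y) else (y, x)) (if d then (x, y') else (y', x)) =
  `|y - y'|.
Proof. by case: d; rewrite /edist /= subrr expr0n ?add0r ?addr0 sqrtr_sqr. Qed.

End Distance.

(** * Walks on the grid *)

(* The plane is cut into unit cells. A closed walk is a list of items: either a
   terminal, or the crossing of the wall [X d l j pos crn] between the cells
   with [d]-coordinates [l] and [l + 1], in position [j] along the wall; [pos]
   is the real coordinate at which the wall is crossed, and [crn] marks the
   crossings created at the ends of a wall while patching another line. *)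
Section Walk.
Variables (R : realType) (n : nat) (loc : option 'I_n -> R * R).

Definition crossing := (bool * nat * nat * R * bool)%type.
Definition item := ('I_n + crossing)%type.

(** The pair whose [d]-coordinate is [a], with [true] for the first axis; through it vertical and
    horizontal lines are treated at once. *)
Definition mk (T : Type) (d : bool) (a b : T) : T * T :=
  if d then (a, b) else (b, a).

Definition cellof (p : R * R) : nat * nat := (Num.trunc p.1, Num.trunc p.2).

Definition X (d : bool) (l j : nat) (x : R) (crn : bool) : item :=
  inr (d, l, j, x, crn).

Definition ptof (it : item) : R * R :=
  match it with
  | inl v => loc (Some v)
  | inr (d, l, _, x, _) => mk d l.+1%:R x
  end.

(** A terminal can only be visited from its own cell. A crossing carries no direction: it is passed
    from whichever side the walk stands on, so a walk can be reversed item by item. *)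
Definition step (c : nat * nat) (it : item) : option (nat * nat) :=
  match it with
  | inl v => if c == cellof (loc (Some v)) then Some c else None
  | inr (d, l, j, _, _) =>
      if c == mk d l j then Some (mk d l.+1 j)
      else if c == mk d l.+1 j then Some (mk d l j) else None
  end.

Fixpoint walk (c : nat * nat) (w : seq item) (c' : nat * nat) : bool :=
  if w is it :: w' then if step c it is Some c1 then walk c1 w' c' else false
  else c == c'.

Lemma walk_cat c w1 w2 c' :
  reflect (exists c1, walk c w1 c1 /\ walk c1 w2 c') (walk c (w1 ++ w2) c').
Proof.
apply: (iffP idP).
  elim: w1 c => [|it w1 IH] c /=; first by exists c; rewrite eqxx.
  by case: (step c it) => // c1; apply: IH.
elim: w1 c => [|it w1 IH] c /= [c1 []]; first by move=> /eqP ->.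
by case: (step c it) => // c2 h1 h2; apply: IH; exists c1.
Qed.

Lemma mk_inj (d : bool) (a b a' b' : nat) : mk d a b = mk d a' b' -> a = a' /\ b = b'.
Proof. by case: d => [[-> ->]|[-> ->]]. Qed.

Lemma mkN (d : bool) (T : Type) (a b : T) : mk (~~ d) a b = mk d b a.
Proof. by case: d. Qed.

Lemma step_sym c it c' : step c it = Some c' -> step c' it = Some c.
Proof.
case: it => [v|[[[[d l] j] x] crn]] /=; first by case: eqP => // -> [<-]; rewrite eqxx.
have neq : (mk d l.+1 j == mk d l j) = false.
  by apply/eqP => /mk_inj [] /esym /n_Sn.
case: eqP => [->|_]; first by case=> <-; rewrite neq eqxx.
by case: eqP => // -> [<-]; rewrite eqxx.
Qed.

Lemma walk_rcons c w it c1 c' : walk c w c1 -> step c1 it = Some c' ->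
  walk c (rcons w it) c'.
Proof.
by move=> h1 h2; rewrite -cats1; apply/walk_cat; exists c1; rewrite h1 /= h2 eqxx.
Qed.

Lemma walk_rev c w c' : walk c w c' -> walk c' (rev w) c.
Proof.
elim: w c => [|it w IH] c /=; first by move=> /eqP ->; rewrite eqxx.
case E: (step c it) => [c1|] // /IH h; rewrite rev_cons.
exact: walk_rcons h (step_sym E).
Qed.

(* The corridor along line [l], in row [e], from column [j] to column [j']. *)
Definition corr (d : bool) (l e j j' : nat) : seq item :=
  let f k := X (~~ d) k e l.+1%:R true in
  if (j <= j')%N then [seq f k | k <- iota j (j' - j)]
  else rev [seq f k | k <- iota j' (j - j')].

Lemma walk_corr d l e j j' : walk (mk d e j) (corr d l e j j') (mk d e j').
Proof.
have H : forall m j, walk (mk d e j)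
    [seq X (~~ d) k e l.+1%:R true | k <- iota j m] (mk d e (j + m)%N).
  elim=> [|m IH] {}j /=; first by rewrite addn0.
  by rewrite !mkN eqxx addnS -addSn IH.
rewrite /corr; case: leqP => h; first by rewrite -{2}(subnKC h) H.
by apply: walk_rev; rewrite -{2}(subnKC (ltnW h)) H.
Qed.

(** Every corner of the corridor lies on the line between the two end positions, so the path is a
    straight segment. *)
Lemma plen_corr d l e j j' (x x' : R) : j%:R <= x <= j.+1%:R ->
  j'%:R <= x' <= j'.+1%:R ->
  plen (mk d l.+1%:R x) (rcons (map ptof (corr d l e j j')) (mk d l.+1%:R x'))
   = `|x - x'|.
Proof.
(* For [m > 0] the bound on [j + m] already puts the next corner before [x']; only the empty
   corridor needs [x <= x']. *)
have H : forall m j (x x' : R), j%:R <= x <= j.+1%:R ->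
   (j + m)%N%:R <= x' -> (m = 0%N -> x <= x') ->
   plen (mk d l.+1%:R x) (rcons (map ptof [seq X (~~ d) k e l.+1%:R true | k <- iota j m])
     (mk d l.+1%:R x')) = x' - x.
  elim=> [|m IH] {}j {}x {}x' /andP[jx xj] jx' h /=.
    rewrite addr0 edist_axis distrC ger0_norm ?subr_ge0 //; exact: h.
  have h1 : ((j.+1%:R : R) <= j.+1%:R) && ((j.+1%:R : R) <= j.+2%:R) by apply/andP; split; rewrite ler_nat.
  have h2 : (j.+1 + m)%N%:R <= x' by rewrite addSnnS.
  have jx1 : j.+1%:R <= x' by apply: le_trans h2; rewrite ler_nat leq_addr.
  rewrite mkN (IH _ _ _ h1 h2 (fun=> jx1)) edist_axis distrC.
  rewrite ger0_norm ?subr_ge0 //; ring.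
move=> hx hx'; rewrite /corr; case: ltngtP => h.
- have := H (j' - j)%N j x x' hx; rewrite subnKC ?(ltnW h) // => ->.
  + rewrite distrC ger0_norm // subr_ge0.
    have : j.+1%:R <= j'%:R :> R by rewrite ler_nat.
    lra.
  + by case/andP: hx'.
  + by move=> /eqP; rewrite subn_eq0 leqNgt h.
- rewrite map_rev plen_rev revK.
  have := H (j - j')%N j' x' x hx'; rewrite subnKC ?(ltnW h) // => ->.
  + rewrite ger0_norm // subr_ge0.
    have : j'.+1%:R <= j%:R :> R by rewrite ler_nat.
    lra.
  + by case/andP: hx.
  + by move=> /eqP; rewrite subn_eq0 leqNgt h.
- by rewrite h subnn /= addr0 edist_axis.
Qed.

Definition side (e l : nat) := (e == l) || (e == l.+1).

(** A 2-exchange. Both crossings lead from row [e] to row [e'], so the stretch [Q] between them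
    leads back; it can be run backwards after a slide along the line on side [e], and a second slide
    on side [e'] reaches [S]. Both crossings vanish at the price of two corridors. *)
Lemma two_opt c c' P Q S d l j j' (x x' : R) b b' e e' a :
  walk c P (mk d e j) -> step (mk d e j) (X d l j x b) = Some (mk d e' j) ->
  walk (mk d e' j) Q (mk d e j') ->
  step (mk d e j') (X d l j' x' b') = Some (mk d e' j') ->
  walk (mk d e' j') S c' ->
  j%:R <= x <= j.+1%:R -> j'%:R <= x' <= j'.+1%:R ->
  let w' := P ++ corr d l e j j' ++ rev Q ++ corr d l e' j j' ++ S in
  walk c w' c' /\
  forall z, plen a (rcons (map ptof w') z) <=
   plen a (rcons (map ptof (P ++ X d l j x b :: Q ++ X d l j' x' b' :: S)) z)
   + 2 * `|x - x'|.
Proof.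
move=> hP hx hQ hx' hS bx bx' w'; split.
  apply/walk_cat; exists (mk d e j); split=> //.
  apply/walk_cat; exists (mk d e j'); split; first exact: walk_corr.
  apply/walk_cat; exists (mk d e' j); split; first exact: walk_rev.
  by apply/walk_cat; exists (mk d e' j'); split=> //; apply: walk_corr.
move=> z; pose px := mk d l.+1%:R x; pose py := mk d l.+1%:R x'.
pose C := map ptof (corr d l e j j'); pose C' := map ptof (corr d l e' j j').
rewrite /w' !map_cat /= !map_cat /= !rcons_cat [leLHS]plen_cat.
rewrite [X in _ <= X + _]plen_cat -addrA lerD2l.
set u := last a _; rewrite -/px -/py !map_rev.
have hC : plen px (rcons C py) = `|x - x'| by apply: plen_corr.
have hC' : plen px (rcons C' py) = `|x - x'| by apply: plen_corr.
set Qs := map ptof Q; set Ss := rcons (map ptof S) z.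
rewrite -/C -/C' -/Qs.
(* Inserting the two crossing points at the ends of the corridors can only lengthen the new path,
   and decomposes it into the old pieces, one of them reversed, and the two corridors. *)
apply: (@le_trans _ _ (plen u (px :: C ++ py :: rev Qs ++ px :: C' ++ py :: Ss))).
  apply: plen_subseq; apply: subseq_trans (subseq_cons _ _).
  do 3? [apply: cat_subseq => //; apply: subseq_trans (subseq_cons _ _)].
  exact: subseq_refl.
rewrite /= -!cat_rcons !plen_cat !last_rcons hC hC' -plen_rev /=.
rewrite !rcons_cat plen_cat last_rcons -/Ss; lra.
Qed.

End Walk.

(** * Patching the crossings of a line *)

Section Patch.
Variables (R : realType) (n : nat) (loc : option 'I_n -> R * R).
Local Notation item := (item R n).
Local Notation ptof := (ptof loc).
Local Notation walk := (walk loc).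
Local Notation step := (step loc).
Implicit Types (w : seq item) (it : item).

Definition grp d l lo hi it : bool :=
  if it is inr (d', l', j, _, crn) then
    [&& ~~ crn, d' == d, l' == l, lo <= j & j < hi]%N else false.

Definition nc it : bool := if it is inr (_, _, _, _, crn) then ~~ crn else true.

Definition crnAt d l j it : bool :=
  if it is inr (d', l', j', _, crn) then
    [&& crn, d' == d, l' == l & j' == j] else false.

Definition okit it : bool :=
  if it is inr (_, _, j, x, crn) then crn || (j%:R <= x <= j.+1%:R) else true.

Definition prow it : nat := if it is inr (_, _, j, _, _) then j else 0%N.
Definition ppos it : R := if it is inr (_, _, _, x, _) then x else 0.

Lemma grpP d l lo hi it : grp d l lo hi it ->
  [/\ it = X n d l (prow it) (ppos it) false, (lo <= prow it)%N & (prow it < hi)%N].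
Proof.
by case: it => [//|[[[[d' l'] j] x] crn]] /= /and5P[/negbTE -> /eqP -> /eqP -> -> ->].
Qed.

Lemma grp_nc d l lo hi it : grp d l lo hi it -> nc it.
Proof. by move=> /grpP[-> _ _]. Qed.

Lemma count_corr d d' l k e e0 j j' :
  count (crnAt d' k e) (corr R n d l e0 j j') =
  [&& d' == ~~ d, e == e0, minn j j' <= k & k < maxn j j']%N :> nat.
Proof.
have H m i : count (crnAt d' k e) [seq X n (~~ d) k e0 l.+1%:R true | k <- iota i m]
  = [&& d' == ~~ d, e == e0 & (i <= k < i + m)%N] :> nat.
  rewrite count_map /=; case: (eqVneq d' (~~ d)) => [->|/negbTE hd] /=; last first.
    by apply/eqP; rewrite -leqn0 leqNgt -has_count; apply/hasPn => x _ /=; rewrite eq_sym hd.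
  case: (eqVneq e e0) => [->|/negbTE he] /=; last first.
    apply/eqP; rewrite -leqn0 leqNgt -has_count; apply/hasPn => x _ /=.
    by rewrite (eq_sym e0) he !andbF.
  rewrite (@eq_count _ _ (pred1 k)); first by rewrite count_uniq_mem ?iota_uniq // mem_iota.
  by move=> x /=; rewrite !eqxx andbT.
rewrite /corr; case: (leqP j j') => h; rewrite ?count_rev H subnKC ?(ltnW h) //.
Qed.

Lemma corr_facts d l e j j' d1 l1 lo hi :
  [/\ all okit (corr R n d l e j j'), filter nc (corr R n d l e j j') = [::]
    & count (grp d1 l1 lo hi) (corr R n d l e j j') = 0%N].
Proof.
rewrite /corr; case: (leqP j j') => _; split; rewrite ?all_rev ?filter_rev ?count_rev;
  by [elim: iota => //=|elim: (iota _ _) => //= x s ->|elim: iota j|elim: (iota _ _)].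
Qed.

Lemma step_dir b a d l j x crn : step b (X n d l j x crn) = Some a ->
  exists s : bool, b = mk d (l + s)%N j /\ a = mk d (l + ~~ s)%N j.
Proof.
rewrite /=; case: eqP => [-> [<-]|_]; first by exists false; rewrite addn0 addn1.
by case: eqP => // -> [<-]; exists true; rewrite addn0 addn1.
Qed.

Lemma step_dir' d l j x crn (s : bool) :
  step (mk d (l + s)%N j) (X n d l j x crn) = Some (mk d (l + ~~ s)%N j).
Proof.
case: s; rewrite /= ?addn0 ?addn1 ?eqxx //.
by case: eqP => // /mk_inj [/esym /n_Sn].
Qed.

(** Bookkeeping of the 2-exchange: two original crossings disappear, and every perpendicular line
    between them gains one corner crossing on each side of the patched line. *)
Lemma pair_step c c' a z d l P Q S j j' (x x' : R) (s : bool) :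
  walk c P (mk d (l + s)%N j) -> walk (mk d (l + ~~ s)%N j) Q (mk d (l + s)%N j') ->
  walk (mk d (l + ~~ s)%N j') S c' ->
  let w := P ++ X n d l j x false :: Q ++ X n d l j' x' false :: S in
  all okit w ->
  exists w', [/\ walk c w' c', all okit w',
    plen a (rcons (map ptof w') z) <=
      plen a (rcons (map ptof w) z) + 2 * `|x - x'|,
    perm_eq (filter nc w)
      (filter nc w' ++ [:: X n d l j x false; X n d l j' x' false]) &
    forall d' k e, (count (crnAt d' k e) w' <= count (crnAt d' k e) w +
      [&& d' == ~~ d, side e l, minn j j' <= k & k < maxn j j'])%N].
Proof.
move=> hP hQ hS w; rewrite all_cat /= all_cat /= => /and5P[okP okx okQ okx' okS].
have [h1 h2] := two_opt a hP (step_dir' d l j x false s) hQ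
  (step_dir' d l j' x' false s) hS okx okx'.
exists (P ++ corr R n d l (l + s) j j' ++ rev Q ++ corr R n d l (l + ~~ s) j j' ++ S).
have [c1 c2 _] := corr_facts d l (l + s) j j' d l 0 0.
have [c3 c4 _] := corr_facts d l (l + ~~ s) j j' d l 0 0.
split.
- exact: h1.
- by rewrite !all_cat okP c1 all_rev okQ c3 okS.
- exact: h2.
- rewrite /w !filter_cat /= !filter_cat /= c2 c4 /= filter_rev.
  by apply/permP => p; rewrite !count_cat /= !count_cat count_rev /=; clear; lia.
- move=> d' k e; rewrite /w !count_cat /= !count_cat /= count_rev !count_corr /side.
  clear; case: (d' == ~~ d) => /=; last by lia.
  case: s => /=; rewrite ?addn0 ?addn1;
    case: (eqVneq e l) => [->|_] /=; rewrite ?(ltn_eqF (ltnSn _)) /=; lia.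
Qed.

Lemma subseq_split (T : eqType) (y : T) ys t : subseq (y :: ys) t ->
  exists a b, t = a ++ y :: b /\ subseq ys b.
Proof.
elim: t => //= x t IH; case: eqP => [->|_]; first by exists [::], t.
by move=> /IH[a [b [-> h]]]; exists (x :: a), b.
Qed.

Lemma perm3_cases (T : eqType) (a b c x y z : T) :
  perm_eq [:: a; b; c] [:: x; y; z] ->
  [\/ c = x /\ (a = y /\ b = z \/ a = z /\ b = y),
      c = y /\ (a = x /\ b = z \/ a = z /\ b = x) |
      c = z /\ (a = x /\ b = y \/ a = y /\ b = x)].
Proof.
move=> h.
have two (p q r s : T) : perm_eq [:: p; q] [:: r; s] -> p = r /\ q = s \/ p = s /\ q = r.
  move=> h2; have := perm_mem h2 p; rewrite !inE eqxx /= => /esym /orP[]/eqP E; subst p.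
    by left; split=> //; move: h2; rewrite perm_cons => /perm_mem /(_ q); rewrite !inE eqxx => /esym /eqP.
  right; split=> //; have : perm_eq [:: s; q] [:: s; r].
    by apply: perm_trans h2 _; rewrite (perm_catC [:: r] [:: s]).
  by rewrite perm_cons => /perm_mem /(_ q); rewrite !inE eqxx => /esym /eqP.
have h' : perm_eq [:: c; a; b] [:: x; y; z].
  by apply: perm_trans h; rewrite (perm_catC [:: c] [:: a; b]).
have := perm_mem h' c; rewrite !inE eqxx /= => /esym /or3P[]/eqP E; subst c.
- by apply: Or31; split=> //; apply: two; rewrite perm_cons in h'.
- apply: Or32; split=> //; apply: two; rewrite -(perm_cons y).
  by apply: perm_trans h' _; rewrite (perm_cat2r [:: z] [:: x; y] [:: y; x]) (perm_catC [:: x] [:: y]).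
- apply: Or33; split=> //; apply: two; rewrite -(perm_cons z).
  by apply: perm_trans h' _; rewrite (perm_catC [:: x; y] [:: z]).
Qed.

(* Among three crossings of a line, two are traversed in the same direction. *)
Lemma same_direction c c' w d l lo hi x1 x2 x3 rest :
  walk c w c' -> perm_eq (filter (grp d l lo hi) w) [:: x1, x2, x3 & rest] ->
  exists P Q S x y u (s : bool), [/\ w = P ++ x :: Q ++ y :: S,
    perm_eq [:: x; y; u] [:: x1; x2; x3],
    walk c P (mk d (l + s)%N (prow x)),
    walk (mk d (l + ~~ s)%N (prow x)) Q (mk d (l + s)%N (prow y)) &
    walk (mk d (l + ~~ s)%N (prow y)) S c'].
Proof.
move=> hw hp.
have [ys hys pys] : exists2 ys, subseq ys (filter (grp d l lo hi) w) &
    perm_eq [:: x1; x2; x3] ys.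
  by apply/count_subseqP => x; rewrite (permP hp) /=; lia.
have all_ys : all (grp d l lo hi) ys.
  by apply/allP => x /(mem_subseq hys); rewrite mem_filter => /andP[].
have {}hys := subseq_trans hys (filter_subseq _ _).
have := perm_size pys; case: ys => [|y1 [|y2 [|y3 [|//]]]] // in hys pys all_ys * => _.
have [w1 [b1 [E1 /subseq_split[w2 [b2 [E2 /subseq_split[w3 [w4 [E3 _]]]]]]]]] :=
  subseq_split hys.
move: all_ys => /= /and4P[g1 g2 g3 _]; rewrite perm_sym in pys.
have [Y1 _ _] := grpP g1; have [Y2 _ _] := grpP g2; have [Y3 _ _] := grpP g3.
have sg y b t cf : y = X n d l (prow y) (ppos y) false -> walk b (y :: t) cf ->
    exists s : bool, b = mk d (l + s)%N (prow y) /\ walk (mk d (l + ~~ s)%N (prow y)) t cf.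
  move=> Y; rewrite [walk _ _ _]/= -/walk; case E : (step b y) => [a|//] ht.
  by rewrite Y in E; have [s [-> Ea]] := step_dir E; exists s; rewrite -Ea.
have wcons y t cf (s : bool) : y = X n d l (prow y) (ppos y) false ->
    walk (mk d (l + ~~ s)%N (prow y)) t cf -> walk (mk d (l + s)%N (prow y)) (y :: t) cf.
  move=> Y h; rewrite Y; rewrite [walk _ _ _]/= -/walk -[X in if X is Some _ then _ else _]/(step _ (X n d l (prow y) (ppos y) false)).
  by rewrite step_dir' /=.
move: hw; rewrite E1 E2 E3 => /walk_cat[m1 [h1 /(sg _ _ _ _ Y1)[s1 [M1]]]].
move=> /walk_cat[m2 [h2 /(sg _ _ _ _ Y2)[s2 [M2]]]].
move=> /walk_cat[m3 [h3 /(sg _ _ _ _ Y3)[s3 [M3 h4]]]]; subst m1 m2 m3.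
have p13 : perm_eq [:: y1; y3; y2] [:: x1; x2; x3].
  by apply: perm_trans pys; rewrite perm_cons (perm_catC [:: y3] [:: y2]).
have p23 : perm_eq [:: y2; y3; y1] [:: x1; x2; x3].
  by apply: perm_trans pys; rewrite (perm_catC [:: y2; y3] [:: y1]).
case: (eqVneq s1 s2) => [E|n12]; first subst s2.
  exists w1, w2, (w3 ++ y3 :: w4), y1, y2, y3, s1; split=> //.
  apply/walk_cat; eexists; split; first exact: h3.
  exact: wcons.
case: (eqVneq s1 s3) => [E|n13]; first subst s3.
  exists w1, (w2 ++ y2 :: w3), w4, y1, y3, y2, s1; split=> //.
    by rewrite -!catA.
  apply/walk_cat; eexists; split; first exact: h2.
  exact: wcons.
have E : s2 = s3 by case: s1 s2 s3 n12 n13 {h1 h2 h3 h4} => [] [] [].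
subst s3; exists (w1 ++ y1 :: w2), w3, w4, y2, y3, y1, s2; split=> //.
  by rewrite -!catA.
apply/walk_cat; eexists; split; first exact: h1.
exact: wcons.
Qed.

Definition le_it (x y : item) : bool := (prow x <= prow y)%N && (ppos x <= ppos y).

(** An exchange always takes two of the three lowest crossings, the list being sorted. The distances
    from the two lowest ones to the upper end [h] pay for the exchange and for the potential of what
    remains; so they bound the cost of the whole patching, however many exchanges it takes. *)
Definition pot (gs : seq item) (h : R) : R :=
  match gs with
  | [::] => 0
  | [:: x] => h - ppos x
  | x :: y :: _ => (h - ppos x) + (h - ppos y)
  end.

(** Discrete counterpart of [pot]: it bounds how often corridors can still sweep across position
    [k], hence at most twice in all. *)
Definition potn (gs : seq item) (k : nat) : nat :=
  match gs with
  | [::] => 0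
  | [:: x] => prow x <= k
  | x :: y :: _ => (prow x <= k) + (prow y <= k)
  end.

#[local] Arguments pot : simpl never.
#[local] Arguments potn : simpl never.

(** The three ways to remove a pair from the lowest crossings [p <= q <= r]; the survivor and the
    next crossing [t] are then the two lowest. The same case distinction is made for real positions
    in [dist_pot]. *)
Lemma cover_pot (lo hi p q r t k : nat) : (p <= q)%N -> (q <= r)%N -> (r <= t)%N ->
  let cov i j := [&& lo <= k, k.+1 < hi, minn i j <= k & k < maxn i j]%N : nat in
  [/\ (cov p q + ((r <= k) + (t <= k)) <= (p <= k) + (q <= k))%N,
      (cov q r + ((p <= k) + (t <= k)) <= (p <= k) + (q <= k))%N &
      (cov p r + ((q <= k) + (t <= k)) <= (p <= k) + (q <= k))%N].
Proof. by move=> pq qr rt /=; split; lia. Qed.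

Lemma dist_pot (p q r t h : R) : p <= q -> q <= r -> r <= t ->
  [/\ `|p - q| + ((h - r) + (h - t)) <= (h - p) + (h - q),
      `|q - r| + ((h - p) + (h - t)) <= (h - p) + (h - q) &
      `|p - r| + ((h - q) + (h - t)) <= (h - p) + (h - q)].
Proof.
move=> pq qr rt; rewrite [`|p - q|]distrC [`|q - r|]distrC [`|p - r|]distrC.
by rewrite !ger0_norm ?subr_ge0 ?(le_trans pq qr) //; split; lra.
Qed.

Lemma patch_step (lo hi : nat) d l (x1 x2 x3 u x y : item) rest :
  all (grp d l lo hi) [:: x1, x2, x3 & rest] -> all okit [:: x1, x2, x3 & rest] ->
  pairwise le_it [:: x1, x2, x3 & rest] -> perm_eq [:: x; y; u] [:: x1; x2; x3] ->
  [/\ pairwise le_it (u :: rest),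
    `|ppos x - ppos y| + pot (u :: rest) hi%:R <= pot [:: x1, x2, x3 & rest] hi%:R &
    forall k, ([&& lo <= k, k.+1 < hi, minn (prow x) (prow y) <= k &
                 k < maxn (prow x) (prow y)] +
       potn (u :: rest) k <= potn [:: x1, x2, x3 & rest] k)%N].
Proof.
move=> /= /and4P[g1 g2 g3 gr] /and4P[ok1 ok2 ok3 okr].
move=> /and4P[/and3P[l12 l13 l1] /andP[l23 l2] l3 pr] /perm3_cases pc.
(* [t] and [T] belong to the fourth crossing, or are the upper end [hi] of the segment when only
   three are left. *)
have [t [T [tp Tp pot_t potn_t]]] : exists t T, [/\ ppos x3 <= t,
    (prow x3 <= T)%N /\ (forall it, it \in [:: x1; x2; x3] -> all (le_it it) rest),
    forall it, pot (it :: rest) hi%:R = (hi%:R - ppos it) + (hi%:R - t) &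
    forall it k, (k.+1 < hi)%N -> potn (it :: rest) k = ((prow it <= k) + (T <= k))%N].
  have al it : it \in [:: x1; x2; x3] -> all (le_it it) rest.
    by rewrite !inE => /or3P[]/eqP ->.
  case: rest gr okr l1 l2 l3 pr al => [|x4 rest] /= gr okr l1 l2 l3 pr al.
    exists hi%:R, hi; have [X3 _ h3] := grpP g3; split.
    - by rewrite X3 /= in ok3; case/andP: ok3 => _ h; apply: le_trans h _; rewrite ler_nat.
    - by split=> //; apply: ltnW.
    - by move=> it; rewrite /pot subrr addr0.
    - by move=> it k hk; rewrite /potn [(hi <= k)%N]leqNgt (ltnW hk) addn0.
  by case/andP: l3 => /andP[r34 p34] _; exists (ppos x4), (prow x4).
case: Tp => Tp al.
move: l12 l13 l23 => /andP[r12 p12] /andP[r13 p13] /andP[r23 p23].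
have [D1 D2 D3] := dist_pot hi%:R p12 p23 tp.
have C k := cover_pot lo hi k r12 r23 Tp.
split.
- by rewrite /= pr andbT al //; case: pc => -[-> _]; rewrite !inE eqxx ?orbT.
- rewrite pot_t; case: pc => -[-> [[-> ->]|[-> ->]]] //; by rewrite distrC.
- move=> k.
  have -> : potn [:: x1, x2, x3 & rest] k = ((prow x1 <= k) + (prow x2 <= k))%N by [].
  case: (ltnP k.+1 hi) => hk; last first.
    rewrite ?andbF /= add0n.
    case: (ltnP k hi) => hk'; last first.
      have [_ _ h1] := grpP g1; have [_ _ h2] := grpP g2.
      rewrite (leq_trans (ltnW h1) hk') (leq_trans (ltnW h2) hk').
      by case: rest {gr okr l1 l2 l3 pr al pot_t potn_t} => [|x4 rest]; 
        rewrite /potn; move: (prow u <= k)%N => []; try move: (prow x4 <= k)%N => [].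
    have [_ _ h1] := grpP g1; have [_ _ h2] := grpP g2.
    have q1 : (prow x1 <= k)%N by rewrite -ltnS (leq_trans h1 hk).
    have q2 : (prow x2 <= k)%N by rewrite -ltnS (leq_trans h2 hk).
    rewrite q1 q2.
    by case: rest {gr okr l1 l2 l3 pr al pot_t potn_t} => [|x4 rest]; 
        rewrite /potn; move: (prow u <= k)%N => []; try move: (prow x4 <= k)%N => [].
  have [C1 C2 C3] := C k; rewrite hk !andTb in C1 C2 C3.
  by rewrite potn_t //; case: pc => -[-> [[-> ->]|[-> ->]]] //; rewrite minnC maxnC.
Qed.

(** Exchanges are repeated while at least three crossings of the segment are left, two of which must
    agree in direction; the decrease of [pot] and [potn] pays for the added length and corners. *)
Lemma patch_ind c a z d l lo hi m w gs : (size gs <= m)%N ->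
  walk c w c -> all okit w -> perm_eq (filter (grp d l lo hi) w) gs ->
  pairwise le_it gs ->
  exists w' rem,
  [/\ walk c w' c, all okit w',
      plen a (rcons (map ptof w') z) <=
        plen a (rcons (map ptof w) z) + 2 * pot gs hi%:R,
      perm_eq (filter nc w) (filter nc w' ++ rem) /\ all (grp d l lo hi) rem &
      (count (grp d l lo hi) w' <= 2)%N /\
      forall d' k e, (count (crnAt d' k e) w' <= count (crnAt d' k e) w +
        [&& d' == ~~ d, side e l, lo <= k & k.+1 < hi] * potn gs k)%N].
Proof.
elim: m w gs => [|m IH] w gs szgs hw ok hp pw.
  exists w, [::]; case: gs szgs hp {pw} => // _ hp; split=> //.
  - by rewrite mulr0 addr0.
  - by rewrite cats0.
  - by split=> [|d' k e]; rewrite ?leq_addr // -size_filter (perm_size hp).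
have agr : all (grp d l lo hi) gs by rewrite -(perm_all _ hp) filter_all.
have okg : all okit gs.
  by rewrite -(perm_all _ hp) all_filter; apply: sub_all ok => x /= ->; rewrite implybT.
have pot0 : 0 <= pot gs hi%:R.
  have bd t : t \in gs -> 0 <= hi%:R - ppos t.
    move=> tg; have := allP okg _ tg; have /grpP[-> _ hh] := allP agr _ tg.
    by move=> /= /andP[_ h]; rewrite subr_ge0; apply: le_trans h _; rewrite ler_nat.
  case: gs bd {szgs hp pw agr okg} => [|x [|y gs]] bd; rewrite /pot //; first exact: bd (mem_head _ _).
  by rewrite addr_ge0 // bd // !inE eqxx ?orbT.
case: (leqP (size gs) 2) => [sz2|].
  exists w, [::]; split=> //.
  - by rewrite lerDl mulr_ge0.
  - by rewrite cats0.
  - by split=> [|d' k e]; rewrite ?leq_addr // -size_filter (perm_size hp).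
case: gs szgs hp pw agr okg {pot0} => [|x1 [|x2 [|x3 rest]]] // szgs hp pw agr okg _.
have [P [Q [S [x [y [u [s [E pxyu hP hQ hS]]]]]]]] := same_direction hw hp.
have := agr; rewrite -[[:: x1, x2, x3 & rest]]/([:: x1; x2; x3] ++ rest) all_cat.
rewrite -(perm_all _ pxyu) => /andP[/and4P[gx gy gu _] gr].
have [X1 lox hix] := grpP gx; have [Y1 loy hiy] := grpP gy.
have [pw' hpot hpotn] := patch_step agr okg pw pxyu.
have := @pair_step c c a z d l P Q S (prow x) (prow y) (ppos x) (ppos y) s hP hQ hS.
rewrite -X1 -Y1 -E => /(_ ok)[w1 [hw1 ok1 len1 perm1 crn1]].
have hp1 : perm_eq (filter (grp d l lo hi) w1) (u :: rest).
  have gnc v : filter (grp d l lo hi) v = filter (grp d l lo hi) (filter nc v).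
    rewrite -filter_predI; apply: eq_filter => t /=.
    by case: (boolP (grp _ _ _ _ t)) => // /grp_nc ->.
  have h := perm_filter (grp d l lo hi) perm1.
  rewrite -gnc filter_cat -gnc /= gx gy in h.
  rewrite -(perm_cat2r [:: x; y]); rewrite perm_sym.
  apply: perm_trans h; rewrite perm_sym; apply: perm_trans hp _.
  rewrite -[[:: x1, x2, x3 & rest]]/([:: x1; x2; x3] ++ rest).
  apply: perm_trans (_ : perm_eq _ ([:: x; y; u] ++ rest)) _.
    by rewrite perm_cat2r perm_sym.
  by rewrite (perm_catC [:: x; y] (u :: rest)).
have szm : (size (u :: rest) <= m)%N by apply: ltnW.
have [w' [rem [hw' ok' len' [perm' allrem] [cnt' crn']]]] :=
  IH _ _ szm hw1 ok1 hp1 pw'.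
exists w', (rem ++ [:: x; y]); split=> //.
- apply: le_trans len' _; move: len1 hpot; lra.
- split; last by rewrite all_cat allrem /= gx gy.
  apply: perm_trans perm1 _; rewrite catA perm_cat2r //.
- split=> // d' k e; apply: leq_trans (crn' d' k e) _.
  have := crn1 d' k e; have := hpotn k.
  have cov : (minn (prow x) (prow y) <= k < maxn (prow x) (prow y))%N ->
     (lo <= k)%N && (k.+1 < hi)%N.
    by move: lox hix loy hiy; clear; lia.
  move: cov (potn (u :: rest) k) (potn [:: x1, x2, x3 & rest] k)
    (count _ w) (count _ w1); clear.
  case: (minn _ _ <= k)%N; case: (k < _)%N => //=; rewrite ?andbF ?addn0;
    try (move=> /(_ isT) => /andP[-> ->]);
  case: (d' == ~~ d); case: (side e l); try case: (lo <= k)%N; try case: (k.+1 < hi)%N => //=; lia.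
Qed.

(** Each potential involves two crossings, so [pot] is at most twice the length of the segment and
    [potn] at most 2. The two corridors of an exchange double the former, which gives the factor
    4. *)
Lemma patch_group c a z d l lo hi w : walk c w c -> all okit w -> (lo <= hi)%N ->
  exists w' rem,
  [/\ walk c w' c, all okit w',
      plen a (rcons (map ptof w') z) <=
        plen a (rcons (map ptof w) z) + 4 * (hi - lo)%N%:R,
      perm_eq (filter nc w) (filter nc w' ++ rem) /\ all (grp d l lo hi) rem &
      (count (grp d l lo hi) w' <= 2)%N /\
      forall d' k e, (count (crnAt d' k e) w' <= count (crnAt d' k e) w +
        2 * [&& d' == ~~ d, side e l, lo <= k & k.+1 < hi])%N].
Proof.
move=> hw ok lohi.
(* A crossing at an integer position may belong to either adjacent wall, so rows are compared first;
   [okit] then makes the positions monotone as well. *)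
pose lex (x y : item) := (prow x < prow y)%N || (prow x == prow y) && (ppos x <= ppos y).
have lex_total : total lex.
  move=> x y; rewrite /lex; case: (ltngtP (prow x) (prow y)) => //= _; exact: le_total.
have lex_trans : transitive lex.
  move=> y x t; rewrite /lex => /orP[h1|/andP[/eqP -> h1]] /orP[h2|/andP[/eqP <- h2]].
  - by rewrite (ltn_trans h1 h2).
  - by rewrite h1.
  - by rewrite h2.
  - by rewrite eqxx (le_trans h1 h2) orbT.
set F := filter (grp d l lo hi) w; pose gs := sort lex F.
have perm_gs : perm_eq F gs by rewrite perm_sym perm_sort.
have agr : all (grp d l lo hi) gs by rewrite -(perm_all _ perm_gs) filter_all.
have okg : all okit gs.
  by rewrite -(perm_all _ perm_gs) all_filter; apply: sub_all ok => x /= ->; rewrite implybT.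
have pw : pairwise le_it gs.
  have srt : pairwise lex gs by rewrite -sorted_pairwise // sort_sorted.
  apply/(pairwiseP (inr (true, 0%N, 0%N, 0, true))) => i j hi' hj ij.
  have := pairwiseP (inr (true, 0%N, 0%N, 0, true)) srt i j hi' hj ij.
  set p := nth _ gs i; set q := nth _ gs j.
  have [gp gq] : grp d l lo hi p /\ grp d l lo hi q by split; apply: (allP agr); rewrite mem_nth.
  have [okp okq] : okit p /\ okit q by split; apply: (allP okg); rewrite mem_nth.
  rewrite /lex /le_it; move: okp okq; have [-> _ _] := grpP gp; have [-> _ _] := grpP gq.
  move=> /= /andP[_ h1] /andP[h2 _] /orP[h|/andP[/eqP ->]]; last by rewrite leqnn.
  rewrite (ltnW h) /=; apply: le_trans h1 _; apply: le_trans h2; by rewrite ler_nat.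
have [w' [rem [h1 h2 h3 h4 [h5 h6]]]] := patch_ind a z (leqnn _) hw ok perm_gs pw.
exists w', rem; split=> //.
- apply: le_trans h3 _; rewrite lerD2l.
  have bd t : t \in gs -> hi%:R - ppos t <= (hi - lo)%N%:R.
    move=> tg; have := allP okg _ tg; have /grpP[-> hl _] := allP agr _ tg.
    move=> /= /andP[h _]; rewrite natrB // lerD2l lerN2; apply: le_trans h; by rewrite ler_nat.
  have b0 : 0 <= (hi - lo)%N%:R :> R by [].
  case: gs bd {perm_gs agr okg pw h6} => [|x [|y gs]] bd; rewrite /pot; first by move: b0; lra.
    by have := bd _ (mem_head _ _); move: b0; lra.
  have hx := bd _ (mem_head _ _).
  have hy : y \in [:: x, y & gs] by rewrite !inE eqxx orbT.
  by have := bd _ hy; move: hx; lra.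
- split=> // d' k e; apply: leq_trans (h6 d' k e) _; rewrite leq_add2l mulnC leq_mul2r.
  by apply/orP; right; case: gs {perm_gs agr okg pw h3 h6} => [|x [|y gs]]; rewrite /potn //; clear; lia.
Qed.

End Patch.

(** * The walk of a tour *)

Section TourWalk.
Variables (R : realType) (n : nat) (loc : option 'I_n -> R * R).
Local Notation item := (item R n).
Local Notation ptof := (ptof loc).
Local Notation walk := (walk loc).

Definition plain (it : item) : bool :=
  if it is inr (_, _, j, x, crn) then ~~ crn && (j%:R <= x <= j.+1%:R) else false.

Definition getT (it : item) : option 'I_n := if it is inl v then Some v else None.

Definition nd (a b : nat) : nat := (a - b + (b - a))%N.

Lemma between_param (x y t : R) : x < y -> x <= t <= y ->
  0 <= (t - x) / (y - x) <= 1 /\ x + (t - x) / (y - x) * (y - x) = t.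
Proof.
move=> xy /andP[xt ty]; have yx : 0 < y - x by rewrite subr_gt0.
split; last by rewrite divfK ?gt_eqF // addrC subrK.
by apply/andP; split; [rewrite divr_ge0 ?subr_ge0 // ltW|rewrite ler_pdivrMr // mul1r lerD2r].
Qed.

Lemma convex_bound (x y u lo hi : R) : 0 <= u <= 1 -> lo <= x <= hi ->
  lo <= y <= hi -> lo <= x + u * (y - x) <= hi.
Proof. by move=> /andP[? ?] /andP[? ?] /andP[? ?]; apply/andP; split; nra. Qed.

(** Induction on the number of horizontal lines to be met, cutting the segment at the next one. The
    column is closed on both sides because a piece may end on the vertical line where [vwalk_up]
    cuts. *)
Lemma hwalk_up (e m : nat) (p q : R * R) : 0 <= p.2 -> 0 <= q.2 ->
  e%:R <= p.1 <= e.+1%:R -> e%:R <= q.1 <= e.+1%:R ->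
  Num.trunc q.2 = (Num.trunc p.2 + m)%N ->
  exists w, [/\ walk (e, Num.trunc p.2) w (e, Num.trunc q.2),
    plen p (rcons (map ptof w) q) <= edist p q, all plain w & size w = m].
Proof.
elim: m p => [|m IH] p p0 q0 hp hq E.
  by exists [::]; rewrite /= E addn0 eqxx addr0.
set r := Num.trunc p.2 in E *.
have pr : p.2 < r.+1%:R by apply: truncnS_gt.
have qr : r.+1%:R <= q.2 by rewrite -truncn_ge_nat // E addnS ltnS leq_addr.
have [u01 uE] := between_param (lt_le_trans pr qr) (introT andP (conj (ltW pr) qr)).
set u := _ / _ in u01 uE; pose z := (p.1 + u * (q.1 - p.1), p.2 + u * (q.2 - p.2)).
have z2 : z.2 = r.+1%:R by [].
have z1 : e%:R <= z.1 <= e.+1%:R by apply: convex_bound.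
have Ez : Num.trunc z.2 = r.+1 by rewrite z2 natrK.
have [||w [w1 w2 w3 w4]] := IH z _ q0 z1 hq; first by rewrite z2.
  by rewrite Ez E addnS addSn.
rewrite Ez in w1.
exists (X n false r e z.1 false :: w); split.
- by rewrite /= eqxx.
- have Pz : ptof (X n false r e z.1 false) = z by rewrite [RHS]surjective_pairing z2.
  by rewrite map_cons rcons_cons Pz [plen _ _]/= -(edist_between p q u01) lerD2l.
- by rewrite /= z1.
- by rewrite /= w4.
Qed.

Lemma hwalk (e : nat) (p q : R * R) : 0 <= p.2 -> 0 <= q.2 ->
  e%:R <= p.1 <= e.+1%:R -> e%:R <= q.1 <= e.+1%:R ->
  exists w, [/\ walk (e, Num.trunc p.2) w (e, Num.trunc q.2),
    plen p (rcons (map ptof w) q) <= edist p q, all plain w &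
    size w = nd (Num.trunc p.2) (Num.trunc q.2)].
Proof.
move=> p0 q0 hp hq; rewrite /nd; case: (leqP (Num.trunc p.2) (Num.trunc q.2)) => h.
  have [w [w1 w2 w3 w4]] := hwalk_up p0 q0 hp hq (esym (subnKC h)).
  by exists w; split=> //; rewrite w4; move: h; clear; lia.
have [w [w1 w2 w3 w4]] := hwalk_up q0 p0 hq hp (esym (subnKC (ltnW h))).
exists (rev w); split.
- exact: walk_rev.
- by rewrite map_rev plen_rev revK edistC.
- by rewrite all_rev.
- by rewrite size_rev w4; move: h; clear; lia.
Qed.

Lemma nd_between (a b c : nat) : (a <= b <= c)%N || (c <= b <= a)%N ->
  (nd a b + nd b c = nd a c)%N.
Proof. by rewrite /nd; lia. Qed.

(** The segment is cut at the next vertical line; inside a column only horizontal lines are met. The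
    counts of horizontal lines before and after the cut add up because the cut point lies between
    the ends. *)
Lemma vwalk_up (m : nat) (p q : R * R) : 0 <= p.1 -> 0 <= q.1 -> 0 <= p.2 -> 0 <= q.2 ->
  Num.trunc q.1 = (Num.trunc p.1 + m)%N ->
  exists w, [/\ walk (cellof p) w (cellof q),
    plen p (rcons (map ptof w) q) <= edist p q, all plain w &
    size w = (m + nd (Num.trunc p.2) (Num.trunc q.2))%N].
Proof.
elim: m p => [|m IH] p p0 q0 p0' q0' E.
  rewrite addn0 in E.
  have [||w [w1 w2 w3 w4]] := @hwalk (Num.trunc p.1) p q p0' q0'.
  - by have /andP[h1 h2] := truncn_itv p0; rewrite h1 ltW.
  - by have /andP[h1 h2] := truncn_itv q0; rewrite -E h1 ltW.
  by exists w; split=> //; rewrite /cellof E.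
set r := Num.trunc p.1 in E *.
have pr : p.1 < r.+1%:R by apply: truncnS_gt.
have qr : r.+1%:R <= q.1 by rewrite -truncn_ge_nat // E addnS ltnS leq_addr.
have [u01 uE] := between_param (lt_le_trans pr qr) (introT andP (conj (ltW pr) qr)).
set u := _ / _ in u01 uE; pose z := (p.1 + u * (q.1 - p.1), p.2 + u * (q.2 - p.2)).
have z1 : z.1 = r.+1%:R by [].
have Ez : Num.trunc z.1 = r.+1 by rewrite z1 natrK.
have zb : p.2 <= z.2 <= q.2 \/ q.2 <= z.2 <= p.2.
  case: (leP p.2 q.2) => h; [left|right]; apply: convex_bound; rewrite ?lexx //.
  - by rewrite h.
  - by rewrite ltW.
  - by rewrite ltW.
have z0 : 0 <= z.2 by case: zb => /andP[h _]; apply: le_trans h.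
have [||wa [a1 a2 a3 a4]] := @hwalk r p z p0' z0.
- by have /andP[h1 h2] := truncn_itv p0; rewrite h1 ltW.
- by rewrite z1 lexx andbT ler_nat.
have [||wb [b1 b2 b3 b4]] := IH z _ q0 z0 q0'; first by rewrite z1.
  by rewrite Ez E addnS addSn.
have bz := truncn_itv z0.
exists (wa ++ X n true r (Num.trunc z.2) z.2 false :: wb); split.
- apply/walk_cat; exists (r, Num.trunc z.2); split=> //=.
  by rewrite eqxx; rewrite /cellof Ez in b1.
- have Pz : ptof (X n true r (Num.trunc z.2) z.2 false) = z.
    by rewrite [RHS]surjective_pairing z1.
  rewrite map_cat rcons_cat map_cons rcons_cons Pz.
  rewrite -cat_rcons plen_cat last_rcons -(edist_between p q u01).
  exact: lerD.
- rewrite all_cat a3 /= b3 andbT; case/andP: bz => -> h /=; exact: ltW.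
- have nb : (nd (Num.trunc p.2) (Num.trunc z.2) + nd (Num.trunc z.2) (Num.trunc q.2) =
      nd (Num.trunc p.2) (Num.trunc q.2))%N.
    by apply: nd_between; case: zb => /andP[h1 h2]; rewrite (le_truncn h1) (le_truncn h2) ?orbT.
  rewrite size_cat a4 [size (_ :: _)]/= b4 -nb.
  move: (nd _ _) (nd _ _) => i j; clear; lia.
Qed.

Lemma vwalk (p q : R * R) : 0 <= p.1 -> 0 <= q.1 -> 0 <= p.2 -> 0 <= q.2 ->
  exists w, [/\ walk (cellof p) w (cellof q),
    plen p (rcons (map ptof w) q) <= edist p q, all plain w &
    size w = (nd (Num.trunc p.1) (Num.trunc q.1) + nd (Num.trunc p.2) (Num.trunc q.2))%N].
Proof.
move=> p0 q0 p0' q0'; case: (leqP (Num.trunc p.1) (Num.trunc q.1)) => h.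
  have [w [w1 w2 w3 w4]] := vwalk_up p0 q0 p0' q0' (esym (subnKC h)).
  by exists w; split=> //; rewrite w4; move: h; rewrite /nd; clear; lia.
have [w [w1 w2 w3 w4]] := vwalk_up q0 p0 q0' p0' (esym (subnKC (ltnW h))).
exists (rev w); split.
- exact: walk_rev.
- by rewrite map_rev plen_rev revK edistC.
- by rewrite all_rev.
- by rewrite size_rev w4; move: h; rewrite /nd; clear; lia.
Qed.

Lemma nd_trunc (x y : R) : 0 <= x -> 0 <= y ->
  (nd (Num.trunc x) (Num.trunc y))%:R <= `|x - y| + 1.
Proof.
move=> x0 y0; have /andP[a b] := truncn_itv x0; have /andP[c d] := truncn_itv y0.
rewrite /nd; case: (leqP (Num.trunc x) (Num.trunc y)) => h.
  have -> : (Num.trunc x - Num.trunc y + (Num.trunc y - Num.trunc x) =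
    Num.trunc y - Num.trunc x)%N by move: h; clear; lia.
  rewrite natrB //; rewrite -natr1 in b; have := ler_norm (y - x); rewrite distrC; lra.
have -> : (Num.trunc x - Num.trunc y + (Num.trunc y - Num.trunc x) =
    Num.trunc x - Num.trunc y)%N by move: h; clear; lia.
rewrite natrB ?(ltnW h) //; rewrite -natr1 in d; have := ler_norm (x - y); lra.
Qed.

Hypothesis loc_ge0 : forall x, 0 <= (loc x).1 /\ 0 <= (loc x).2.
Hypothesis loc_sep : forall x y, loc x = loc y \/ 2 <= edist (loc x) (loc y).

(** Each direction contributes at most its extent plus one, so a leg of length [D] meets at most
    [2 D + 2] walls, and [2 D + 2 <= 3 D] once distinct locations are at distance at least 2. The
    depot may coincide with a terminal, whence the case of equal locations. *)
Lemma edge_walk x y : exists w, [/\ walk (cellof (loc x)) w (cellof (loc y)),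
    plen (loc x) (rcons (map ptof w) (loc y)) <= edist (loc x) (loc y),
    all plain w & (size w)%:R <= 3 * edist (loc x) (loc y)].
Proof.
have [x1 x2] := loc_ge0 x; have [y1 y2] := loc_ge0 y.
have [w [w1 w2 w3 w4]] := vwalk x1 y1 x2 y2; exists w; split=> //.
case: (loc_sep x y) => [E|h].
  by rewrite w4 E /nd !subnn edistpp mulr0.
have := nd_trunc x1 y1; have := nd_trunc x2 y2; have [] := edist_coord (loc x) (loc y).
rewrite w4 natrD; lra.
Qed.

Lemma tour_walk x y (s : seq 'I_n) :
  exists w, [/\ walk (cellof (loc x)) w (cellof (loc y)),
    plen (loc x) (rcons (map ptof w) (loc y)) <=
      plen (loc x) (rcons (map (loc \o Some) s) (loc y)),
    all (fun it => isSome (getT it) || plain it) w, pmap getT w = s &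
    (count plain w)%:R <= 3 * plen (loc x) (rcons (map (loc \o Some) s) (loc y))].
Proof.
have plT w : all plain w -> pmap getT w = [::] /\ all (fun it => isSome (getT it) || plain it) w.
  elim: w => //= it w IH /andP[h /IH[-> ->]]; rewrite h orbT andbT.
  by case: it h.
elim: s x => [|v s IH] x /=.
  have [w [w1 w2 w3 w4]] := edge_walk x y; have [h1 h2] := plT w w3.
  exists w; rewrite !addr0; split=> //; apply: le_trans w4; by rewrite ler_nat count_size.
have [w [w1 w2 w3 w4]] := edge_walk x (Some v); have [h1 h2] := plT w w3.
have [w' [a1 a2 a3 a4 a5]] := IH (Some v).
exists (w ++ inl v :: w'); split.
- by apply/walk_cat; exists (cellof (loc (Some v))); rewrite /= eqxx.
- rewrite map_cat rcons_cat /= -cat_rcons plen_cat last_rcons; exact: lerD.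
- by rewrite all_cat h2 /= a3.
- by rewrite pmap_cat h1 /= a4.
- rewrite count_cat /= add0n natrD mulrDr; apply: lerD a5.
  by apply: le_trans w4; rewrite ler_nat count_size.
Qed.

End TourWalk.

(** * Dyadic segments of a line and the segments to be patched *)

Section Jobs.
Local Open Scope nat_scope.
Variables (r : nat) (cnt : nat -> nat).

(* [grpn h q] counts the groups of crossings in the segment
   [[q * 2 ^ h, (q + 1) * 2 ^ h)] when every dyadic segment that holds more than
   [r] groups is merged into a single one. *)
Fixpoint grpn (h q : nat) : nat :=
  let s := if h is h'.+1 then (grpn h' q.*2 + grpn h' q.*2.+1)%N else cnt q in
  if (s > r)%N then 1%N else s.

Definition merged (h q : nat) : bool :=
  ((if h is h'.+1 then (grpn h' q.*2 + grpn h' q.*2.+1)%N else cnt q) > r)%N.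

Lemma grpn_le h q : (0 < r)%N -> (grpn h q <= r)%N.
Proof. by move=> r0; case: h => [|h] /=; case: leqP. Qed.

Lemma sum_double (f : nat -> nat) m :
  (\sum_(q < m) (f q.*2 + f q.*2.+1) = \sum_(q < m.*2) f q)%N.
Proof.
elim: m => [|m IH]; first by rewrite !big_ord0.
by rewrite doubleS big_ord_recr /= IH !big_ord_recr /= addnA.
Qed.

(** Each merge replaces more than [r] groups by one and so removes at least [r] of them; no more
    groups can be removed than there were crossings. *)
Lemma sum_merged K : (0 < r)%N ->
  (\sum_(h < K.+1) \sum_(q < 2 ^ (K - h)) merged h q * r <= \sum_(q < 2 ^ K) cnt q)%N.
Proof.
move=> r0.
suff H m : (m <= K)%N -> (\sum_(q < 2 ^ (K - m)) grpn m q +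
   \sum_(h < m.+1) \sum_(q < 2 ^ (K - h)) merged h q * r <= \sum_(q < 2 ^ K) cnt q)%N.
  by apply: leq_trans (H K (leqnn K)); rewrite leq_addl.
elim: m => [|m IH] mK.
  rewrite big_ord_recl big_ord0 addn0 subn0 -big_split /=.
  apply: leq_sum => q _; rewrite /merged; case: leqP => h; rewrite ?mul0n ?addn0 //.
  by rewrite mul1n add1n.
apply: leq_trans (IH (ltnW mK)); rewrite big_ord_recr /= addnCA addnC leq_add2r.
rewrite -big_split /= (_ : (2 ^ (K - m) = (2 ^ (K - m.+1)).*2)%N); last first.
  by rewrite -mul2n -expnS -subSn.
rewrite -(sum_double (grpn m)); apply: leq_sum => q _; rewrite /merged.
case: leqP => h; rewrite ?mul0n ?addn0 ?add0n //.
by rewrite mul1n add1n.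
Qed.

Variables (K z : nat).

(** [z] is the shifted coordinate of the line, which carries sides of dissection squares of size
    [2 ^ h] when [2 ^ h] divides it; such levels are called admissible below. The outermost merged
    segments at admissible levels are the ones to patch. *)
Fixpoint jobs (h q : nat) : seq (nat * nat) :=
  if [&& (h < K)%N, 2 ^ h %| z & merged h q] then [:: (h, q)]
  else if h is h'.+1 then jobs h' q.*2 ++ jobs h' q.*2.+1 else [::].

Definition seg (h q j : nat) : bool := (q * 2 ^ h <= j < q.+1 * 2 ^ h)%N.

Lemma segS h q j : seg h.+1 q j = seg h q.*2 j || seg h q.*2.+1 j.
Proof.
rewrite /seg -!mul2n expnS; move: (2 ^ h)%N => t; apply/idP/idP; last nia.
by move=> H; case: (ltnP j ((2 * q).+1 * t)) => /=; nia.
Qed.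

Lemma seg_disj h q j : seg h q.*2 j -> seg h q.*2.+1 j -> False.
Proof. by rewrite /seg -!mul2n; move: (2 ^ h)%N => t; nia. Qed.

Lemma jobs_prop h q J : J \in jobs h q -> (J.1 < K)%N /\ (2 ^ J.1 %| z)%N.
Proof.
elim: h q => [|h IH] q /=; case: ifP => [/and3P[? ? _]|_]; rewrite ?inE //;
  try by move=> /eqP ->.
by rewrite mem_cat => /orP[] /IH.
Qed.

Lemma jobs_count h q j : (count (fun J => seg J.1 J.2 j) (jobs h q) <= seg h q j)%N.
Proof.
elim: h q => [|h IH] q; rewrite [jobs _ _]/=; case: ifP => _ //=; rewrite ?addn0 //.
rewrite count_cat segS; apply: leq_trans (leq_add (IH _) (IH _)) _.
by case: (boolP (seg h q.*2 j)) => // h1; case: (boolP (seg h _ j)) => // /(seg_disj h1).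
Qed.

(** The outermost merged segments are replaced by all merged ones at admissible levels: the shift
    then enters only through divisibility, which makes averaging possible. *)
Lemma jobs_cost h q : (\sum_(J <- jobs h q) 2 ^ J.1 <=
  \sum_(h' < h.+1 | (h' < K) && (2 ^ h' %| z))
     2 ^ h' * \sum_(q' < 2 ^ (h - h')) merged h' (q * 2 ^ (h - h') + q'))%N.
Proof.
elim: h q => [|h IH] q.
  rewrite [jobs _ _]/= [X in _ <= X]big_mkcond big_ord1 /=.
  rewrite subnn expn0 big_ord1 /= muln1 addn0 mul1n dvd1n.
  case: ltnP => _ /=; last by rewrite big_nil.
  by case: ifP => h; rewrite ?big_nil // big_seq1 /= expn0.
rewrite [jobs _ _]/=; case: ifP => [/and3P[hK hz hm]|_].
  rewrite big_seq1 big_mkcond big_ord_recr /= hK hz subnn big_ord1 /=.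
  by rewrite expn0 muln1 addn0 hm muln1 leq_addl.
rewrite big_cat /=; apply: leq_trans (leq_add (IH _) (IH _)) _.
rewrite -big_split /= [X in (_ <= X)%N]big_mkcond big_ord_recr /= -big_mkcond /=.
apply: leq_trans (leq_addr _ _); apply: leq_sum => h' _; rewrite -mulnDr leq_mul2l.
apply/orP; right; rewrite (_ : (2 ^ (h.+1 - h') = 2 ^ (h - h') + 2 ^ (h - h'))%N); last first.
  by rewrite addnn -mul2n -expnS -subSn // -ltnS.
move: (2 ^ (h - h')) => t; rewrite [X in (_ <= X)%N]big_split_ord /=.
apply: leq_add; apply: leq_sum => q' _; rewrite -!mul2n.
  by rewrite (_ : 2 * q * t + q' = q * (t + t) + q') //; lia.
by rewrite (_ : (2 * q).+1 * t + q' = q * (t + t) + (t + q')) //; lia.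
Qed.

End Jobs.

(** * Average patching cost of one line over the shifts *)

Section JobsAverage.
Local Open Scope nat_scope.

(** A segment of level [h] costs [2 ^ h], but its line is admissible for at most [2 ^ (K - h)] of
    the [2 ^ K] shifts. So every merged segment costs at most [2 ^ K] in total whatever its level,
    and by [sum_merged] there are [r] crossings for each of them. *)
Lemma jobs_average (r K L : nat) (cnt : nat -> nat) : (0 < r)%N ->
  (r * \sum_(a < 2 ^ K) \sum_(J <- jobs r cnt K.+1 (L + a) K.+1 0) 2 ^ J.1 <=
     2 ^ K * \sum_(q < 2 ^ K.+1) cnt q)%N.
Proof.
move=> r0.
pose m h := (\sum_(q' < 2 ^ (K.+1 - h)) merged r cnt h q')%N.
have dvds h : (h <= K)%N -> (2 ^ h * \sum_(a < 2 ^ K) (2 ^ h %| L + a) <= 2 ^ K)%N.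
  move=> hK; have -> : (2 ^ K = 2 ^ h * 2 ^ (K - h))%N by rewrite -expnD subnKC.
  rewrite leq_mul2l; apply/orP; right; move: (2 ^ (K - h))%N (2 ^ h)%N (expn_gt0 2 h) => s t t0.
  rewrite -(big_mkord predT (fun a => nat_of_bool (t %| L + a))).
  elim: s => [|s IH]; first by rewrite muln0 big_geq.
  rewrite mulnS addnC (@big_cat_nat _ _ _ (t * s)) ?leq_addr //= -addn1.
  apply: leq_add IH _; rewrite -{1}[(t * s)%N]add0n big_addn addKn big_mkord.
  have le1 (a b : 'I_t) : t %| L + (a + t * s) -> t %| L + (b + t * s) -> a = b.
    move=> ha hb; apply/val_inj => /=.
    have /eqP : a == b %[mod t].
      by rewrite -(eqn_modDr (t * s)) -(eqn_modDl L) (eqP ha) (eqP hb).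
    by rewrite !modn_small.
  case: (pickP (fun a : 'I_t => t %| L + (a + t * s))) => [a0 ha0|h0]; last first.
    by rewrite big1 // => a _; rewrite h0.
  rewrite (bigD1 a0) //= ha0 big1 ?addn0 // => b; case: (boolP (_ %| _)) => // hb.
  by rewrite (le1 _ _ hb ha0) eqxx.
apply: (@leq_trans (r * \sum_(a < 2 ^ K) \sum_(h < K.+2 | (h < K.+1) && (2 ^ h %| L + a))
    2 ^ h * m h)%N).
  rewrite leq_mul2l; apply/orP; right; apply: leq_sum => a _.
  by have := jobs_cost r cnt K.+1 (L + a) K.+1 0.
have -> : (\sum_(a < 2 ^ K) \sum_(h < K.+2 | (h < K.+1) && (2 ^ h %| L + a)) 2 ^ h * m h =
  \sum_(h < K.+2 | (h < K.+1)%N) (2 ^ h * \sum_(a < 2 ^ K) (2 ^ h %| L + a)) * m h)%N.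
  rewrite (exchange_big_dep (fun h : 'I_K.+2 => h < K.+1)%N) /=; last by move=> a h _ /andP[].
  apply: eq_bigr => h hK; rewrite big_mkcond /= mulnAC [RHS]big_distrr /=.
  by apply: eq_bigr => a _; rewrite hK /=; case: (_ %| _); rewrite ?muln1 ?muln0.
apply: (@leq_trans (r * \sum_(h < K.+2) 2 ^ K * m h)%N).
  rewrite leq_mul2l; apply/orP; right; rewrite big_mkcond; apply: leq_sum => h _.
  by case: ifP => // hK; rewrite leq_mul2r dvds ?orbT // -ltnS.
rewrite -big_distrr /= mulnCA leq_mul2l; apply/orP; right.
apply: leq_trans (sum_merged cnt K.+1 r0).
rewrite big_distrr /=; apply: leq_sum => h _; rewrite mulnC big_distrl.
by apply: leq_sum => q _.
Qed.

End JobsAverage.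

(** * The structure theorem *)

Section JobBounds.
Local Open Scope nat_scope.
Variables (r K z : nat) (cnt : nat -> nat) (f : nat -> nat -> nat).
Hypothesis r_gt0 : 0 < r.
Hypothesis fS : forall h q, f h.+1 q = f h q.*2 + f h q.*2.+1.
Hypothesis f0 : forall q, f 0 q <= cnt q.

(** At an admissible level a merged segment is itself patched and keeps at most two crossings for
    its single group; otherwise its groups are those of its halves, whose level is admissible
    too. *)
Lemma jobs_bound h q : (forall J, J \in jobs r cnt K z h q -> f J.1 J.2 <= 2) ->
  h < K -> 2 ^ h %| z -> f h q <= 2 * grpn r cnt h q.
Proof.
elim: h q => [|h IH] q; rewrite [jobs _ _ _ _ _ _]/=; case: ifP.
- move=> /and3P[_ _ hm] H _ _; have := H (0, q); rewrite inE eqxx => /(_ isT) /=.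
  by rewrite /merged in hm; rewrite hm.
- move=> hj _ hK hz; move: hj; rewrite hK hz /= => /negbT; rewrite /merged -leqNgt => hm.
  by rewrite /= ltnNge hm /= (leq_trans (f0 q)) // leq_pmull.
- move=> /and3P[_ _ hm] H _ _; have := H (h.+1, q); rewrite inE eqxx => /(_ isT) /=.
  by rewrite /merged in hm; rewrite hm.
- move=> hj H hK hz; move: hj; rewrite hK hz /= => /negbT; rewrite /merged -leqNgt => hm.
  have hz' : 2 ^ h %| z by apply: dvdn_trans hz; rewrite expnS dvdn_mull.
  rewrite /= ltnNge hm /= fS mulnDr.
  by apply: leq_add; (apply: IH; [|exact: ltnW|exact: hz']) => J hJ;
    apply: H; rewrite mem_cat hJ ?orbT.
Qed.

Lemma f_mono h h' q q' : h' <= h -> q' %/ 2 ^ (h - h') = q -> f h' q' <= f h q.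
Proof.
move=> hh <- {q}; have [m ->] : exists m, h = h' + m by exists (h - h'); rewrite subnKC.
rewrite addKn {hh h}.
elim: m => [|m IH]; first by rewrite expn0 divn1 addn0.
apply: leq_trans IH _; rewrite addnS fS expnSr divnMA.
move: (q' %/ 2 ^ m) => t; rewrite {1}(divn_eq t 2) muln2.
by case: (t %% 2) (ltn_pmod t (isT : 0 < 2)) => [|[|//]] _;
  rewrite ?addn0 ?addn1 ?leq_addr ?leq_addl.
Qed.

(** Admissible levels are closed downwards. On the way down from the root, the first admissible
    ancestor satisfies [jobs_bound] with at most [r] groups, and counts only shrink on the rest of
    the way. *)
Lemma jobs_bound_desc h q h' q' : h' <= h -> q' %/ 2 ^ (h - h') = q ->
  (forall J, J \in jobs r cnt K z h q -> f J.1 J.2 <= 2) ->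
  h' < K -> 2 ^ h' %| z -> f h' q' <= 2 * r.
Proof.
elim: h q => [|h IH] q hh E H hK hz.
  move: hh E; rewrite leqn0 => /eqP h0; rewrite h0 expn0 divn1 => E; subst q'.
  rewrite h0 in hK hz; apply: leq_trans (jobs_bound H hK hz) _.
  by rewrite leq_mul2l grpn_le.
case: (boolP ((h.+1 < K) && (2 ^ h.+1 %| z))) => [/andP[hK' hz']|hn].
  apply: leq_trans (f_mono hh E) _; apply: leq_trans (jobs_bound H hK' hz') _.
  by rewrite leq_mul2l grpn_le.
move: hh; rewrite leq_eqVlt => /orP[/eqP h0|hh].
  by move: hn; rewrite -h0 hK hz.
rewrite ltnS in hh; have H' J : J \in jobs r cnt K z h q.*2 ++ jobs r cnt K z h q.*2.+1 ->
    f J.1 J.2 <= 2.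
  move=> hJ; apply: H; rewrite [jobs _ _ _ _ _ _]/=; case: ifP => // /and3P[h1 h2 _].
  by move: hn; rewrite h1 h2.
move: E; rewrite subSn // expnSr divnMA => E.
have tE := divn_eq (q' %/ 2 ^ (h - h')) 2; rewrite E in tE.
case: (_ %% 2) (ltn_pmod (q' %/ 2 ^ (h - h')) (isT : 0 < 2)) tE => [|[|//]] _;
  rewrite ?addn0 ?addn1 muln2 => tE; apply: (IH _ hh tE) => // J hJ; apply: H';
  by rewrite mem_cat hJ ?orbT.
Qed.

End JobBounds.

(** * Runs of terminals along a walk *)

Section Runs.
Variables (R : realType) (n : nat) (loc : option 'I_n -> R * R).

Fixpoint runs (T : Type) (A : pred T) (f : bool) (s : seq T) : nat :=
  if s is v :: s' then ((A v && ~~ f) + runs A (A v) s')%N else 0%N.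

Definition bnd (inA : pred (nat * nat)) (it : item R n) : bool :=
  if it is inr (d, l, j, _, _) then inA (mk d l j) != inA (mk d l.+1 j) else false.

(** A new run can only begin after the walk has entered the set of cells through a boundary wall,
    unless the walk starts inside it. *)
Lemma runs_walk inA c w c' f : walk loc c w c' ->
  (runs (fun v => inA (cellof (loc (Some v)))) f (pmap (@getT R n) w) <=
   count (bnd inA) w + (inA c && ~~ f))%N.
Proof.
elim: w c f => [|it w IH] c f //=; case E: (step loc c it) => [c1|//] /IH {}IH.
case: it E => [v|[[[[d l] j] x] crn]] /=.
  move=> E; have [E1 E2] : c1 = c /\ c = cellof (loc (Some v)).
    by move: E; case: eqP => // -> [->].
  rewrite E1 {1}E2 in IH; rewrite -E2 add0n addnC leq_add2r.
  by apply: leq_trans (IH _) _; rewrite -?E2 andbN addn0.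
move=> E; apply: leq_trans (IH f) _; rewrite -addnA addnCA leq_add2l.
have [[-> ->]|[-> ->]] : (c = mk d l j /\ c1 = mk d l.+1 j) \/ (c = mk d l.+1 j /\ c1 = mk d l j).
  by move: E; case: eqP => [-> [<-]|_]; [left|case: eqP => // -> [<-]; right].
all: by case: (inA (mk d l j)); case: (inA (mk d l.+1 j)); case: f.
Qed.

End Runs.

(** * Patching a list of segments in succession *)

Section PatchJobs.
Variables (R : realType) (n : nat) (loc : option 'I_n -> R * R).
Local Notation item := (item R n).

Definition job := (bool * nat * nat * nat)%type.
Definition jgrp (J : job) : pred item := let: (d, l, lo, hi) := J in @grp R n d l lo hi.
Definition jcrn (d : bool) (l j : nat) (J : job) : bool :=
  let: (d', l', lo, hi) := J in [&& d == ~~ d', side j l', lo <= l & l.+1 < hi]%N.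
Definition jlen (J : job) : nat := let: (_, _, lo, hi) := J in (hi - lo)%N.
Definition jok (J : job) : bool := let: (_, _, lo, hi) := J in (lo <= hi)%N.

(** Later patchings preserve what earlier ones achieved, because original crossings are only ever
    deleted; the corner crossings are of another kind and are counted separately. *)
Lemma patch_jobs c a z (js : seq job) (w : seq item) :
  walk loc c w c -> all (@okit R n) w -> all jok js ->
  exists w', [/\ walk loc c w' c, 
    plen a (rcons (map (ptof loc) w') z) <=
      plen a (rcons (map (ptof loc) w) z) + 4 * (\sum_(J <- js) jlen J)%N%:R,
    perm_eq (pmap (@getT R n) w') (pmap (@getT R n) w),
    (forall J, J \in js -> (count (jgrp J) w' <= 2)%N) &
    (forall p : pred item, (forall it, p it -> nc it) -> (count p w' <= count p w)%N) /\
    forall d l j, (count (crnAt d l j) w' <=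
       count (crnAt d l j) w + 2 * \sum_(J <- js) jcrn d l j J)%N].
Proof.
elim: js w => [|[[[d l] lo] hi] js IH] w hw ok.
  move=> _; exists w; rewrite big_nil mulr0 addr0; split=> //.
  by split=> // *; rewrite big_nil muln0 addn0.
move=> /= /andP[lohi okj].
have [w1 [rem [h1 h2 h3 [h4 h5] [h6 h7]]]] := patch_group a z d l hw ok lohi.
have [w2 [k1 k2 k3 k4 [k5 k6]]] := IH w1 h1 h2 okj.
have cnt_le (p : pred item) : (forall it, p it -> nc it) -> (count p w1 <= count p w)%N.
  move=> pn; have pE v : count p v = count p (filter (@nc R n) v).
    rewrite count_filter; apply: eq_count => it /=.
    by case: (boolP (p it)) => // /pn ->.
  by rewrite (pE w1) (pE w) (permP h4) count_cat leq_addr.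
exists w2; split=> //.
- apply: le_trans k2 _; rewrite big_cons natrD mulrDr /=.
  by rewrite addrA lerD2r.
- apply: perm_trans k3 _.
  have tE v : pmap (@getT R n) v = pmap (@getT R n) (filter (@nc R n) v).
    by elim: v => [|[v|[[[[? ?] ?] ?] []]] s IHs] //=; rewrite IHs.
  rewrite (tE w) (tE w1); have := perm_pmap (@getT R n) h4; rewrite pmap_cat.
  have -> : pmap (@getT R n) rem = [::].
    by elim: (rem) h5 => [|[v|[[[[? ?] ?] ?] ?]] s IHs] //= /andP[_ /IHs].
  by rewrite cats0 perm_sym.
- move=> J; rewrite inE => /orP[/eqP ->|]; last exact: k4.
  apply: leq_trans h6; apply: k5 => it; exact: grp_nc.
- split=> [p pn|d' l' j]; first exact: leq_trans (k5 p pn) (cnt_le p pn).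
  apply: leq_trans (k6 _ _ _) _; rewrite big_cons mulnDr addnA leq_add2r.
  exact: h7.
Qed.

End PatchJobs.

(** * Crossings on the sides of dissection squares *)

Section SideBound.
Variables (R : realType) (n : nat) (loc : option 'I_n -> R * R).
Local Notation item := (item R n).
Variables (r K L : nat) (sh : bool -> nat) (w w' : seq item).
Local Open Scope nat_scope.

Definition onl (d : bool) (l j : nat) (it : item) : bool :=
  if it is inr (d', l', j', _, crn) then
    [&& ~~ crn, d' == d, l' == l & j' + sh (~~ d) == j] else false.

Definition cntl (d : bool) (l j : nat) : nat := count (onl d l j) w.

(** Dyadic segments live in shifted coordinates; the truncated subtraction clips the part of a
    segment that precedes cell 0. *)
Definition tojob (d : bool) (l : nat) (J : nat * nat) : job :=
  (d, l, J.2 * 2 ^ J.1 - sh (~~ d), J.2.+1 * 2 ^ J.1 - sh (~~ d)).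

Definition linejobs (d : bool) (l : nat) : seq (nat * nat) :=
  jobs r (cntl d l) K.+1 (l.+1 + sh d) K.+1 0.

Definition alljobs : seq job :=
  flatten [seq map (tojob d l) (linejobs d l) | d <- [:: true; false], l <- iota 0 L].

Lemma mem_alljobs d l J : l < L -> J \in linejobs d l -> tojob d l J \in alljobs.
Proof.
move=> lL hJ; apply/flattenP; exists (map (tojob d l) (linejobs d l)); last exact: map_f.
by apply/allpairsP; exists (d, l); split; rewrite ?mem_iota ?inE //; case: (d).
Qed.

Lemma alljobs_inv J : J \in alljobs -> exists d l J0,
  [/\ l < L, J0 \in linejobs d l & J = tojob d l J0].
Proof.
move=> /flattenP[s /allpairsP[[d l] /= [_ hl ->]] /mapP[J0 h1 h2]].
by exists d, l, J0; split=> //; move: hl; rewrite mem_iota.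
Qed.

Lemma big_alljobs (F : job -> nat) : \sum_(J <- alljobs) F J =
  \sum_(d <- [:: true; false]) \sum_(l < L) \sum_(J <- linejobs d l) F (tojob d l J).
Proof.
rewrite /alljobs big_flatten /= cats0 big_cat !big_map !big_cons big_nil addn0 /=.
have iotaE (G : nat -> nat) : \sum_(l <- iota 0 L) G l = \sum_(l < L) G l.
  by rewrite -(big_mkord predT) /index_iota subn0.
by rewrite !iotaE; congr (_ + _); apply: eq_bigr => l _; rewrite big_map.
Qed.

Hypothesis r_gt0 : 0 < r.
Hypothesis jobs_done : forall J, J \in alljobs -> count (@jgrp R n J) w' <= 2.
Hypothesis nc_le : forall p : pred item, (forall it, p it -> nc it) -> count p w' <= count p w.
Hypothesis crn_le : forall d l j, count (crnAt d l j) w' <= 2 * \sum_(J <- alljobs) jcrn d l j J.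
Hypothesis w_range : forall d l j x b, inr (d, l, j, x, b) \in w -> l < L.

Definition segl d l h q (it : item) : bool :=
  if it is inr (d', l', j', _, crn) then
    [&& ~~ crn, d' == d, l' == l & seg h q (j' + sh (~~ d))] else false.

Lemma segl_nc d l h q it : segl d l h q it -> nc it.
Proof. by case: it => [v|[[[[? ?] ?] ?] ?]] //= /and4P[]. Qed.

Lemma count_disjU (T : Type) (a b c : pred T) s : (forall x, c x = a x || b x) ->
  (forall x, a x -> b x -> False) -> count c s = count a s + count b s.
Proof.
move=> h1 h2; rewrite -count_predUI (@eq_count _ c (predU a b)) //.
rewrite (@eq_count _ (predI a b) pred0) ?count_pred0 ?addn0 // => x /=.
by apply/negP => /andP[]; apply: h2.
Qed.

Lemma count_leU (T : eqType) (a b c : pred T) s :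
  (forall x, x \in s -> c x -> a x || b x) -> count c s <= count a s + count b s.
Proof.
elim: s => //= x s IH h.
have {}IH := IH (fun y ys => h y (@mem_behead _ (x :: s) y ys)).
have {h} := h x (mem_head x s); move: (c x) (a x) (b x) (count c s) (count a s) (count b s) IH; clear => i j k p q t h.
by case: i => [/(_ isT)|_]; case: j; case: k => //=; lia.
Qed.

Lemma noncorner_bound d l h q : h <= K -> 2 ^ h %| l.+1 + sh d -> q < 2 ^ (K.+1 - h) ->
  count (segl d l h q) w' <= 2 * r.
Proof.
move=> hK hz hq; case: (ltnP l L) => lL; last first.
  apply: leq_trans (nc_le (@segl_nc d l h q)) _; rewrite -[count _ _]size_filter.
  case E : (filter _ _) => [//|it s]; have : it \in filter (segl d l h q) w by rewrite E mem_head.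
  rewrite mem_filter => /andP[]; case: it {E} => [v|[[[[d' l'] ?] ?] ?]] //=.
  move=> /and4P[_ _ /eqP -> _] /w_range; by rewrite ltnNge lL.
apply: (@jobs_bound_desc r K.+1 (l.+1 + sh d) (cntl d l)
  (fun h q => count (segl d l h q) w') r_gt0 _ _ K.+1 0 h q) => //.
- move=> h' q'; apply: count_disjU => [[v|[[[[d' l'] j'] x] b]]|[v|[[[[d' l'] j'] x] b]]] //=.
    by rewrite segS; do 3 case: (X in X && _) => //=.
  by move=> /and4P[_ _ _ h1] /and4P[_ _ _]; apply: seg_disj.
- move=> q'; apply: leq_trans (nc_le (@segl_nc d l 0 q')) _.
  apply: sub_count => -[v|[[[[d' l'] j'] x] b]] //= /and4P[-> -> ->] /=.
  by rewrite /seg expn0 !muln1 ltnS eqn_leq andbC.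
- exact: leqW.
- exact: divn_small.
- move=> J hJ; apply: leq_trans (jobs_done (mem_alljobs lL hJ)).
  apply: sub_count => -[v|[[[[d' l'] j'] x] b]] //= /and4P[-> -> ->] /=.
  by rewrite /seg; clear; lia.
Qed.

Lemma jcrn_seg d l j d' l' J : jcrn d l j (tojob d' l' J) ->
  [/\ d' = ~~ d, side j l', seg J.1 J.2 (l + sh d) & seg J.1 J.2 (l.+1 + sh d)].
Proof.
move=> /= /and4P[/eqP hd hs h1 h2].
have E : ~~ d' = d by rewrite hd.
by split=> //; rewrite ?hd ?negbK // /seg; move: h1 h2; rewrite E; clear; lia.
Qed.

(** A corner at this position comes from patching one of the two perpendicular lines next to row
    [j]. The patched segments of a line are disjoint, so each of these lines accounts for at most
    one segment and two corners. *)
Lemma corner_bound d l j : count (crnAt d l j) w' <= 4.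
Proof.
apply: leq_trans (crn_le d l j) _; rewrite (_ : 4 = 2 * 2) // leq_mul2l /=.
rewrite big_alljobs.
have H d' : \sum_(l' < L) \sum_(J <- linejobs d' l') jcrn d l j (tojob d' l' J) <=
    2 * (d' == ~~ d).
  case: (eqVneq d' (~~ d)) => [Ed|nd]; last first.
    rewrite big1 // => l' _; rewrite big1 // => J _; case E : (jcrn _ _ _ _) => //.
    by have [h _ _ _] := jcrn_seg E; rewrite h eqxx in nd.
  rewrite muln1; apply: (@leq_trans (\sum_(l' < L) side j l')).
    apply: leq_sum => l' _; apply: (@leq_trans (\sum_(J <- linejobs d' l') side j l' * seg J.1 J.2 (l + sh d))).
      apply: leq_sum => J _; case E : (jcrn _ _ _ _) => //.
      by have [_ -> -> _] := jcrn_seg E.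
    rewrite -big_distrr /= -{2}(muln1 (side j l')) leq_mul2l; apply/orP; right.
    have := jobs_count r (cntl d' l') K.+1 (l'.+1 + sh d') K.+1 0 (l + sh d).
    rewrite -sum1_count big_mkcond /= => h.
    apply: leq_trans (leq_trans h (leq_b1 _)).
    by apply: leq_sum => J _; case: (seg _ _ _).
  have le1 (a : nat) : \sum_(l' < L) (l' == a :> nat) <= 1.
    case: (ltnP a L) => aL; last first.
      by rewrite big1 // => l' _; case: eqP => // E; have := ltn_ord l'; rewrite E ltnNge aL.
    rewrite (bigD1 (Ordinal aL)) //= eqxx big1 // => l'; rewrite -val_eqE /= => /negbTE ->.
    by [].
  apply: (@leq_trans (\sum_(l' < L) ((l' == j :> nat) + (l' == j.-1 :> nat)))).
    apply: leq_sum => l' _; rewrite /side; clear; by lia.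
  by rewrite big_split /= -[2]/(1 + 1); apply: leq_add; apply: le1.
rewrite !big_cons big_nil addn0; apply: leq_trans (leq_add (H true) (H false)) _.
by case: d {H}.
Qed.

(** The job behind the corner lies on a perpendicular line [l'] and has the line [l] in its
    interior. A multiple of its length would fall on its end, so its level exceeds [h]. Hence [l']
    is at a multiple of [2 ^ h] too, and the corner, being next to it, sits at an end of the side:
    corners do not accumulate along a side. *)
Lemma corner_pos d l j h q it : it \in w' -> crnAt d l j it ->
  2 ^ h %| l.+1 + sh d -> seg h q (j + sh (~~ d)) ->
  j + sh (~~ d) = q * 2 ^ h \/ (j + sh (~~ d)).+1 = q.+1 * 2 ^ h.
Proof.
move=> hit hc hz hs.
have : 0 < count (crnAt d l j) w' by rewrite -has_count; apply/hasP; exists it.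
move=> /leq_trans /(_ (crn_le d l j)); rewrite muln_gt0 /= lt0n => hn.
have [J hJ hcJ] : exists2 J, J \in alljobs & jcrn d l j J.
  apply/hasP; apply: contraNT hn => /hasPn hn; rewrite big_seq big1 // => J /hn.
  by case: (jcrn _ _ _ _).
have [d' [l' [J0 [_ hJ0 EJ]]]] := alljobs_inv hJ; rewrite EJ in hcJ.
have [Ed hs' s1 s2] := jcrn_seg hcJ.
have [_ hz'] := jobs_prop hJ0; subst d'.
have hlt : h < J0.1.
  rewrite ltnNge; apply/negP => hle.
  have : 2 ^ J0.1 %| l.+1 + sh d by apply: dvdn_trans hz; apply: dvdn_exp2l.
  move: s1 s2; rewrite /seg; move: (2 ^ J0.1) => u /andP[s1 _] /andP[_ s2] /dvdnP[t Et].
  have : J0.2 * u < t * u by rewrite -Et addSn ltnS.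
  rewrite Et in s2; move: s2; rewrite !ltn_mul2r => /andP[_ s2] /andP[_ s3].
  by rewrite ltnS leqNgt s3 in s2.
have hz2 : 2 ^ h %| l'.+1 + sh (~~ d) by apply: dvdn_trans hz'; apply: dvdn_exp2l; apply: ltnW.
move: hz2 hs hs' => /dvdnP[t Et]; rewrite /seg /side.
have tp : 0 < 2 ^ h by rewrite expn_gt0.
move: Et tp; move: (2 ^ h) => u Et tp /andP[h1 h2] /orP[]/eqP Ej; subst j.
  right; have : q * u < t * u <= q.+1 * u by rewrite -Et; move: h1 h2; clear; lia.
  rewrite ltn_mul2r leq_mul2r (gtn_eqF tp) tp /= => h3.
  have -> : q.+1 = t by apply/eqP; rewrite eqn_leq; move: h3; clear; lia.
  by rewrite -Et addSn.
left; have : q * u <= t * u < q.+1 * u by rewrite -Et h1 h2.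
rewrite ltn_mul2r leq_mul2r (gtn_eqF tp) tp /= => h3.
have -> : q = t by apply/eqP; rewrite eqn_leq; move: h3; clear; lia.
by rewrite -Et.
Qed.

Definition sidez d z h q (it : item) : bool :=
  if it is inr (d', l', j', _, _) then
    [&& d' == d, l'.+1 + sh d == z & seg h q (j' + sh (~~ d))] else false.

(** At most [2 * r] original crossings, and at most 4 corner crossings at each of the two extreme
    positions of the side. *)
Lemma side_bound d z h q : h <= K -> 2 ^ h %| z -> q < 2 ^ (K.+1 - h) ->
  count (sidez d z h q) w' <= 2 * r + 8.
Proof.
move=> hK hz hq; case: (ltnP (sh d) z) => hl; last first.
  rewrite (@eq_count _ _ pred0) ?count_pred0 // => -[v|[[[[d' l'] j'] x] b]] //=.
  by apply/negP => /and3P[_ /eqP E _]; move: hl E; clear; lia.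
pose l := z.-1 - sh d; have El : l.+1 + sh d = z by rewrite /l; move: hl; clear; lia.
rewrite -El in hz *.
pose j1 := q * 2 ^ h - sh (~~ d); pose j2 := (q.+1 * 2 ^ h).-1 - sh (~~ d).
apply: (@leq_trans (count (segl d l h q) w' + (count (crnAt d l j1) w' + count (crnAt d l j2) w'))).
  pose B := predU (crnAt d l j1) (crnAt (R := R) (n := n) d l j2).
  apply: (@leq_trans (count (segl d l h q) w' + count B w')); last first.
    by rewrite leq_add2l; apply: count_leU => it _.
  apply: count_leU => it hit; rewrite /B.
  case: it hit => [v|[[[[d' l'] j'] x] b]] hit //=.
  rewrite eqn_add2r eqSS => /and3P[/eqP Ed /eqP El' hs]; subst d' l'; rewrite !eqxx /= hs.
  case: b hit => hit //=; have := @corner_pos d l j' h q _ hit _ hz hs.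
  rewrite /= !eqxx => /(_ isT) [] E; rewrite /j1 /j2.
    by rewrite -E addnK eqxx.
  by rewrite -E /= addnK eqxx orbT.
apply: leq_add (noncorner_bound hK hz hq) _.
exact: leq_add (corner_bound d l j1) (corner_bound d l j2).
Qed.

(** A vertical line at a multiple of [2 ^ h] need not be admissible at level [h.+1], so a vertical
    side of a half square is cut into two segments of level [h]. Twice two of them and two
    horizontal sides make 6. *)
Lemma bnd_bound h h' q q' : h <= K -> h' = h \/ h' = h.+1 ->
  q < 2 ^ (K.+1 - h) -> q' < 2 ^ (K.+1 - h') ->
  count (bnd (fun c => seg h q (c.1 + sh true) && seg h' q' (c.2 + sh false))) w' <=
    6 * (2 * r + 8).
Proof.
move=> hK hh hq hq'.
have vb z : 2 ^ h %| z -> count (sidez true z h' q') w' <= 2 * (2 * r + 8).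
  move=> hz; case: hh => E; subst h'.
    by apply: leq_trans (side_bound true hK hz hq') _; rewrite leq_pmull.
  have e2 : 2 ^ (K.+1 - h) = (2 ^ (K.+1 - h.+1)).*2 by rewrite -mul2n -expnS subSS -subSn.
  rewrite (@count_disjU _ (sidez true z h q'.*2) (sidez true z h q'.*2.+1)).
  - have -> : 2 * (2 * r + 8) = 2 * r + 8 + (2 * r + 8) by rewrite mul2n addnn.
    apply: leq_add; apply: side_bound => //; rewrite e2.
      by rewrite ltn_double.
    by rewrite -doubleS -ltnS; move: hq'; clear; rewrite -!mul2n; lia.
  - by move=> [v|[[[[d' l'] j'] x] b]] //=; rewrite segS; do 2 case: (X in X && _) => //=.
  - by move=> [v|[[[[d' l'] j'] x] b]] //= /and3P[_ _ h1] /and3P[_ _]; apply: seg_disj.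
have hb z : 2 ^ h' %| z -> count (sidez false z h q) w' <= 2 * r + 8.
  move=> hz; apply: side_bound => //; apply: dvdn_trans hz; apply: dvdn_exp2l.
  by case: hh => ->.
have vb1 := vb (q * 2 ^ h) (dvdn_mull _ (dvdnn _)).
have vb2 := vb (q.+1 * 2 ^ h) (dvdn_mull _ (dvdnn _)).
have hb1 := hb (q' * 2 ^ h') (dvdn_mull _ (dvdnn _)).
have hb2 := hb (q'.+1 * 2 ^ h') (dvdn_mull _ (dvdnn _)).
apply: (@leq_trans (count (sidez true (q * 2 ^ h) h' q') w' +
   count (sidez true (q.+1 * 2 ^ h) h' q') w' + (count (sidez false (q' * 2 ^ h') h q) w' +
   count (sidez false (q'.+1 * 2 ^ h') h q) w'))); last first.
  by move: vb1 vb2 hb1 hb2; clear; lia.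
have U (a b c : pred item) : (forall it, c it -> a it || b it) -> count c w' <= count a w' + count b w'.
  by move=> h0; apply: count_leU => it _; apply: h0.
pose V := predU (sidez true (q * 2 ^ h) h' q') (sidez true (q.+1 * 2 ^ h) h' q').
pose H := predU (sidez false (q' * 2 ^ h') h q) (sidez false (q'.+1 * 2 ^ h') h q).
apply: leq_trans (_ : count V w' + count H w' <= _); last by apply: leq_add; apply: U.
apply: U => -[v|[[[[d l] j] x] b]] //=; rewrite /V /H /=.
by case: d; rewrite /= ?andbF ?orbF /seg; clear; move: (2 ^ h) (2 ^ h') => t t'; lia.
Qed.

End SideBound.

(** * Choice of the shifts and reordering of the tours *)

Section Structure.
Variables (R : realType).

Definition tlen n (loc : option 'I_n -> R * R) (s : seq 'I_n) : R :=
  plen (loc None) (rcons (map (loc \o Some) s) (loc None)).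

Definition rect (h h' q q' : nat) (fx fy : nat) : bool := seg h q fx && seg h' q' fy.

Section Cost.
Variables (n r K L : nat) (w : seq (item R n)).
Local Open Scope nat_scope.

Definition shift (ab : nat * nat) (d : bool) : nat := if d then ab.1 else ab.2.

Definition jcost (ab : nat * nat) : nat :=
  \sum_(J <- alljobs r K L (shift ab) w) jlen J.

Lemma sum_cntl d sh : \sum_(l < L) \sum_(q < 2 ^ K.+1) cntl sh w d l q <=
  count (fun it => if it is inr (d', _, _, _, crn) then ~~ crn && (d' == d) else false) w.
Proof.
rewrite /cntl; elim: w => [|it w0 IH] /=.
  by rewrite big1 // => l _; rewrite big1.
under eq_bigr do rewrite big_split /=.
rewrite big_split /=; apply: leq_add IH.
case: it => [v|[[[[d' l'] j'] x] crn]] /=.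
  by rewrite big1 // => l _; rewrite big1.
case: crn => /=; first by rewrite big1 // => l _; rewrite big1.
case: (d' == d) => /=; last by rewrite big1 // => l _; rewrite big1.
have le1 m (a : nat) : \sum_(i < m) (a == i :> nat) <= 1.
  case: (ltnP a m) => am; last first.
    by rewrite big1 // => i _; case: eqP => // E; have := ltn_ord i; rewrite -E ltnNge am.
  rewrite (bigD1 (Ordinal am)) //= big1 ?addn0 ?leq_b1 // => i ne.
  by case: eqP => // E; case/eqP: ne; apply/val_inj.
apply: leq_trans (le1 L l'); apply: leq_sum => l _; case: (l' == l) => /=; last by rewrite big1.
exact: le1.
Qed.

Lemma jcost_le ab : jcost ab <= \sum_(d <- [:: true; false]) \sum_(l < L)
   \sum_(J <- linejobs r K (shift ab) w d l) 2 ^ J.1.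
Proof.
rewrite /jcost big_alljobs; apply: leq_sum => d _; apply: leq_sum => l _.
apply: leq_sum => J _ /=; move: (2 ^ J.1) => t; rewrite mulSn; clear; lia.
Qed.

Lemma jcost_average : 0 < r ->
  r * \sum_(a < 2 ^ K) \sum_(b < 2 ^ K) jcost (val a, val b) <=
  2 ^ K * 2 ^ K * count (fun it => if it is inr (_, _, _, _, crn) then ~~ crn else false) w.
Proof.
move=> r0.
pose S d a b := \sum_(l < L) \sum_(J <- linejobs r K (shift (a, b)) w d l) 2 ^ J.1.
pose P d (it : item R n) := if it is inr (d', _, _, _, crn) then ~~ crn && (d' == d) else false.
(* The level of a line depends on the shift in its own direction, the grouping of its crossings on
   the other shift. So the latter is fixed while averaging over the former. *)
have avg d y (f : nat -> nat * nat) : (forall x, shift (f x) d = x) ->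
   (forall x, shift (f x) (~~ d) = y) ->
   r * \sum_(x < 2 ^ K) \sum_(l < L) \sum_(J <- linejobs r K (shift (f x)) w d l) 2 ^ J.1 <=
     2 ^ K * count (P d) w.
  move=> f1 f2; rewrite exchange_big /= big_distrr /=.
  apply: (@leq_trans (\sum_(l < L) 2 ^ K * \sum_(q < 2 ^ K.+1) cntl (shift (f 0)) w d l q)).
    apply: leq_sum => l _; have := @jobs_average r K l.+1 (cntl (shift (f 0)) w d l) r0.
    apply: leq_trans; rewrite leq_mul2l; apply/orP; right; apply: leq_sum => x _.
    rewrite /linejobs f1 (_ : cntl (shift (f x)) w d l = cntl (shift (f 0)) w d l) //.
    by apply/funext => q; rewrite /cntl; apply: eq_count => it; rewrite /onl !f2.
  by rewrite -big_distrr /= leq_mul2l sum_cntl orbT.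
have SE : \sum_(a < 2 ^ K) \sum_(b < 2 ^ K) jcost (val a, val b) <=
   \sum_(b < 2 ^ K) \sum_(a < 2 ^ K) S true a b + \sum_(a < 2 ^ K) \sum_(b < 2 ^ K) S false a b.
  rewrite [X in _ <= X + _]exchange_big /= -big_split /=; apply: leq_sum => a _.
  rewrite -big_split /=; apply: leq_sum => b _; apply: leq_trans (jcost_le _) _.
  by rewrite !big_cons big_nil addn0.
apply: (@leq_trans (2 ^ K * (2 ^ K * count (P true) w) + 2 ^ K * (2 ^ K * count (P false) w))).
  apply: leq_trans (leq_mul (leqnn r) SE) _; rewrite mulnDr; apply: leq_add.
    rewrite big_distrr /= -[X in _ <= X * _](card_ord (2 ^ K)) -sum_nat_const.
    apply: leq_sum => b _; exact: (avg true b (fun x => (x, val b))).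
  rewrite big_distrr /= -[X in _ <= X * _](card_ord (2 ^ K)) -sum_nat_const.
  apply: leq_sum => a _; exact: (avg false a (fun x => (val a, x))).
rewrite !mulnA -mulnDr leq_mul2l; apply/orP; right.
by rewrite -(count_disjU (c := fun it => if it is inr (_, _, _, _, crn) then ~~ crn else false))
  // => -[v|[[[[[] ?] ?] ?] []]].
Qed.

End Cost.

Lemma exists_shift (K m r : nat) (F : nat * nat -> nat) : (0 < r)%N ->
  (r * \sum_(a < 2 ^ K) \sum_(b < 2 ^ K) F (val a, val b) <= 2 ^ K * 2 ^ K * m)%N ->
  exists a b, [/\ (a < 2 ^ K)%N, (b < 2 ^ K)%N & (r * F (a, b) <= m)%N].
Proof.
move=> r0 H; case: (boolP [exists a : 'I_(2 ^ K), exists b : 'I_(2 ^ K), (r * F (val a, val b) <= m)%N]).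
  by move=> /existsP[a /existsP[b h]]; exists a, b.
move=> /existsPn h; exfalso; move: H; apply/negP; rewrite -ltnNge.
apply: (@leq_trans (2 ^ K * 2 ^ K * m.+1)); first by rewrite ltn_mul2l muln_gt0 !expn_gt0 /=.
rewrite -mulnA -[X in (X * _ <= _)%N](card_ord (2 ^ K)) -sum_nat_const big_distrr /=.
apply: leq_sum => a _; rewrite -[X in (X * _ <= _)%N](card_ord (2 ^ K)) -sum_nat_const big_distrr /=.
apply: leq_sum => b _; have /existsPn /(_ b) := h a; by rewrite -ltnNge.
Qed.

(** The patching costs of all tours are added before averaging, so that one shift serves them all;
    the bound on runs is obtained for each tour separately and for every shift. *)
Lemma structure (eps : R) : 0 < eps -> exists c : nat,
  forall n (loc : option 'I_n -> R * R) m (ss : 'I_m -> seq 'I_n) K,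
  (forall x, 0 <= (loc x).1 /\ 0 <= (loc x).2) ->
  (forall x y, loc x = loc y \/ 2 <= edist (loc x) (loc y)) ->
  exists (a b : nat) (ss' : 'I_m -> seq 'I_n),
  [/\ (a < 2 ^ K)%N, (b < 2 ^ K)%N, forall i, perm_eq (ss' i) (ss i),
      \sum_i tlen loc (ss' i) <= (1 + eps) * \sum_i tlen loc (ss i) &
      forall h h' q q', (h <= K)%N -> h' = h \/ h' = h.+1 ->
        (q < 2 ^ (K.+1 - h))%N -> (q' < 2 ^ (K.+1 - h'))%N -> forall i,
        (runs (fun v => rect h h' q q' (Num.trunc (loc (Some v)).1 + a)
                 (Num.trunc (loc (Some v)).2 + b)) false (ss' i) <= c)%N].
Proof.
(* [12 = 4 * 3]: patching costs four times the length of a segment, and a tour has at most three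
   crossings per unit of length. *)
move=> eps0; pose r := (Num.trunc (12 / eps)).+1.
have hr : 12 / r%:R <= eps :> R.
  have h : 12 / eps < r%:R by apply: truncnS_gt.
  by rewrite ler_pdivrMr ?ltr0n // mulrC -ler_pdivrMr // ltW.
(* The last unit is for the run that may start in the cell of the depot. *)
exists (6 * (2 * r + 8) + 1)%N => n loc m ss K loc0 locs.
have /choice[w hw] i := tour_walk loc0 locs None None (ss i).
pose c0 := cellof (loc None).
pose lof (it : item R n) := if it is inr (_, l, _, _, _) then l.+1 else 0%N.
pose L i := (\max_(it <- w i) lof it)%N.
have wr i d l j x b : inr (d, l, j, x, b) \in w i -> (l < L i)%N.
  move=> hit; rewrite /L (big_rem _ hit) /=; exact: leq_maxl.
pose X it := if it is inr (_, _, _, _, crn) then ~~ crn else false : bool.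
have nocorner i it : it \in w i -> if it is inr (_, _, _, _, crn) then ~~ crn else true.
  have [_ _ h _ _] := hw i; move=> /(allP h); by case: it => [//|[[[[? ?] ?] ?] []]].
have Xplain i : count (fun it : item R n => if it is inr (_, _, _, _, crn) then ~~ crn else false) (w i)
    = count (@plain R n) (w i).
  have [_ _ h _ _] := hw i; apply: eq_in_count => it /(allP h).
  by case: it => [//|[[[[? ?] ?] ?] []]] //= ->.
pose F ab := (\sum_i jcost r K (L i) (w i) ab)%N.
have [a [b [ha hb hF]]] : exists a b, [/\ (a < 2 ^ K)%N, (b < 2 ^ K)%N &
    (r * F (a, b) <= \sum_i count (@plain R n) (w i))%N].
  apply: exists_shift => //; rewrite big_distrr /= big_distrr /=.
  have -> : (\sum_(i < 2 ^ K) r * \sum_(b < 2 ^ K) F (val i, val b) =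
    \sum_i r * \sum_(a < 2 ^ K) \sum_(b < 2 ^ K) jcost r K (L i) (w i) (val a, val b))%N.
    rewrite -!big_distrr /=; congr (_ * _)%N; rewrite [RHS]exchange_big /=.
    by apply: eq_bigr => x _; rewrite exchange_big.
  by apply: leq_sum => i _; rewrite -Xplain; apply: jcost_average.
pose sh := shift (a, b); pose js i := alljobs r K (L i) sh (w i).
have okj i : all jok (js i).
  apply/allP => J /alljobs_inv[d [l [J0 [_ _ ->]]]] /=.
  by rewrite leq_sub2r // leq_mul2r leqnSn orbT.
have okw i : all (@okit R n) (w i).
  have [_ _ h _ _] := hw i; apply: sub_all h => -[v|[[[[? ?] ?] ?] ?]] //= /andP[_ ->].
  by rewrite orbT.
have /choice[w' hw'] i : exists w', _ :=
  let: And5 hwk _ _ _ _ := hw i in patch_jobs (loc None) (loc None) hwk (okw i) (okj i).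
exists a, b, (fun i => pmap (@getT R n) (w' i)); split=> // [i||h h' q q' hK hh hq hq' i].
- by have [_ _ h _ _] := hw' i; have [_ _ _ <- _] := hw i.
- apply: (@le_trans _ _ (\sum_i (tlen loc (ss i) + 4 * (jcost r K (L i) (w i) (a, b))%:R))).
    apply: ler_sum => i _; have [_ h _ _ _] := hw' i; have [_ h' _ _ _] := hw i.
    apply: (@le_trans _ _ (plen (loc None) (rcons (map (ptof loc) (w' i)) (loc None)))).
      (* Dropping the crossings of the patched walk leaves the terminals in their new order, on a
         path that is not longer. *)
      apply: plen_subseq; rewrite -!cats1; apply: cat_subseq => //.
      elim: (w' i) => [|[v|it] t IH] //=; first by rewrite eqxx.
      exact: subseq_trans IH (subseq_cons _ _).
    by apply: le_trans h _; rewrite lerD2r.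
  rewrite big_split /= mulrDl mul1r lerD2l -big_distrr /= -natr_sum.
  have hT : (\sum_i count (@plain R n) (w i))%:R <= 3 * \sum_i tlen loc (ss i).
    by rewrite natr_sum big_distrr /=; apply: ler_sum => i _; have [_ _ _ _] := hw i.
  have T0 : 0 <= \sum_i tlen loc (ss i) by apply: sumr_ge0 => i _; apply: plen_ge0.
  apply: (@le_trans _ _ (12 / r%:R * \sum_i tlen loc (ss i))); last exact: ler_wpM2r.
  have r0 : 0 < r%:R :> R by rewrite ltr0n.
  rewrite mulrAC ler_pdivlMr // -mulrA [_ * r%:R]mulrC -natrM.
  have : (r * F (a, b))%:R <= 3 * \sum_i tlen loc (ss i).
    by apply: le_trans hT; rewrite ler_nat.
  rewrite /F; lra.
- have [hwk _ _ h2 [h3 h4]] := hw' i.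
  pose inA (c : nat * nat) := seg h q (c.1 + sh true)%N && seg h' q' (c.2 + sh false)%N.
  apply: leq_trans (runs_walk inA false hwk) _; apply: leq_add; last exact: leq_b1.
  have w0 d l j : count (crnAt d l j) (w i) = 0%N.
    apply/eqP; rewrite -leqn0 leqNgt -has_count; apply/hasPn => it /nocorner.
    by case: it => [//|[[[[? ?] ?] ?] []]].
  apply: (@bnd_bound R n r K (L i) sh (w i) (w' i) (isT : (0 < r)%N) h2 h3 _ (wr i)) => //.
  by move=> d l j; apply: leq_trans (h4 d l j) _; rewrite w0.
Qed.

End Structure.

(** * The dynamic program *)

Section Combinatorics.
Variable T : eqType.
Implicit Types (s p : seq T) (A : pred T).

Lemma uniq_split s a z b a' b' : uniq s -> s = a ++ z :: b -> s = a' ++ z :: b' ->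
  a = a' /\ b = b'.
Proof.
move=> us E E'.
have za : z \notin a by move: us; rewrite E cat_uniq /= => /and3P[_ /norP[]].
have za' : z \notin a' by move: us; rewrite E' cat_uniq /= => /and3P[_ /norP[]].
have ix t u : z \notin t -> index z (t ++ z :: u) = size t.
  by move=> zt; rewrite index_cat (negbTE zt) /= eqxx addn0.
have sz : size a = size a' by rewrite -(ix a b za) -E E' (ix a' b' za').
move: E'; rewrite E => /eqP; rewrite eqseq_cat // => /andP[/eqP -> /eqP[->]].
by [].
Qed.

Fixpoint rstarts A (f : bool) s : seq T :=
  if s is x :: s' then (if A x && ~~ f then [:: x] else [::]) ++ rstarts A (A x) s'
  else [::].

Lemma size_rstarts A f s : size (rstarts A f s) = runs A f s.
Proof. by elim: s f => //= x s IH f; rewrite size_cat IH; case: (_ && _). Qed.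

Lemma not_rstart A f s y : y \in s -> A y -> y \notin rstarts A f s -> 
  (exists b, f /\ s = y :: b) \/ exists a z b, s = a ++ z :: y :: b /\ A z.
Proof.
elim: s f => //= x s IH f; rewrite inE mem_cat => ys Ay /norP[y1 y2].
case: (eqVneq y x) ys => [E _|_ /= ys].
  subst y; left; exists s; split=> //; move: y1; rewrite Ay /=.
  by case: f => //=; rewrite inE eqxx.
right; case: (IH _ ys Ay y2) => [[b [Ax ->]]|[a [z [b [-> Az]]]]].
  by exists [::], x, b.
by exists (x :: a), z, b.
Qed.

Lemma flatten_slot (I : eqType) (P : I -> seq T) (ks : seq I) k1 k2 y :
  uniq (flatten (map P ks)) -> k1 \in ks -> k2 \in ks -> y \in P k1 -> y \in P k2 -> k1 = k2.
Proof.
elim: ks => //= k ks IH; rewrite cat_uniq => /and3P[u1 u2 u3].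
have H k' : k' \in ks -> y \in P k -> y \in P k' -> False.
  move=> hk h1 h2; move/hasPn: u2 => /(_ y); rewrite h1 => /(_ _)/negP; apply=> //.
  by apply/flattenP; exists (P k') => //; apply: map_f.
rewrite !inE => /orP[/eqP ->|h1] /orP[/eqP ->|h2] y1 y2 //.
- by case: (H k2 h2 y1 y2).
- by case: (H k1 h1 y2 y1).
- exact: IH.
Qed.

(* If a tour is cut into more pieces than it has runs, two pieces are consecutive. *)
Lemma adjacent_pieces A s (I : eqType) (P : I -> seq T) (ks : seq I) :
  uniq s -> uniq ks -> perm_eq (flatten (map P ks)) (filter A s) ->
  (forall k, k \in ks -> infix (P k) s) ->
  (runs A false s < count (fun k => P k != [::]) ks)%N ->
  exists k1 k2, [/\ k1 \in ks, k2 \in ks, k1 != k2 & P k1 != [::]] /\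
     P k2 != [::] /\ infix (P k1 ++ P k2) s.
Proof.
move=> us uks hp hi hr.
have ufl : uniq (flatten (map P ks)) by rewrite (perm_uniq hp) filter_uniq.
pose ns := [seq k <- ks | P k != [::]].
have [k2 [y [p2 [hk2 E2 yr]]]] : exists k2 y p2, [/\ k2 \in ks, P k2 = y :: p2 & y \notin rstarts A false s].
  (* Otherwise the heads of the nonempty pieces would be distinct run starts, and there are too many
     of them. *)
  have : ~~ all (fun k => if P k is y :: _ then y \in rstarts A false s else true) ns.
    apply/negP => /allP h.
    pose hd k := if P k is y :: _ then Some y else None.
    have hns k : k \in ns -> exists y p, P k = y :: p.
      by rewrite mem_filter; case: (P k) => // y p _; exists y, p.
    have : (size (map hd ns) <= size (map Some (rstarts A false s)))%N.
      apply: uniq_leq_size.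
        rewrite map_inj_in_uniq ?filter_uniq // => k k' hk hk'.
        have [y [p E]] := hns k hk; have [y' [p' E']] := hns k' hk'.
        rewrite /hd E E' => -[Ey]; subst y'.
        move: hk hk'; rewrite !mem_filter => /andP[_ hk] /andP[_ hk'].
        by apply: (@flatten_slot _ P ks k k' y) => //; rewrite ?E ?E' mem_head.
      move=> o /mapP[k hk ->]; have [y [p E]] := hns k hk; have := h k hk.
      by rewrite /hd E => /map_f.
    by rewrite !size_map size_rstarts size_filter leqNgt hr.
  move=> /allPn[k]; rewrite mem_filter => /andP[_ hk]; case E : (P k) => [//|y p] hy.
  by exists k, y, p.
have yA : y \in filter A s.
  rewrite -(perm_mem hp); apply/flattenP; exists (P k2); first exact: map_f.
  by rewrite E2 mem_head.
move: (yA); rewrite mem_filter => /andP[Ay ys].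
have [[b [//]]|[a [z [b [Es Az]]]]] := not_rstart ys Ay yr.
(* The predecessor [z] of the head [y] is in [A]. Its piece must end with [z], or it would contain
   [y] and be the same piece. *)
have zA : z \in filter A s by rewrite mem_filter Az Es mem_cat inE eqxx orbT.
rewrite -(perm_mem hp) in zA; case/flattenP: zA => _ /mapP[k1 hk1 ->] zk1.
have /infixP[a2 [b2 Es2]] := hi k2 hk2; rewrite E2 /= in Es2.
have [Ea2 Eb2] : a ++ [:: z] = a2 /\ b = p2 ++ b2.
  by apply: (@uniq_split s _ y) => //; rewrite Es -catA.
have zk2 : z \notin P k2.
  apply/negP; rewrite E2 => zk2; move: us; rewrite Es cat_uniq => /and3P[_ _] /=.
  move: zk2; rewrite Eb2 !inE mem_cat => /orP[/eqP ->|->]; by rewrite ?eqxx ?orbT.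
have nk : k1 != k2 by apply/eqP => E; move: zk2; rewrite -E zk1.
exists k1, k2; split; first by split=> //; case: (P k1) zk1.
split; first by rewrite E2.
have /infixP[a1 [b1 Es1]] := hi k1 hk1.
have [p [p' E1]] : exists p p', P k1 = p ++ z :: p'.
  by case/splitPr: zk1 => p p'; exists p, p'.
rewrite E1 in Es1; case: p' E1 Es1 => [|x p'] E1 Es1.
  have [_ Eb1] : a = a1 ++ p /\ y :: b = b1.
    by apply: (@uniq_split s _ z) => //; rewrite Es1 -!catA.
  apply/infixP; exists a1, b2; rewrite E1 Es1 -Eb1 E2 Eb2 -!catA.
  by rewrite ?cat_cons -?catA.
have [_ [Exy _]] : a = a1 ++ p /\ y :: b = x :: p' ++ b1.
  by apply: (@uniq_split s _ z) => //; rewrite Es1 -!catA.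
have : k1 = k2.
  apply: (@flatten_slot _ P ks k1 k2 y) => //; last by rewrite E2 mem_head.
  by rewrite E1 Exy mem_cat !inE eqxx !orbT.
by move/eqP: nk.
Qed.

(** Deleting an element never creates a run: at worst it joins two of them or shortens one. *)
Lemma runs_subseq A s t f : subseq t s -> (runs A f t <= runs A f s)%N.
Proof.
have drop f' t' x : (runs A f' t' <= (A x && ~~ f') + runs A (A x) t')%N.
  case: t' => //= y t'; case: (A x); case: (A y); case: f' => /=; lia.
elim: s t f => [|x s IH] t f; first by rewrite subseq0 => /eqP ->.
case: t => [|y t] //=; case: eqP => [->|_] h; first by rewrite leq_add2l IH.
by apply: leq_trans (drop f (y :: t) x) _; rewrite leq_add2l; apply: IH.
Qed.

End Combinatorics.

(** * Families of pieces that the dynamic program can derive *)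

Section DP.
Variables (R : realType) (I : instance R).
Variables (M c : nat).
Local Notation n := (nterm I).
Local Notation slots := (M * c.*2)%N.
Local Open Scope nat_scope.

Variables (q : 'I_n -> nat) (cap : nat).

Definition coord (d : bool) (p : R * R) : R := if d then p.1 else p.2.

(* Codes: [0] is the depot, [v + 1] the terminal [v]. *)
Definition codeloc (j : nat) : R * R :=
  if j is j'.+1 then (if (insub j' : option 'I_n) is Some v then pos v else depot I) else depot I.

(* A threshold on a coordinate is a code, with [0] for minus infinity and
   [n + 1] for plus infinity. *)
Definition ltc (d : bool) (v : 'I_n) (j : nat) : bool :=
  (0 < j) && ((n < j) || (coord d (pos v) < coord d (codeloc j))%R).

Definition region := bool -> nat * nat.

Definition inreg (rho : region) (v : 'I_n) : bool :=
  [&& ~~ ltc true v (rho true).1, ltc true v (rho true).2,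
      ~~ ltc false v (rho false).1 & ltc false v (rho false).2].

Definition whole : region := fun=> (0, n.+1).

Definition pieces := nat -> seq 'I_n.

Definition stour (k : nat) : nat := k %/ c.*2.

Definition load (P : pieces) (i : nat) : nat :=
  \sum_(k < slots | stour k == i) \sum_(v <- P k) q v.

Definition glue (d : bool) (r1 r2 : region) : region :=
  fun e => if e == d then ((r1 d).1, (r2 d).2) else r1 e.

Definition adjacent (d : bool) (r1 r2 : region) : bool :=
  (r1 (~~ d) == r2 (~~ d)) && ((r1 d).2 == (r2 d).1).

Definition madd (P1 P2 : pieces) : pieces := fun k => P1 k ++ P2 k.

(** When slot [k1] is empty this merely moves a piece, so that no separate operation is needed for
    it. *)
Definition mmerge (k1 k2 : nat) (P : pieces) : pieces :=
  fun k => if k == k1 then P k1 ++ P k2 else if k == k2 then [::] else P k.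

Definition single (k : nat) (v : 'I_n) : pieces := fun j => if j == k then [:: v] else [::].

Definition nopiece : pieces := fun=> [::].

Definition regok (rho : region) : Prop := forall d, (rho d).1 <= n.+1 /\ (rho d).2 <= n.+1.

(** The lower threshold does not exceed the upper one, as far as terminals can tell; this makes a
    glued region the disjoint union of its two parts. *)
Definition ordered (rho : region) : Prop :=
  forall d v, ltc d v (rho d).1 -> ltc d v (rho d).2.

(** What the program can find within [h] rounds. In [DerA] no slot is used on both sides, so that
    pieces stay as they are; concatenation is left to [DerM], which changes no load and therefore
    tests no capacity. *)
Inductive Der : nat -> region -> pieces -> Prop :=
| Der0 rho : regok rho -> ordered rho -> (forall v, ~~ inreg rho v) -> Der 0 rho nopiece
| Der1 rho v k : regok rho -> (forall u, inreg rho u = (u == v)) -> k < slots ->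
    Der 0 rho (single k v)
| DerW h rho P : Der h rho P -> Der h.+1 rho P
| DerA h d r1 r2 P1 P2 : Der h r1 P1 -> Der h r2 P2 -> adjacent d r1 r2 ->
    (forall k, k < slots -> P1 k = [::] \/ P2 k = [::]) ->
    (forall i, i < M -> load P1 i + load P2 i <= cap) ->
    Der h.+1 (glue d r1 r2) (madd P1 P2)
| DerM h rho P k1 k2 : Der h rho P -> k1 < slots -> k2 < slots -> k1 != k2 ->
    stour k1 = stour k2 -> P k2 != [::] -> Der h.+1 rho (mmerge k1 k2 P).

Lemma Der_le h h' rho P : h <= h' -> Der h rho P -> Der h' rho P.
Proof. by move=> /subnKC <-; elim: (h' - h) => [|m IH] D; rewrite ?addn0 ?addnS //; apply/DerW/IH. Qed.

Section Completeness.
Variable ss : nat -> seq 'I_n.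
Hypothesis ss_perm : perm_eq (flatten (map ss (iota 0 M))) (enum 'I_n).
Hypothesis ss_load : forall i, i < M -> \sum_(v <- ss i) q v <= cap.
Hypothesis c_gt0 : 0 < c.

Definition slotsof (i : nat) : seq nat := iota (i * c.*2) c.*2.

(** Link between a family and the target tours [ss]: its pieces are stretches of the tours and
    together make up the terminals of [A]. *)
Definition good (A : pred 'I_n) (P : pieces) : Prop :=
  forall i, i < M -> perm_eq (flatten (map P (slotsof i))) (filter A (ss i)) /\
     forall k, k \in slotsof i -> infix (P k) (ss i).

Lemma slotsofP i k : (k \in slotsof i) = (stour k == i).
Proof.
have c2 : 0 < c.*2 by rewrite double_gt0.
rewrite mem_iota /stour; apply/idP/eqP => [/andP[h1 h2]|<-].
  by rewrite -(subnKC h1) divnMDl // divn_small ?addn0 // ltn_subLR.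
by rewrite leq_divM /= -mulSnr ltn_ceil.
Qed.

Lemma slotsof_lt i k : i < M -> k \in slotsof i -> k < slots.
Proof.
move=> iM; rewrite mem_iota => /andP[_ h]; apply: leq_trans h _.
by rewrite -mulSnr leq_mul2r iM orbT.
Qed.

Lemma uniq_ss i : i < M -> uniq (ss i).
Proof.
move=> iM; have : uniq (flatten (map ss (iota 0 M))) by rewrite (perm_uniq ss_perm) enum_uniq.
have : i \in iota 0 M by rewrite mem_iota.
elim: (iota 0 M) => //= j js IH; rewrite inE cat_uniq => /orP[/eqP ->|h] /and3P[h1 _ h3] //.
exact: IH.
Qed.

Lemma load_slots P i : i < M -> load P i = \sum_(k <- slotsof i) \sum_(v <- P k) q v.
Proof.
move=> iM; rewrite /load -(big_mkord (fun k => stour k == i) (fun k => \sum_(v <- P k) q v)).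
rewrite -big_filter; apply: perm_big; apply: uniq_perm; rewrite ?filter_uniq ?iota_uniq //.
move=> k; rewrite mem_filter slotsofP mem_index_iota /=; case: eqP => //= E.
by apply: (slotsof_lt iM); rewrite slotsofP E.
Qed.

Lemma good_load A P i : i < M -> good A P -> load P i = \sum_(v <- ss i | A v) q v.
Proof.
move=> iM /(_ i iM)[h _]; rewrite load_slots // -[RHS]big_filter.
transitivity (\sum_(v <- flatten (map P (slotsof i))) q v).
  by rewrite big_flatten big_map.
exact: perm_big.
Qed.

Lemma sum_delta (ks : seq nat) a x : uniq ks -> a \in ks -> \sum_(k <- ks) (k == a) * x = x.
Proof.
elim: ks => //= k ks IH /andP[k1 k2]; rewrite inE big_cons => /orP[/eqP E|h].
  rewrite E eqxx mul1n big_seq big1 ?addn0 // => j hj.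
  by case: (eqVneq j k) => [Ej|_] //; rewrite -Ej hj in k1.
by rewrite IH //; case: (eqVneq k a) => [E|_] //; rewrite E h in k1.
Qed.

Lemma flatten_merge (ks : seq nat) P k1 k2 : uniq ks -> k1 \in ks -> k2 \in ks -> k1 != k2 ->
  perm_eq (flatten (map (mmerge k1 k2 P) ks)) (flatten (map P ks)).
Proof.
move=> uks h1 h2 ne; apply/permP => p.
have E Q : count p (flatten (map Q ks)) = \sum_(k <- ks) count p (Q k).
  by elim: (ks) => [|k s IH] /=; rewrite ?big_nil // big_cons count_cat IH.
apply: (@addIn (count p (P k2))); rewrite !E.
rewrite -{1}(sum_delta (count p (P k2)) uks h2) -[in RHS](sum_delta (count p (P k2)) uks h1).
rewrite -!big_split /=; apply: eq_bigr => k _; rewrite /mmerge.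
case: (eqVneq k k1) => [->|_]; first by rewrite (negbTE ne) mul0n addn0 count_cat mul1n.
by case: (eqVneq k k2) => [->|_] //=; rewrite mul1n mul0n addn0.
Qed.

Lemma good_merge A P i k1 k2 : i < M -> good A P -> k1 \in slotsof i -> k2 \in slotsof i ->
  k1 != k2 -> infix (P k1 ++ P k2) (ss i) -> good A (mmerge k1 k2 P).
Proof.
move=> iM gP h1 h2 ne hi j jM; have [g1 g2] := gP j jM.
case: (eqVneq j i) => [E|nij].
  subst j; split; first by apply: perm_trans g1; apply: flatten_merge; rewrite ?iota_uniq.
  move=> k hk; rewrite /mmerge; case: ifP => // _; case: ifP => _; last exact: g2.
  exact: infix0s.
have E k : k \in slotsof j -> mmerge k1 k2 P k = P k.
  move: h1 h2; rewrite !slotsofP /mmerge => /eqP e1 /eqP e2 /eqP e.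
  case: eqP => [Ek|_]; first by rewrite -Ek e in e1; rewrite e1 eqxx in nij.
  by case: eqP => [Ek|_] //; rewrite -Ek e in e2; rewrite e2 eqxx in nij.
split; last by move=> k hk; rewrite E //; apply: g2.
rewrite (_ : map (mmerge k1 k2 P) (slotsof j) = map P (slotsof j)) //.
by apply/eq_in_map => k hk; apply: E.
Qed.

Section Compress.
Variables (Tg : pred nat) (cc : nat) (A : pred 'I_n).
Hypothesis Tg_count : cc <= count Tg (iota 0 c.*2).
Hypothesis A_runs : forall i, i < M -> runs A false (ss i) <= cc.

(** A nonempty piece weighs one, and one more outside the target slots [Tg]. Joining two pieces
    lowers the total, and so does moving a piece from outside into an empty target slot. *)
Definition wgt (k : nat) (b : bool) : nat := b + (b && ~~ Tg (k %% c.*2)).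
Definition potential (P : pieces) : nat := \sum_(k <- iota 0 slots) wgt k (P k != [::]).

Lemma potential_merge P k1 k2 : k1 < slots -> k2 < slots -> k1 != k2 -> P k2 != [::] ->
  P k1 != [::] \/ Tg (k1 %% c.*2) && ~~ Tg (k2 %% c.*2) ->
  potential (mmerge k1 k2 P) < potential P.
Proof.
move=> h1 h2 ne p2 h.
have m1 : k1 \in iota 0 slots by rewrite mem_iota.
have m2 : k2 \in iota 0 slots by rewrite mem_iota.
have E : potential (mmerge k1 k2 P) + (wgt k1 (P k1 != [::]) + wgt k2 true) =
    potential P + wgt k1 true.
  rewrite -(sum_delta (wgt k1 (P k1 != [::])) (iota_uniq 0 slots) m1).
  rewrite -(sum_delta (wgt k2 true) (iota_uniq 0 slots) m2).
  rewrite -[in RHS](sum_delta (wgt k1 true) (iota_uniq 0 slots) m1).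
  rewrite /potential -!big_split /=; apply: eq_bigr => k _; rewrite /mmerge.
  case: (eqVneq k k1) => [->|_].
    rewrite (negbTE ne) mul0n !mul1n addn0 addnC; congr (_ + wgt _ _).
    by case: (P k1) => //=; rewrite p2.
  by case: (eqVneq k k2) => [->|_] //=; rewrite ?mul0n ?mul1n ?p2 ?addn0 // /wgt /= addnC addn0.
have : wgt k1 true < wgt k1 (P k1 != [::]) + wgt k2 true.
  case: h => [->|/andP[t1 t2]]; first by rewrite -addn1 leq_add2l /wgt.
  by rewrite /wgt t1 t2 /=; case: (P k1 != [::]).
move: E; clear; lia.
Qed.

(** If a target slot of the tour is free, the stray piece is moved there. Otherwise the nonempty
    slots of the tour outnumber its runs in [A], and two pieces are consecutive on the tour. *)
Lemma compress_step P k2 : good A P -> k2 < slots -> P k2 != [::] ->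
  ~~ Tg (k2 %% c.*2) -> exists k k', [/\ k < slots, k' < slots, k != k', stour k = stour k' &
    P k' != [::]] /\ good A (mmerge k k' P) /\ potential (mmerge k k' P) < potential P.
Proof.
move=> gP h2 p2 t2; pose i := stour k2.
have iM : i < M by rewrite /i /stour ltn_divLR ?double_gt0.
have k2i : k2 \in slotsof i by rewrite slotsofP.
have [g1 g2] := gP i iM.
case: (boolP (has (fun k => Tg (k %% c.*2) && (P k == [::])) (slotsof i))).
  move=> /hasP[k1 k1i /andP[t1 /eqP p1]].
  have ne : k1 != k2 by apply/eqP => E; rewrite -E p1 in p2.
  exists k1, k2; split; first split=> //; first exact: slotsof_lt k1i.
    by move: k1i; rewrite slotsofP => /eqP.
  split; first by apply: (good_merge iM) => //; rewrite p1 /=; apply: g2.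
  by apply: potential_merge => //; [exact: slotsof_lt k1i|right; rewrite t1].
move=> /hasPn hn.
have hcnt : runs A false (ss i) < count (fun k => P k != [::]) (slotsof i).
  apply: leq_ltn_trans (leq_trans (A_runs iM) Tg_count) _.
  have -> : count Tg (iota 0 c.*2) = count (fun k => Tg (k %% c.*2)) (slotsof i).
    rewrite /slotsof -[i * c.*2]addn0 iotaDl count_map; apply: eq_in_count => t.
    by rewrite mem_iota /= => tc; rewrite modnMDl modn_small.
  have sub k : k \in slotsof i -> Tg (k %% c.*2) -> P k != [::].
    by move=> hk tk; have := hn k hk; rewrite tk.
  rewrite -!size_filter; have := uniq_leq_size (s1 := k2 :: filter (fun k => Tg (k %% c.*2)) (slotsof i))
     (s2 := filter (fun k => P k != [::]) (slotsof i)).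
  apply; first by rewrite /= mem_filter (negbTE t2) filter_uniq ?iota_uniq.
  move=> k; rewrite inE !mem_filter => /orP[/eqP ->|/andP[tk hk]]; first by rewrite p2.
  by rewrite sub.
have [k1 [k1' [[m1 m2 ne p1] [p1' hi]]]] := adjacent_pieces (uniq_ss iM) (iota_uniq _ _) g1 g2 hcnt.
exists k1, k1'; split.
  split=> //; [exact: slotsof_lt m1|exact: slotsof_lt m2|].
  by move: m1 m2; rewrite !slotsofP => /eqP -> /eqP ->.
split; first exact: (good_merge iM).
by apply: potential_merge => //; [exact: slotsof_lt m1|exact: slotsof_lt m2|left].
Qed.

(** The potential is at most [2 * slots] at the start and decreases with every merge, which bounds
    the extra rounds. *)
Lemma compress h rho P : Der h rho P -> good A P ->
  exists P', [/\ Der (h + 2 * slots) rho P', good A P' &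
     forall k, k < slots -> ~~ Tg (k %% c.*2) -> P' k = [::]].
Proof.
have pot_le Q : potential Q <= 2 * slots.
  rewrite /potential; apply: (@leq_trans (\sum_(k <- iota 0 slots) 2)).
    by apply: leq_sum => k _; rewrite /wgt; case: (Q k != [::]) => //=; case: (Tg _).
  by rewrite big_const_seq count_predT size_iota iter_addn_0.
move: (2 * slots) (pot_le P) => m; elim: m h P => [|m IH] h P hm D gP.
  exists P; rewrite addn0; split=> // k hk tk; apply/eqP; apply: contraT => pk.
  by have [? [? [_ [_]]]] := compress_step gP hk pk tk; rewrite ltnNge (leq_trans hm).
case: (boolP (has (fun k => ~~ Tg (k %% c.*2) && (P k != [::])) (iota 0 slots))).
  move=> /hasP[k]; rewrite mem_iota => hk /andP[tk pk].
  have [k1 [k2 [[h1 h2 ne st p2] [g' hp]]]] := compress_step gP hk pk tk.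
  have [||P' [D' ? ?]] := IH h.+1 (mmerge k1 k2 P) _ _ g'.
  - by rewrite -ltnS; apply: leq_trans hp hm.
  - exact: DerM.
  by exists P'; rewrite addnS -addSn.
move=> /hasPn hn; exists P; split=> //; first by apply: Der_le D; rewrite leq_addr.
move=> k hk tk; have := hn k; rewrite mem_iota hk tk /= negbK => /(_ isT) /eqP.
by [].
Qed.

End Compress.
End Completeness.
End DP.

(** * From the dissection to a short derivation *)

Section Dissection.
Variables (R : realType) (I : instance R) (M c : nat).
Local Notation n := (nterm I).
Local Notation slots := (M * c.*2)%N.
Local Open Scope nat_scope.
Variables (q : 'I_n -> nat) (cap : nat) (ss : nat -> seq 'I_n).
Hypothesis ss_perm : perm_eq (flatten (map ss (iota 0 M))) (enum 'I_n).
Hypothesis ss_load : forall i, i < M -> \sum_(v <- ss i) q v <= cap.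
Hypothesis c_gt0 : 0 < c.
Hypothesis q_le : forall v, q v <= cap.
Variable f : bool -> 'I_n -> nat.
Hypothesis f_mono : forall d u v, (coord d (pos u) <= coord d (pos v))%R -> f d u <= f d v.
Hypothesis f_inj : forall u v, f true u = f true v -> f false u = f false v -> u = v.

(** A set that is downward closed in coordinate [d] is expressed by a threshold: the code of its
    lowest outsider, or the code of minus or plus infinity for the empty or the full set. Dissection
    lines thereby become thresholds among terminal coordinates. *)
Definition cutp (d : bool) (A : pred 'I_n) : nat :=
  if [forall v, ~~ A v] then 0 else if [forall v, A v] then n.+1 else
  if [pick u | ~~ A u && [forall w, ~~ A w ==> (coord d (pos u) <= coord d (pos w))%R]]
    is Some u then (val u).+1 else 0.

Definition cut (d : bool) (a : nat) : nat := cutp d (fun v => f d v < a).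

Lemma cut_le d a : cut d a <= n.+1.
Proof.
rewrite /cut /cutp; case: ifP => // _; case: ifP => // _; case: pickP => // u _.
exact: leqW (ltn_ord u).
Qed.

Lemma cutP d a v : ltc d v (cut d a) = (f d v < a).
Proof.
rewrite /cut /cutp; case: ifP => [/forallP h|h0]; first by rewrite /ltc (negbTE (h v)).
case: ifP => [/forallP h|h1]; first by rewrite /ltc /= ltnSn h.
case: pickP => [u /andP[hu /forallP hm]|hn].
  rewrite /ltc /= ltnNge (ltn_ord u) /= /codeloc valK; case: (ltnP (f d v) a) => hv.
    apply/idP; rewrite ltNge; apply: contraNN hu => /f_mono h.
    exact: leq_ltn_trans hv.
  apply/negbTE; rewrite -leNgt; have := hm v; by rewrite -leqNgt hv.
exfalso; move/negbT: h1; rewrite negb_forall => /existsP[u0 hu0].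
have := @Order.TotalTheory.arg_minP _ _ _ u0 (fun u => ~~ (f d u < a)) (fun u => coord d (pos u)) hu0.
case=> u hu hm; have := hn u; rewrite hu /= => /negbT /negP; apply.
by apply/forallP => w; apply/implyP => /hm.
Qed.

Definition inR (lo hi : bool -> nat) (v : 'I_n) : bool :=
  (lo true <= f true v < hi true) && (lo false <= f false v < hi false).

Definition region_of (lo hi : bool -> nat) : region := fun d => (cut d (lo d), cut d (hi d)).

Lemma inreg_region_of lo hi v : inreg (region_of lo hi) v = inR lo hi v.
Proof. by rewrite /inreg /inR /= !cutP -!leqNgt andbA. Qed.

Lemma regok_region_of lo hi : regok I (region_of lo hi).
Proof. by move=> d; rewrite !cut_le. Qed.

Definition slab (d : bool) (a b : nat) : nat := #|[pred v | a <= f d v < b]|.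

(** The rounds are bounded by the number of terminals in the two slabs spanned by the box, and not
    by the depth of the dissection, which depends on the coordinates. Full slabs are counted because
    a threshold code changes only when its slab gains a terminal somewhere. *)
Definition node (lo hi : bool -> nat) : Prop := exists P h,
  [/\ Der M c q cap h (region_of lo hi) P, good M c ss (inR lo hi) P &
      h <= (2 * slots).+1 * (slab true (lo true) (hi true) + slab false (lo false) (hi false))].

Definition upd (g : bool -> nat) (d : bool) (x : nat) : bool -> nat :=
  fun e => if e == d then x else g e.

Lemma slab0 d a b : a <= b -> slab d a b = 0 -> forall v, (f d v < a) = (f d v < b).
Proof.
move=> ab h v; have := card0_eq h v; rewrite inE => H.
case: (ltnP (f d v) a) => h1; first by rewrite (leq_trans h1 ab).
by move: H; rewrite h1 /= => ->.
Qed.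

Lemma slab_cat d a x b : a <= x <= b -> slab d a b = slab d a x + slab d x b.
Proof.
move=> /andP[ax xb]; rewrite /slab -(cardID [pred v | f d v < x]).
congr (_ + _); apply: eq_card => v; rewrite !inE; case: (ltnP (f d v) x) => h /=.
- by rewrite (leq_trans h xb) !andbT.
- by rewrite !andbF.
- by [].
- by rewrite (leq_trans ax h).
Qed.

Lemma leaf_node lo hi : (forall d, lo d <= hi d) -> (forall u v, inR lo hi u -> inR lo hi v -> u = v) -> node lo hi.
Proof.
move=> le h; case: (pickP (inR lo hi)) => [v hv|h0]; last first.
  exists (@nopiece _ I), 0; split=> //.
    by apply: Der0; [exact: regok_region_of|move=> d v; rewrite /region_of /= !cutP => /leq_trans; apply; exact: le|move=> v; rewrite inreg_region_of h0].
  move=> i iM; split=> [|k _]; last exact: infix0s.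
  rewrite (eq_filter h0) filter_pred0 (_ : flatten _ = [::]) //.
  by elim: (slotsof c i) => //= k ks ->.
have E u : inR lo hi u = (u == v).
  by apply/idP/eqP => [/h|->] //; apply.
have vin : v \in flatten (map ss (iota 0 M)) by rewrite (perm_mem ss_perm) mem_enum.
case/flattenP: vin => _ /mapP[i + ->]; rewrite mem_iota /= add0n => iM vi.
have c2 : 0 < c.*2 by rewrite double_gt0.
have ki : i * c.*2 \in slotsof c i by rewrite mem_iota leqnn /= -{1}[i * _]addn0 ltn_add2l.
exists (single (i * c.*2) v), 0; split=> //.
  apply: Der1; [exact: regok_region_of|by move=> u; rewrite inreg_region_of E|].
  exact: slotsof_lt ki.
have uss := uniq_ss ss_perm.
have flE (ks : seq nat) : uniq ks ->
    flatten (map (single (i * c.*2) v) ks) = if i * c.*2 \in ks then [:: v] else [::].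
  elim: ks => //= k ks IH /andP[h1 h2]; rewrite IH // inE /single eq_sym.
  by case: eqP => [->|_] //=; rewrite (negbTE h1).
move=> j jM; rewrite flE ?iota_uniq //; case: (eqVneq j i) => [->|nji].
  rewrite ki; split.
    rewrite (eq_filter (a2 := pred1 v)); last by move=> u; rewrite /= E.
    by rewrite filter_pred1_uniq // uss.
  move=> k _; rewrite /single; case: ifP => _; last exact: infix0s.
  by case/splitPr: vi => a b; apply/infixP; exists a, b.
have nij : i * c.*2 \notin slotsof c j by rewrite slotsofP // /stour mulnK // eq_sym.
rewrite (negbTE nij); split; last first.
  move=> k hk; rewrite /single; case: eqP => [Ek|_]; last exact: infix0s.
  by rewrite -Ek hk in nij.
rewrite (eq_in_filter (a2 := pred0)) ?filter_pred0 // => u hu; rewrite /= E.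
apply/negbTE/eqP => Eu; subst u; move/negP: nij; apply; rewrite slotsofP // /stour mulnK //.
have ufl : uniq (flatten (map ss (iota 0 M))) by rewrite (perm_uniq ss_perm) enum_uniq.
apply/eqP; apply: (@flatten_slot _ _ ss (iota 0 M) i j v ufl); rewrite ?mem_iota //.
Qed.

(** If the slab on one side of the cut holds no terminal, the threshold code does not change, the
    region is that of the other side, and no round is spent. Otherwise the slab count of both sides
    drops strictly, which leaves room for [2 * slots] merges in each child and one joining. *)
Lemma node_split d x lo hi : lo d <= x <= hi d ->
  node lo (upd hi d x) -> node (upd lo d x) hi ->
  (forall i, i < M -> runs (inR lo (upd hi d x)) false (ss i) <= c) ->
  (forall i, i < M -> runs (inR (upd lo d x) hi) false (ss i) <= c) -> node lo hi.
Proof.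
move=> lxh n1 n2 r1 r2; have /andP[lx xh] := lxh.
pose mu lo hi := slab true (lo true) (hi true) + slab false (lo false) (hi false).
have mu1 : mu lo hi = mu lo (upd hi d x) + slab d x (hi d).
  by rewrite /mu /upd; case: d lxh {n1 n2 r1 r2 lx xh} => /= h; rewrite (slab_cat _ h); lia.
have mu2 : mu lo hi = mu (upd lo d x) hi + slab d (lo d) x.
  by rewrite /mu /upd; case: d lxh {n1 n2 r1 r2 lx xh mu1} => /= h; rewrite (slab_cat _ h); lia.
case: (posnP (slab d (lo d) x)) => [s0|s1].
  have h0 := slab0 lx s0.
  have Ec : cut d x = cut d (lo d) by rewrite /cut; congr (cutp d _); apply/funext => v; rewrite h0.
  have [P [h [D gP hh]]] := n2; exists P, h; split.
  - rewrite (_ : region_of lo hi = region_of (upd lo d x) hi) //; apply/funext => e.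
    by rewrite /region_of /upd; case: eqP => // ->; rewrite Ec.
  - rewrite (_ : inR lo hi = inR (upd lo d x) hi) //; apply/funext => v.
    by rewrite /inR /upd; case: d {n1 n2 r1 r2 lx xh mu1 mu2 s0 lxh Ec D gP hh} h0 => h0 /=; rewrite ![_ <= f _ v]leqNgt h0.
  - by apply: leq_trans hh _; rewrite leq_mul2l -/(mu _ _) -/(mu lo hi) mu2 leq_addr orbT.
case: (posnP (slab d x (hi d))) => [s0|s2].
  have h0 := slab0 xh s0.
  have Ec : cut d x = cut d (hi d) by rewrite /cut; congr (cutp d _); apply/funext => v; rewrite h0.
  have [P [h [D gP hh]]] := n1; exists P, h; split.
  - rewrite (_ : region_of lo hi = region_of lo (upd hi d x)) //; apply/funext => e.
    by rewrite /region_of /upd; case: eqP => // ->; rewrite Ec.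
  - rewrite (_ : inR lo hi = inR lo (upd hi d x)) //; apply/funext => v.
    by rewrite /inR /upd; case: d {n1 n2 r1 r2 lx xh mu1 mu2 s0 s1 lxh Ec D gP hh} h0 => h0 /=; rewrite h0.
  - by apply: leq_trans hh _; rewrite leq_mul2l -/(mu _ _) -/(mu lo hi) mu1 leq_addr orbT.
have [P1 [h1 [D1 g1 b1]]] := n1; have [P2 [h2 [D2 g2 b2]]] := n2.
(* Pieces of the lower half go to the first [c] slots of each tour, those of the upper half to the
   last [c]. *)
have cT : c <= count (fun t => t < c) (iota 0 c.*2).
  rewrite -addnn iotaD count_cat; apply: leq_trans (leq_addr _ _).
  rewrite (eq_in_count (a2 := predT)) ?count_predT ?size_iota // => t.
  by rewrite mem_iota => /andP[_ ->].
have cT' : c <= count (fun t => c <= t) (iota 0 c.*2).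
  rewrite -addnn iotaD count_cat; apply: leq_trans (leq_addl _ _).
  rewrite (eq_in_count (a2 := predT)) ?count_predT ?size_iota // => t.
  by rewrite mem_iota => /andP[-> _].
have [Q1 [E1 k1 z1]] := compress ss_perm c_gt0 cT r1 D1 g1.
have [Q2 [E2 k2 z2]] := compress ss_perm c_gt0 cT' r2 D2 g2.
have AE v : inR lo hi v = inR lo (upd hi d x) v || inR (upd lo d x) hi v.
  rewrite /inR /upd; case: d lx xh {n1 n2 r1 r2 mu1 mu2 s1 s2 lxh D1 D2 g1 g2 b1 b2 E1 E2 k1 k2} => /= lx xh;
  move: (f true v) (f false v) => a b.
    by case: (ltnP a x) => h; rewrite ?andbF /= ?orbF //; [rewrite (leq_trans h xh)|rewrite (leq_trans lx h)]; rewrite ?andbT ?andbF ?orbF ?(leqNgt x) ?h //=; rewrite ?orbF //.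
  by case: (ltnP b x) => h; rewrite ?andbF /= ?orbF //; [rewrite (leq_trans h xh)|rewrite (leq_trans lx h)]; rewrite ?andbT ?andbF ?orbF ?(leqNgt x) ?h //= ?andbF ?orbF //.
have Adis v : inR lo (upd hi d x) v -> inR (upd lo d x) hi v -> False.
  rewrite /inR /upd; case: (d) => /= /andP[/andP[_ a1] /andP[_ a2]] /andP[/andP[a3 _] /andP[a4 _]].
    by move: (leq_trans a1 a3); rewrite ltnn.
  by move: (leq_trans a2 a4); rewrite ltnn.
pose m := maxn (h1 + 2 * slots) (h2 + 2 * slots).
exists (madd Q1 Q2), m.+1; split.
- have -> : region_of lo hi = glue d (region_of lo (upd hi d x)) (region_of (upd lo d x) hi).
    by apply/funext => e; rewrite /glue /region_of /upd eqxx; case: eqP => [->|].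
  apply: DerA.
  + exact: Der_le (leq_maxl _ _) E1.
  + exact: Der_le (leq_maxr _ _) E2.
  + by rewrite /adjacent /region_of /upd eqxx; case: (d); rewrite /= !eqxx.
  + move=> k hk; case: (ltnP (k %% c.*2) c) => hc.
      by right; apply: z2 => //; rewrite -ltnNge.
    by left; apply: z1 => //; rewrite -leqNgt.
  + move=> i iM; rewrite (good_load _ _ iM k1) // (good_load _ _ iM k2) //.
    apply: leq_trans (ss_load iM); rewrite big_mkcond [X in _ + X]big_mkcond -big_split /=.
    apply: leq_sum => v _; have := @Adis v.
    by case: (inR lo _ v); case: (inR _ hi v) => //= h; rewrite ?addn0 //; case: h.
- move=> i iM; have [p1 i1] := k1 i iM; have [p2 i2] := k2 i iM; split.
    have pm : perm_eq (flatten (map (madd Q1 Q2) (slotsof c i)))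
        (flatten (map Q1 (slotsof c i)) ++ flatten (map Q2 (slotsof c i))).
      apply/permP => p; rewrite count_cat; elim: (slotsof c i) => //= k ks IH.
      by rewrite !count_cat IH; lia.
    apply: perm_trans pm _; apply: perm_trans (perm_cat p1 p2) _.
    apply/permP => p; rewrite count_cat !count_filter; rewrite -count_predUI addnC.
    rewrite (eq_count (a2 := pred0)) ?count_pred0 ?add0n => [|v]; last first.
      by apply/negP => /= /andP[/andP[_ a1] /andP[_ a2]]; apply: (Adis v).
    by apply: eq_count => v /=; rewrite AE; case: (p v).
  move=> k hk; rewrite /madd; have kM := slotsof_lt iM hk.
  case: (ltnP (k %% c.*2) c) => hc.
    by rewrite (z2 k kM) ?cats0 ?i1 // -ltnNge.
  by rewrite (z1 k kM) ?i2 // -leqNgt.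
- rewrite -/(mu lo hi); move: b1 b2; rewrite -!/(mu _ _) => b1 b2.
  have l1 : mu lo (upd hi d x) < mu lo hi by rewrite mu1 -addn1 leq_add2l.
  have l2 : mu (upd lo d x) hi < mu lo hi by rewrite mu2 -addn1 leq_add2l.
  have A h t : h <= (2 * slots).+1 * t -> t < mu lo hi -> h + 2 * slots < (2 * slots).+1 * mu lo hi.
    move=> ht tm; apply: (@leq_trans ((2 * slots).+1 * t.+1)); last by rewrite leq_mul2l tm orbT.
    by rewrite mulnS addnC addSn ltnS leq_add2l.
  by move: (A _ _ b1 l1) (A _ _ b2 l2); rewrite /m -/(_ < _) gtn_max => -> ->.
Qed.

Variable K : nat.
Hypothesis f_lt : forall d v, f d v < 2 ^ K.+1.
Hypothesis f_runs : forall h h' q1 q2, h <= K -> h' = h \/ h' = h.+1 ->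
  q1 < 2 ^ (K.+1 - h) -> q2 < 2 ^ (K.+1 - h') -> forall i, i < M ->
  runs (fun v => rect h h' q1 q2 (f true v) (f false v)) false (ss i) <= c.

Definition box (x1 x2 : nat) : bool -> nat := fun d => if d then x1 else x2.

(** A square is halved by a vertical line and each half by a horizontal one; this is why runs have
    to be bounded on half squares too. At unit size [f_inj] leaves at most one terminal. *)
Lemma node_square h q1 q2 : h <= K.+1 -> q1 < 2 ^ (K.+1 - h) -> q2 < 2 ^ (K.+1 - h) ->
  node (box (q1 * 2 ^ h) (q2 * 2 ^ h)) (box (q1.+1 * 2 ^ h) (q2.+1 * 2 ^ h)).
Proof.
elim: h q1 q2 => [|h IH] q1 q2 hK h1 h2.
  apply: leaf_node => [[]|u v]; rewrite /inR /box ?expn0 ?muln1 // !ltnS => /andP[a1 a2] /andP[a3 a4].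
  by apply: f_inj; lia.
have e2 : 2 ^ (K.+1 - h) = (2 ^ (K.+1 - h.+1)).*2 by rewrite -mul2n -expnS subSS -subSn.
have dbl t : t < 2 ^ (K.+1 - h.+1) -> t.*2 < 2 ^ (K.+1 - h) /\ t.*2.+1 < 2 ^ (K.+1 - h).
  by move=> ht; rewrite e2 -!mul2n; move: ht; clear; lia.
have rr hh q3 q4 : hh = h \/ hh = h.+1 -> q3 < 2 ^ (K.+1 - h) -> q4 < 2 ^ (K.+1 - hh) ->
    forall i, i < M -> runs (inR (box (q3 * 2 ^ h) (q4 * 2 ^ hh)) (box (q3.+1 * 2 ^ h) (q4.+1 * 2 ^ hh))) false (ss i) <= c.
  move=> a1 a2 a3 i iM; apply: f_runs => //; exact: hK.
have half q3 : q3 < 2 ^ (K.+1 - h) ->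
    node (box (q3 * 2 ^ h) (q2 * 2 ^ h.+1)) (box (q3.+1 * 2 ^ h) (q2.+1 * 2 ^ h.+1)).
  move=> h3; have [d1 d2] := dbl q2 h2.
  have ub x y z : upd (box x y) false z = box x z by apply/funext => -[].
  have eA : q2 * 2 ^ h.+1 = q2.*2 * 2 ^ h by rewrite expnS -mul2n; lia.
  have eB : q2.+1 * 2 ^ h.+1 = q2.*2.+2 * 2 ^ h by rewrite expnS -doubleS -mul2n; lia.
  apply: (@node_split false (q2.*2.+1 * 2 ^ h)); rewrite ?ub /=; rewrite ?eA ?eB.
  - by rewrite !leq_mul2r leqnSn leqnSn !orbT.
  - exact: IH (ltnW hK) h3 d1.
  - exact: IH (ltnW hK) h3 d2.
  - by apply: rr => //; left.
  - by apply: rr => //; left.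
have [d1 d2] := dbl q1 h1.
have ub x y z : upd (box x y) true z = box z y by apply/funext => -[].
have eA : q1 * 2 ^ h.+1 = q1.*2 * 2 ^ h by rewrite expnS -mul2n; lia.
have eB : q1.+1 * 2 ^ h.+1 = q1.*2.+2 * 2 ^ h by rewrite expnS -doubleS -mul2n; lia.
rewrite eA eB.
apply: (@node_split true (q1.*2.+1 * 2 ^ h)); rewrite ?ub /=.
- by rewrite !leq_mul2r leqnSn leqnSn !orbT.
- exact: half d1.
- exact: half d2.
- by apply: rr => //; right.
- by apply: rr => //; right.
Qed.

(** At the root every tour is a single run, so [compress] with one target slot per tour leaves one
    piece, which is the tour itself. *)
Lemma dp_complete : exists P h, [/\ Der M c q cap h (whole I) P,
  h <= (2 * slots).+1 * (2 * n) + 2 * slots,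
  (forall i, i < M -> P (i * c.*2) = ss i) &
  forall k, k < slots -> k %% c.*2 != 0 -> P k = [::]].
Proof.
have c2 : 0 < c.*2 by rewrite double_gt0.
have [P [h [D gP hh]]] : exists P h, [/\ Der M c q cap h (whole I) P, good M c ss (fun=> true) P &
   h <= (2 * slots).+1 * (2 * n)].
  (* Without terminals [region_of] gives both thresholds the code 0, which are not those of [whole];
     the root is then derived directly. *)
  case: (posnP n) => [n0|n0].
    exists (@nopiece _ I), 0; split=> //.
      by apply: Der0 => [d //|d v|v]; have := ltn_ord v; rewrite {2}n0.
    move=> i iM; split=> [|k _]; last exact: infix0s.
    have -> : ss i = [::] by case: (ss i) => // v s; have := ltn_ord v; rewrite {2}n0.
    by rewrite (_ : flatten _ = [::]) //; elim: (slotsof c i) => //= k ks ->.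
  have k0 : 0 < 2 ^ (K.+1 - K.+1) by rewrite subnn.
  have [P [h [D gP hh]]] := node_square (leqnn K.+1) k0 k0.
  have inT v : inR (box (0 * 2 ^ K.+1) (0 * 2 ^ K.+1)) (box (1 * 2 ^ K.+1) (1 * 2 ^ K.+1)) v.
    by rewrite /inR /box !mul0n !mul1n !f_lt.
  exists P, h; split.
  - rewrite (_ : whole I = region_of (box (0 * 2 ^ K.+1) (0 * 2 ^ K.+1)) (box (1 * 2 ^ K.+1) (1 * 2 ^ K.+1))) //.
    apply/funext => d; rewrite /region_of /whole /cut /cutp.
    have -> : box (0 * 2 ^ K.+1) (0 * 2 ^ K.+1) d = 0 by case: d.
    have -> : box (1 * 2 ^ K.+1) (1 * 2 ^ K.+1) d = 2 ^ K.+1 by case: d; rewrite /= mul1n.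
    rewrite ifT; last by apply/forallP.
    rewrite ifF; last by apply/negbTE/forallPn; exists (Ordinal n0); rewrite negbK f_lt.
    by rewrite ifT //; apply/forallP => v; rewrite f_lt.
  - by rewrite (_ : (fun=> true) = inR (box (0 * 2 ^ K.+1) (0 * 2 ^ K.+1)) (box (1 * 2 ^ K.+1) (1 * 2 ^ K.+1))) //; apply/funext => v; rewrite inT.
  - apply: leq_trans hh _; rewrite leq_mul2l; apply/orP; right; rewrite mul2n -addnn.
    by apply: leq_add; apply: leq_trans (max_card _) _; rewrite card_ord.
have [|i iM|Q [E gQ z]] := @compress _ I M c q cap ss ss_perm c_gt0 (pred1 0) 1 (fun=> true) _ _ _ _ _ D gP.
- by rewrite (count_uniq_mem _ (iota_uniq _ _)) mem_iota c2.
- by case: (ss i) => //= v s; elim: s.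
exists Q, (h + 2 * slots); split=> //; first by rewrite leq_add2r.
move=> i iM; have [p1 p2] := gQ i iM.
have fl : flatten (map Q (slotsof c i)) = Q (i * c.*2).
  rewrite /slotsof; have [m Em] : exists m, c.*2 = m.+1 by case: (c.*2) c2 => // m; exists m.
  rewrite {2}Em /= (_ : flatten _ = [::]) ?cats0 //.
  have H ks : (forall k, k \in ks -> Q k = [::]) -> flatten (map Q ks) = [::].
    by elim: ks => //= k ks IH hk; rewrite hk ?mem_head // IH // => k' h'; apply: hk; rewrite inE h' orbT.
  apply: H => k; rewrite mem_iota => /andP[k1 k2].
  have k3 : k < i * c.*2 + c.*2 by rewrite {2}Em addnS -addSn.
  have kE : k \in slotsof c i by rewrite mem_iota ltnW.
  apply: z; first exact: slotsof_lt kE.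
  rewrite /= -(subnKC (ltnW k1)) modnMDl modn_small; last first.
    by rewrite ltn_subLR ?(ltnW k1).
  by rewrite subn_eq0 -ltnNge.
rewrite fl (eq_filter (a2 := predT)) // filter_predT in p1.
have /infixP[a [b Es]] : infix (Q (i * c.*2)) (ss i).
  by apply: p2; rewrite mem_iota leqnn /= -{1}[i * _]addn0 ltn_add2l.
have := perm_size p1; rewrite Es !size_cat => sz.
have a0 : a = [::] by apply: size0nil; move: sz; clear; lia.
have b0 : b = [::] by apply: size0nil; move: sz; clear; lia.
by rewrite a0 b0 cats0.
Qed.

End Dissection.

(** * Verification of real RAM programs *)

Section Runs.
Variable R : realType.
Implicit Types (s : state R) (Q : state R -> Prop).
Local Open Scope nat_scope.

(** A total-correctness triple with a time bound. [T] is only an upper bound, so branches of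
    different cost can share it. *)
Definition run (p : cmd) (T : nat) s Q : Prop :=
  exists t s', [/\ exec p s t s', t <= T & Q s'].

Lemma run_weak p T T' s Q Q' : run p T s Q -> T <= T' -> (forall s', Q s' -> Q' s') -> run p T' s Q'.
Proof. by move=> [t [s' [h1 h2 h3]]] h4 h5; exists t, s'; split=> //; [exact: leq_trans h4|exact: h5]. Qed.

Lemma run_skip s Q : Q s -> run Skip 1 s Q.
Proof. by exists 1, s; split=> //; apply: ExecSkip. Qed.

Lemma run_istore a e s Q : Q (istore s (ieval s a) (ieval s e)) -> run (IStore a e) 1 s Q.
Proof. by move=> h; eexists; eexists; split; [exact: ExecIStore|by []|]. Qed.

Lemma run_rstore a e s Q : Q (rstore s (ieval s a) (reval s e)) -> run (RStore a e) 1 s Q.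
Proof. by move=> h; eexists; eexists; split; [exact: ExecRStore|by []|]. Qed.

Lemma run_seq p1 p2 T1 T2 s Q : run p1 T1 s (fun s1 => run p2 T2 s1 Q) ->
  run (Seq p1 p2) (T1 + T2) s Q.
Proof.
move=> [t1 [s1 [e1 l1 [t2 [s2 [e2 l2 h]]]]]]; exists (t1 + t2), s2.
by split=> //; [exact: ExecSeq e1 e2|exact: leq_add].
Qed.

Lemma run_if b p1 p2 T s Q : (if beval s b then run p1 T s Q else run p2 T s Q) ->
  run (If b p1 p2) T.+1 s Q.
Proof.
move=> h; have [t [s' [e l q]]] : run (if beval s b then p1 else p2) T s Q by case: beval h.
by exists t.+1, s'; split=> //; apply: ExecIf.
Qed.

Definition V (k : nat) : iexp := ILoad (INat k).
Definition set (k : nat) (e : iexp) : cmd := IStore (INat k) e.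

Definition loop (v : nat) (ea ee ew : iexp) (body : cmd) : cmd :=
  Seq (set v ea) (While (BNot (BILe ee (V v))) (Seq body (set v (IAdd (V v) ew)))).

(** [Inv i] describes the state at the test before iteration [i], so the body must establish
    [Inv i.+1] for the counter already advanced. The two extra steps per iteration are the test and
    the increment. *)
Lemma run_loop (Inv : nat -> state R -> Prop) v a0 m w T ea ee ew body s Q :
  0 < w -> ieval s ea = a0 -> Inv 0 (istore s v a0) ->
  (forall i s, Inv i s -> imem s v = a0 + i * w /\ ieval s ee = a0 + m * w) ->
  (forall i s, i < m -> Inv i s -> run body T s (fun s' =>
     [/\ imem s' v = a0 + i * w, ieval s' ew = w & Inv i.+1 (istore s' v (a0 + i.+1 * w))])) ->
  (forall s', Inv m s' -> Q s') ->
  run (loop v ea ee ew body) (m * (T + 2) + 2) s Q.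
Proof.
move=> w0 Ea I0 Ii Ib IQ.
have W k i s1 : i + k = m -> Inv i s1 ->
    run (While (BNot (BILe ee (V v))) (Seq body (set v (IAdd (V v) ew)))) (k * (T + 2) + 1) s1 Q.
  elim: k i s1 => [|k IH] i s1 ik h.
    have [h1 h2] := Ii _ _ h; exists 1, s1; split=> //; last by apply: IQ; rewrite -ik addn0.
    by apply: ExecWhileF; rewrite /= h1 h2 -ik addn0 negbK.
  have im : i < m by rewrite -ik addnS ltnS leq_addr.
  have [h1 h2] := Ii _ _ h; have [t1 [s2 [e1 l1 [a1 a2 a3]]]] := Ib i s1 im h.
  have ik' : i.+1 + k = m by rewrite addSn -addnS.
  have [t2 [s3 [e2 l2 q]]] := IH i.+1 _ ik' a3.
  exists (t1 + 1 + t2).+1, s3; split=> //; last by move: l1 l2; clear; rewrite mulSn; lia.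
  apply: (ExecWhileT _ _ e2); first by rewrite /= h1 h2 -ltnNge ltn_add2l ltn_mul2r w0.
  apply: ExecSeq e1 _.
  have -> : istore s2 v (a0 + i.+1 * w) = istore s2 (ieval s2 (INat v)) (ieval s2 (IAdd (V v) ew)).
    by rewrite /= a1 a2 -addnA -mulSnr.
  exact: ExecIStore.
apply: (@run_weak _ (1 + (m * (T + 2) + 1)) _ _ Q) => //; last by rewrite addnCA.
apply: run_seq; apply: run_istore; rewrite [ieval _ (INat v)]/= Ea; exact: W I0.
Qed.

(* [eqx K s s']: the states differ at most in the variables [1 .. K - 1]. *)
Definition eqx (K : nat) s s' : Prop :=
  rmem s' =1 rmem s /\ forall a, (a == 0) || (K <= a) -> imem s' a = imem s a.

(** Integers can only be added and subtracted, so products are computed by repeated addition, with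
    [cnt] as counter. *)
Definition mul (dst cnt : nat) (ea eb : iexp) : cmd :=
  Seq (set dst (INat 0)) (loop cnt (INat 0) eb (INat 1) (set dst (IAdd (V dst) ea))).

Lemma run_mul dst cnt ea eb K s va vb : 0 < dst < K -> 0 < cnt < K -> dst != cnt ->
  (forall s', rmem s' =1 rmem s -> (forall a, a != dst -> a != cnt -> imem s' a = imem s a) ->
     ieval s' ea = va /\ ieval s' eb = vb) ->
  run (mul dst cnt ea eb) (vb * 3 + 3) s (fun s' => [/\ rmem s' =1 rmem s,
     forall a, a != dst -> a != cnt -> imem s' a = imem s a & imem s' dst = vb * va]).
Proof.
move=> hd hc ne ev.
rewrite -[3 in X in run _ X]/(1 + 2) addnCA; apply: run_seq; apply: run_istore => /=.
set s0 := istore _ _ _.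
apply: (run_loop (Inv := fun i s' => [/\ rmem s' =1 rmem s,
  forall a, a != dst -> a != cnt -> imem s' a = imem s a, imem s' dst = i * va & imem s' cnt = i])
  (a0 := 0) (w := 1)) => //.
- split=> [//|a a1 a2||] /=.
  + by rewrite (negbTE a1) (negbTE a2).
  + by case: eqP => [E|_]; [rewrite E eqxx in ne|rewrite eqxx mul0n].
  + by rewrite eqxx.
- move=> i s1 [h1 h2 h3 h4]; have [_ e2] := ev s1 h1 h2.
  by rewrite h4 e2 !muln1 !add0n.
- move=> i s1 im [h1 h2 h3 h4]; apply: run_istore => /=.
  have [e1 _] := ev s1 h1 h2.
  have -> : (cnt == dst) = false by apply/eqP => E; rewrite E eqxx in ne.
  rewrite h4 muln1 add0n; split=> //.
  split=> [//|a a1 a2||] /=.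
  + by rewrite (negbTE a1) (negbTE a2) h2.
  + by case: eqP => [E|_]; [rewrite E eqxx in ne|rewrite eqxx e1 h3 mulSnr].
  + by rewrite eqxx muln1 add0n.
- by move=> s1 [h1 h2 h3 _].
Qed.

Definition fill (v : nat) (ed em ex : iexp) : cmd :=
  loop v (INat 0) em (INat 1) (IStore (IAdd ed (V v)) ex).

Lemma run_fill v ed em ex s d m (F : nat -> nat) : v < d ->
  (forall o s', o <= m -> rmem s' =1 rmem s -> imem s' v = o ->
     (forall a, a != v -> ~~ (d <= a < d + m) -> imem s' a = imem s a) ->
     (forall a, d + o <= a -> imem s' a = imem s a) ->
     [/\ ieval s' ed = d, ieval s' em = m & o < m -> ieval s' ex = F o]) ->
  run (fill v ed em ex) (m * 3 + 2) s (fun s' => [/\ rmem s' =1 rmem s,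
     forall a, a != v -> ~~ (d <= a < d + m) -> imem s' a = imem s a &
     forall o, o < m -> imem s' (d + o) = F o]).
Proof.
move=> vd ev.
pose Inv i s' := [/\ i <= m, rmem s' =1 rmem s, imem s' v = i,
  forall a, a != v -> ~~ (d <= a < d + m) -> imem s' a = imem s a &
  (forall a, d + i <= a -> imem s' a = imem s a) /\ forall o, o < i -> imem s' (d + o) = F o].
rewrite -[3]/(1 + 2); apply: (@run_loop Inv v 0 m 1 1) => //.
- split=> //=; [by rewrite eqxx|by move=> a /negbTE ->|split=> // a ha].
  by case: eqP => // E; move: ha; rewrite E addn0 leqNgt vd.
- move=> i s1 [h0 h1 h2 h3 [h4 h5]]; have [_ e2 _] := ev i s1 h0 h1 h2 h3 h4.
  by rewrite h2 e2 !muln1 !add0n.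
- move=> i s1 im [h0 h1 h2 h3 [h4 h5]]; apply: run_istore => /=.
  have [e1 _ e3] := ev i s1 h0 h1 h2 h3 h4; rewrite (e3 im) e1 h2.
  have vne a : d <= a -> (a == v) = false.
    by move=> da; apply/eqP => E; move: vd; rewrite -E ltnNge da.
  have vne' : (v == d + i) = false.
    by apply/eqP => E; move: vd; rewrite E ltnNge leq_addr.
  rewrite vne' muln1 add0n; split=> //; split=> //=.
  + by rewrite eqxx muln1 add0n.
  + move=> a av hd'; rewrite (negbTE av); case: eqP => [E|_]; last exact: h3.
    by move: hd'; rewrite E leq_addr ltn_add2l im.
  + split=> [a ha|o oi].
      rewrite vne; last by apply: leq_trans ha; rewrite leq_addr.
      case: eqP => [E|_]; first by move: ha; rewrite E addnS ltnn.
      by apply: h4; apply: ltnW; rewrite -addnS.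
    rewrite vne ?leq_addr // eqn_add2l; case: eqP => [->|/eqP ne] //.
    by apply: h5; move: oi; rewrite ltnS leq_eqVlt (negbTE ne).
- by move=> s1 [_ h1 _ h3 [_ h5]]; split.
Qed.

End Runs.

(** * The program *)

Section Program.
Variables (M c : nat).
Local Open Scope nat_scope.
Definition nslots := M * c.*2.
(** Layout of a block: a presence flag, the four thresholds, the [M] loads, then the first and the
    last terminals of all slots. These [keylen] entries form the key. The successors of all terminal
    codes follow; they recover the pieces but do not belong to the key. *)
Definition oload i := 5 + i.
Definition ost k := 5 + M + k.
Definition oen k := 5 + M + nslots + k.
Definition keylen := 5 + M + nslots + nslots.
Definition nvars := 20.

(** Integer cells below 20 are variables. A block for the current candidate starts at [eCA], the
    rounded demands at [eQ], the output under construction at [eO] and the table at [eTB]. The real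
    cell at the address of a block holds its cost, so [eCA] must also lie beyond the [3 n + 2] input
    reals. The base [eB] exceeds every key entry, loads being at most [2 n]. *)
Definition eN := V 0.
Definition eW := IAdd eN (INat keylen.+1).
Definition eB := IAdd (IAdd eN eN) (INat 3).
Definition eCA := IAdd (IAdd (IAdd eN eN) eN) (INat (nvars + 2)).
Definition eQ := IAdd eCA eW.
Definition eO := IAdd (IAdd eQ eN) (INat 1).
Definition eTB := IAdd (IAdd (IAdd eO eN) eN) (INat (M + 2 + nvars)).
Definition vT := 19.
Definition eTE := IAdd eTB (V vT).
Definition at_ (e : iexp) (o : nat) := ILoad (IAdd e (INat o)).

Definition seqs (ps : seq cmd) : cmd := foldr Seq Skip ps.
Definition ball (bs : seq bexp) : bexp := foldr BAnd (BILe (INat 0) (INat 0)) bs.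
Definition bieq (a b : iexp) : bexp := BAnd (BILe a b) (BILe b a).
Definition bpos (a : iexp) : bexp := BILe (INat 1) a.

Definition pkey (os : seq nat) : cmd :=
  foldr (fun o p => Seq (mul 3 2 (V 4) eB) (Seq (set 4 (IAdd (V 3) (at_ eCA o))) p)) Skip os.

(** The key, read as a number in base [eB], is the index of its block. This direct addressing keeps
    the table polynomial because [keylen] is a constant. A present block is overwritten only by a
    cheaper one. *)
Definition pinsert : cmd :=
  Seq (set 4 (INat 0)) (Seq (pkey (iota 0 keylen)) (Seq (mul 3 2 (V 4) eW)
  (Seq (set 5 (IAdd eTB (V 3)))
  (If (BNot (BAnd (bpos (at_ (V 5) 0)) (BRLe (RLoad (V 5)) (RLoad eCA))))
    (Seq (fill 1 (V 5) eW (ILoad (IAdd eCA (V 1)))) (RStore (V 5) (RLoad eCA)))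
    Skip)))).

End Program.

(** * Contents of the memory, invariant of the table, insertion *)

Section Semantics.
Variables (R : realType) (I : instance R) (M c : nat).
Local Notation n := (nterm I).
Local Notation slots := (nslots M c).
Local Notation klen := (keylen M c).
Local Open Scope nat_scope.
Implicit Types (s : state R) (P : pieces I) (rho : region).

Definition capn : nat := 2 * n.
(** The least integer not below [2 n d]; the range searched suffices because [d <= 1]. *)
Definition qv (v : 'I_n) : nat :=
  find (fun k => (capn%:R * demand v <= k%:R :> R)%R) (iota 0 capn.+1).

Definition DerI h rho P := Der M c qv capn h rho P.

Definition st (p : seq 'I_n) : nat := if p is v :: _ then v.+1 else 0.
Definition en (p : seq 'I_n) : nat := if p is v :: p' then (last v p').+1 else 0.
(** The successor of code [j], written as a sum instead of a search so that it is additive over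
    disjoint pieces: blocks can then be combined entry by entry. *)
Fixpoint nx (p : seq 'I_n) (j : nat) : nat :=
  if p is v :: p' then (j == v.+1) * st p' + nx p' j else 0.
Definition nxt P j := \sum_(k < slots) nx (P k) j.
Definition tc (p : seq 'I_n) : R := tour_cost (map Some p).
Definition costP P : R := (\sum_(k < slots) tc (P k))%R.

Definition blk rho P (o : nat) : nat :=
  if o < 5 then nth 0 [:: 1; (rho true).1; (rho true).2; (rho false).1; (rho false).2] o
  else if o < 5 + M then load M c qv P (o - 5)
  else if o < 5 + M + slots then st (P (o - (5 + M)))
  else if o < klen then en (P (o - (5 + M + slots)))
  else nxt P (o - klen).

Lemma blk_load rho P i : i < M -> blk rho P (oload i) = load M c qv P i.
Proof. by move=> iM; rewrite /blk /oload ltn_add2l iM addKn. Qed.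

Lemma blk_st rho P k : k < slots -> blk rho P (ost M k) = st (P k).
Proof.
move=> h; rewrite /blk /ost; do 2 (case: ltnP => [hh|_]; first by exfalso; move: hh; clear; lia).
by rewrite ltn_add2l h addKn.
Qed.

Lemma blk_en rho P k : k < slots -> blk rho P (oen M c k) = en (P k).
Proof.
move=> h; rewrite /blk /oen /keylen.
do 3 (case: ltnP => [hh|_]; first by exfalso; move: hh; clear; lia).
by rewrite ltn_add2l h addKn.
Qed.

Lemma blk_nxt rho P j : blk rho P (klen + j) = nxt P j.
Proof.
rewrite /blk addKn /keylen.
by do 4 (case: ltnP => [hh|_]; first by exfalso; move: hh; clear; lia).
Qed.

Definition aW := n + klen.+1.
Definition aB := n + n + 3.
Definition aCA := n + n + n + 22.
Definition aQ := aCA + aW.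
Definition aO := aQ + n + 1.
Definition aTB := aO + n + n + (M + 2 + 20).
Definition aS := aB ^ klen.

Definition hcode (f : nat -> nat) (acc : nat) (os : seq nat) := foldl (fun a o => a * aB + f o) acc os.
Definition code rho P := hcode (blk rho P) 0 (iota 0 klen).
Definition addr idx := aTB + idx * aW.

(** The entry at [klen], the successor of code 0, is left out: moving a piece into an empty slot
    spoils it, since the end code of an empty piece is 0. *)
Definition vblk s A rho P : Prop :=
  (forall o, o < aW -> o != klen -> imem s (A + o) = blk rho P o) /\ rmem s A = costP P.

Definition flagged s idx := imem s (addr idx) != 0.

(** Soundness is kept as an invariant: the table contains only derivable families, each at the index
    of its own key and with its exact cost. *)
Record GI s : Prop := { GI_n : imem s 0 = n;
  GI_in : forall a, a < 2 + 3 * n -> rmem s a = nth 0%R (input_seq I) a;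
  GI_q : forall v : 'I_n, imem s (aQ + v) = qv v;
  GI_T : imem s vT = aS * aW;
  GI_tab : forall idx, idx < aS -> flagged s idx ->
    exists h rho P, [/\ DerI h rho P, vblk s (addr idx) rho P & code rho P = idx] }.

(** Entries never disappear and costs never rise, so what is established during a pass still holds
    at its end. *)
Definition tab s s' : Prop := forall idx, idx < aS -> flagged s idx ->
  flagged s' idx /\ (rmem s' (addr idx) <= rmem s (addr idx))%R.

Record rel k s s' : Prop := { rel_GI : GI s'; rel_tab : tab s s';
  rel_keep : forall a, k <= a < 20 -> imem s' a = imem s a }.

Definition has s rho P (x : R) : Prop :=
  flagged s (code rho P) /\ (rmem s (addr (code rho P)) <= x)%R.

Lemma rel_refl k s : GI s -> rel k s s. Proof. by split=> // idx. Qed.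

Lemma rel_trans k s1 s2 s3 : rel k s1 s2 -> rel k s2 s3 -> rel k s1 s3.
Proof.
move=> [g1 t1 k1] [g2 t2 k2]; split=> // [idx h f|a h]; last by rewrite k2 ?k1.
have [f1 l1] := t1 idx h f; have [f2 l2] := t2 idx h f1.
by split=> //; apply: le_trans l2 l1.
Qed.

Lemma rel_weak k k' s s' : k <= k' -> rel k s s' -> rel k' s s'.
Proof. by move=> kk [g t h]; split=> // a /andP[a1 a2]; rewrite h // (leq_trans kk). Qed.

Lemma addr_facts : [/\ 3 * n + 22 = aCA, aCA + aW = aQ, aQ + n + 1 = aO,
  aO + 2 * n + M + 22 = aTB & klen < aW].
Proof. by rewrite /aTB /aO /aQ /aCA /aW; split; lia. Qed.

Lemma ev_addr s : imem s 0 = n -> [/\ ieval s (eW M c) = aW, ieval s eB = aB,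
  ieval s eCA = aCA, ieval s (eQ M c) = aQ & ieval s (eO M c) = aO /\ ieval s (eTB M c) = aTB].
Proof. by move=> h; rewrite /= h. Qed.

Lemma rel_mod k s s' : GI s -> imem s' 0 = imem s 0 ->
  (forall a, aQ <= a -> imem s' a = imem s a) ->
  (forall a, (a < 2 + 3 * n) || (aTB <= a) -> rmem s' a = rmem s a) ->
  (forall a, k <= a < 20 -> imem s' a = imem s a) -> k <= vT -> rel k s s'.
Proof.
have [f1 f2 f3 f4 f5] := addr_facts.
move=> g h0 hQ hr hk kT.
have A idx : aTB <= addr idx by rewrite /addr leq_addr.
have AQ a : aTB <= a -> aQ <= a by move=> h; move: f3 f4 h; clear; lia.
have fl idx : flagged s' idx = flagged s idx by rewrite /flagged hQ // AQ.
have gg : GI s'.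
  split.
  - by rewrite h0 GI_n.
  - by move=> a ha; rewrite hr ?ha // GI_in.
  - by move=> v; rewrite hQ ?leq_addr // GI_q.
  - by rewrite hk ?GI_T // kT.
  - move=> idx hi; rewrite fl => hf; have [h [rho [P [D [v1 v2] E]]]] := GI_tab g hi hf.
    exists h, rho, P; split=> //; split; last by rewrite hr ?A ?orbT.
    move=> o ho hne; rewrite hQ ?v1 //; apply: AQ; apply: leq_trans (A idx) _; exact: leq_addr.
split=> // idx hi hf; split; first by rewrite fl.
by rewrite hr ?A ?orbT.
Qed.

Lemma hcode_rcons f acc os o : hcode f acc (rcons os o) = hcode f acc os * aB + f o.
Proof. by rewrite /hcode foldl_rcons. Qed.

Lemma hcode_inj f g os : (forall o, o \in os -> f o < aB) -> (forall o, o \in os -> g o < aB) ->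
  hcode f 0 os = hcode g 0 os -> forall o, o \in os -> f o = g o.
Proof.
elim/last_ind: os => // os o IH hf hg; rewrite !hcode_rcons => E.
have ho : o \in rcons os o by rewrite mem_rcons mem_head.
have sub x : x \in os -> x \in rcons os o by rewrite mem_rcons inE orbC => ->.
have B0 : 0 < aB by rewrite /aB addnS.
have Em : f o = g o.
  by have := congr1 (modn^~ aB) E; rewrite /= !modnMDl !modn_small ?hf ?hg.
have Ed : hcode f 0 os = hcode g 0 os.
  by have := congr1 (divn^~ aB) E; rewrite /= !divnMDl // !divn_small ?addn0 ?hf ?hg.
move=> x; rewrite mem_rcons inE => /orP[/eqP ->//|hx].
by apply: IH => // y hy; [apply: hf|apply: hg]; apply: sub.
Qed.

Lemma hcode_lt f os : (forall o, o \in os -> f o < aB) -> hcode f 0 os < aB ^ size os.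
Proof.
elim/last_ind: os => [|os o IH] hf; first by rewrite /= expn0.
rewrite hcode_rcons size_rcons expnSr.
have h1 : hcode f 0 os < aB ^ size os.
  by apply: IH => x hx; apply: hf; rewrite mem_rcons inE hx orbT.
have h2 : f o < aB by apply: hf; rewrite mem_rcons mem_head.
apply: (@leq_trans ((hcode f 0 os).+1 * aB)); last by rewrite leq_mul2r h1 orbT.
by rewrite mulSnr ltn_add2l.
Qed.

Lemma Der_bounds h rho P : DerI h rho P -> regok I rho /\ forall i, i < M -> load M c qv P i <= capn.
Proof.
have qle v : qv v <= capn.
  rewrite /qv -ltnS -[X in _ < X](size_iota 0); rewrite -has_find; apply/hasP; exists capn.
    by rewrite mem_iota /= add0n ltnSn.
  by rewrite -{2}[capn%:R]mulr1 ler_wpM2l //; case/andP: (demand_bounds v).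
elim => {h rho P}.
- move=> rho ro _ _; split=> // i _; rewrite /load big1 // => k _; exact: big_nil.
- move=> rho v k ro _ hk; split=> // i iM; rewrite /load big_mkcond (bigD1 (Ordinal hk)) //=.
  rewrite [X in _ + X]big1 ?addn0 => [|j].
    by case: ifP => _ //; rewrite /single eqxx big_seq1.
  rewrite -val_eqE /= => /negbTE ne; case: ifP => // _; rewrite /single ne; exact: big_nil.
- by [].
- move=> h d r1 r2 P1 P2 _ [ro1 l1] _ [ro2 l2] _ hd hl; split.
    by move=> e; rewrite /glue; case: ifP => // _; split; [case: (ro1 d)|case: (ro2 d)].
  move=> i iM; apply: leq_trans (hl i iM).
  rewrite /load -big_split /=; apply: leq_sum => k _; by rewrite /madd big_cat.
- move=> h rho P k1 k2 _ [ro l] h1 h2 ne es _; split=> // i iM; apply: leq_trans (l i iM).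
  rewrite /load [X in X <= _]big_mkcond [X in _ <= X]big_mkcond /=.
  rewrite (bigD1 (Ordinal h1)) // (bigD1 (Ordinal h2)) /=; last by rewrite -val_eqE /= eq_sym.
  rewrite [X in _ <= X](bigD1 (Ordinal h1)) // [X in _ <= _ + X](bigD1 (Ordinal h2)) /=; last by rewrite -val_eqE /= eq_sym.
  rewrite !addnA; apply: leq_add.
    rewrite es /mmerge eqxx [k2 == k1]eq_sym (negbTE ne) eqxx big_nil.
    by case: ifP => // _; rewrite big_cat /= addn0.
  apply: leq_sum => k /andP[]; rewrite -!val_eqE /= => /negbTE e1 /negbTE e2.
  by rewrite /mmerge e1 e2.
Qed.

Lemma blk_lt h rho P o : DerI h rho P -> o < klen -> blk rho P o < aB.
Proof.
move=> /Der_bounds[ro lo] ok; rewrite /blk ok.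
have stlt p : st p < aB by case: p => [|v p] /=; rewrite /aB; [lia|have := ltn_ord v; lia].
have enlt p : en p < aB by case: p => [|v p] /=; rewrite /aB; [lia|have := ltn_ord (last v p); lia].
case: (ltnP o 5) => h5; last first.
  case: (ltnP o (5 + M)) => hM; last by case: ifP.
  have h1 : o - 5 < M by rewrite ltn_subLR.
  by apply: leq_ltn_trans (lo _ h1) _; rewrite /capn /aB; lia.
have [a1 a2] := ro true; have [a3 a4] := ro false.
by case: o h5 {ok} => [|[|[|[|[|o]]]]] //= _; move: a1 a2 a3 a4; rewrite /aB; lia.
Qed.

Lemma code_lt h rho P : DerI h rho P -> code rho P < aS.
Proof.
move=> D; rewrite /aS -[X in aB ^ X](size_iota 0); apply: hcode_lt => o.
by rewrite mem_iota => /andP[_ ho]; apply: blk_lt D _.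
Qed.

(** Every key entry is below the base [aB], so the index determines its digits. *)
Lemma code_key h h' rho P rho' P' : DerI h rho P -> DerI h' rho' P' ->
  code rho P = code rho' P' -> forall o, o < klen -> blk rho P o = blk rho' P' o.
Proof.
move=> D D' E o ho; apply: (hcode_inj _ _ E); rewrite ?mem_iota // => x.
  by rewrite mem_iota => /andP[_ hx]; apply: blk_lt D _.
by rewrite mem_iota => /andP[_ hx]; apply: blk_lt D' _.
Qed.

Lemma eq_hcode f g acc os : (forall o, o \in os -> f o = g o) -> hcode f acc os = hcode g acc os.
Proof.
rewrite /hcode; elim: os acc => //= o os IH acc H; rewrite H ?mem_head // IH // => x hx.
by apply: H; rewrite inE hx orbT.
Qed.

Lemma eq_code rho P rho' P' : (forall o, o < klen -> blk rho P o = blk rho' P' o) ->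
  code rho P = code rho' P'.
Proof.
move=> h; apply: eq_hcode => o; rewrite mem_iota => /andP[_]; exact: h.
Qed.

Lemma addr_disj idx idx' o o' : idx != idx' -> o < aW -> o' < aW -> addr idx + o != addr idx' + o'.
Proof.
move=> ne h h'; rewrite /addr -[aTB + _ + o]addnA -[aTB + _ + o']addnA eqn_add2l.
apply/eqP => E.
have W0 : 0 < aW by apply: leq_ltn_trans h.
have : (idx * aW + o) %/ aW = (idx' * aW + o') %/ aW by rewrite E.
rewrite !divnMDl // !divn_small // !addn0 => E'.
by rewrite E' eqxx in ne.
Qed.

Definition TK := klen * (aB * 3 + 4) + 1.
Definition TI := 1 + (TK + ((aW * 3 + 3) + (1 + (aW * 3 + 2 + 1).+1))).

Lemma run_pkey os s : imem s 0 = n -> run (pkey os) (size os * (aB * 3 + 4) + 1) s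
  (fun s' => eqx 5 s s' /\ imem s' 4 = hcode (fun o => imem s (aCA + o)) (imem s 4) os).
Proof.
have [f1 f2 f3 f4 f5] := addr_facts.
elim: os s => [|o os IH] s h0; first by apply: run_skip.
rewrite [pkey _]/=; apply: (@run_weak _ _ ((aB * 3 + 3) + (1 + (size os * (aB * 3 + 4) + 1)))
  _ _ _ _ _ _ (fun s' h => h)); last by rewrite /= mulSn; lia.
apply: run_seq; apply: run_weak (run_mul (K := 5) (va := imem s 4) (vb := aB) _ _ _ _) (leqnn _) _ => //.
  move=> s' hr hs; have e0 : imem s' 0 = n by rewrite hs.
  by have [_ -> _ _ _] := ev_addr e0; rewrite /= hs.
move=> s1 [hr hs h3]; have e0 : imem s1 0 = n by rewrite hs.
apply: run_seq; apply: run_istore; rewrite [ieval _ (INat 4)]/=.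
set x := ieval _ _; have xE : x = imem s 4 * aB + imem s (aCA + o).
  have [_ _ eca _ _] := ev_addr e0; rewrite /x [ieval _ _]/= -/eCA -[imem s1 0 + _ + _ + _]/(ieval s1 eCA) eca h3 mulnC.
  by rewrite hs //; move: f1; clear; lia.
have e1 : imem (istore s1 4 x) 0 = n by [].
apply: run_weak (IH _ e1) (leqnn _) _ => s2 [[q1 q2] q3]; split.
  split=> [a|a ha]; first by rewrite q1 /= hr.
  rewrite q2 // /=; have a4 : (a == 4) = false by move: ha; clear; lia.
  by rewrite a4 hs //; move: ha; clear; lia.
rewrite q3 [imem _ 4]/= xE; apply: eq_hcode => o' _ /=.
have a4 : (aCA + o' == 4) = false by move: f1; clear; lia.
by rewrite a4 hs //; move: f1; clear; lia.
Qed.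

Lemma run_pinsert s h rho P : GI s -> vblk s aCA rho P -> DerI h rho P ->
  run (pinsert M c) TI s (fun s' => rel 6 s s' /\ has s' rho P (costP P)).
Proof.
have [f1 f2 f3 f4 f5] := addr_facts.
move=> g [v1 v2] D; set A := addr (code rho P).
have AT : aTB <= A by rewrite /A /addr leq_addr.
apply: run_seq; apply: run_istore; rewrite [ieval _ (INat 4)]/= [ieval _ (INat 0)]/=.
have e0 : imem (istore s 4 0) 0 = n by rewrite /= GI_n.
have := run_pkey (iota 0 klen) e0; rewrite size_iota => K.
apply: run_seq; apply: run_weak K (leqnn _) _ => s1 [[q1 q2] q3].
have e1 : imem s1 0 = n by rewrite q2.
have codeE : imem s1 4 = code rho P.
  rewrite q3 [imem _ 4]/=; apply: eq_hcode => o; rewrite mem_iota => /andP[_ ho] /=.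
  have -> : (aCA + o == 4) = false by move: f1; clear; lia.
  by rewrite v1 //; move: f5 ho; clear; lia.
apply: run_seq; apply: run_weak (run_mul (K := 6) (va := code rho P) (vb := aW) _ _ _ _) (leqnn _) _ => //.
  move=> s' hr hs; have e2 : imem s' 0 = n by rewrite hs.
  by have [-> _ _ _ _] := ev_addr e2; rewrite /= hs.
move=> s2 [r2 m2 d2]; have e2 : imem s2 0 = n by rewrite m2.
apply: run_seq; apply: run_istore; rewrite [ieval _ (INat 5)]/=.
have -> : ieval s2 (IAdd (eTB M c) (V 3)) = A.
  have [_ _ _ _ [_ etb]] := ev_addr e2; rewrite [ieval _ _]/= -[X in X + imem s2 3]/(ieval s2 (eTB M c)) etb d2.
  by rewrite /A /addr mulnC.
set s3 := istore s2 5 A.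
have m3 a : (a == 0) || (6 <= a) -> imem s3 a = imem s a.
  move=> ha; rewrite /= ; have -> : (a == 5) = false by move: ha; clear; lia.
  rewrite m2 ?q2 /=; last by move: ha; clear; lia.
  - by have -> : (a == 4) = false by move: ha; clear; lia.
  - by move: ha; clear; lia.
  - by move: ha; clear; lia.
have r3 a : rmem s3 a = rmem s a by rewrite /= r2 q1.
have e3 : imem s3 0 = n by rewrite m3 ?GI_n.
have rel3 : rel 6 s s3.
  apply: rel_mod => //; [exact: m3|move=> a ha; apply: m3; move: ha f1 f2; clear; lia|].
  by move=> a /andP[ha _]; apply: m3; rewrite ha orbT.
have [w3 _ c3 _ _] := ev_addr e3.
apply: run_if; rewrite (_ : beval s3 _ =
  ~~ ((0 < imem s3 (A + 0)) && (rmem s3 A <= rmem s3 aCA)%R)); last by rewrite -c3.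
rewrite addn0 !r3 v2; case: ifP; last first.
  move=> /negbT; rewrite negbK => /andP[b1 b2].
  apply: (@run_weak _ _ 1 _ _ _ _ _ _ (fun s' h => h)) => //; last by rewrite addnS.
  apply: run_skip; split=> //; split; last by rewrite r3.
  by rewrite /flagged -/A -lt0n.
rewrite negb_and => hb.
apply: run_seq.
apply: run_weak (run_fill (d := A) (m := aW) (F := fun o => imem s3 (aCA + o)) _ _) (leqnn _) _.
- by move: AT f1 f2 f3 f4; clear; lia.
- move=> o s' ho hr ho1 hs _; have e' : imem s' 0 = n.
    by rewrite hs // -?e3 //; move: AT f1 f2 f3 f4; clear; lia.
  have [-> _ ca _ _] := ev_addr e'; rewrite /= hs //; last by move: AT f1 f2 f3 f4; clear; lia.
  split=> // om; rewrite -[X in imem s' (X + _)]/(ieval s' eCA) ca ho1 hs //.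
    by move: f1; clear; lia.
  by move: om AT f2 f3 f4; clear; lia.
move=> s4 [r4 m4 d4]; apply: run_rstore.
have e4 : imem s4 0 = n by rewrite m4 // ?e3 //; move: AT f1 f2 f3 f4; clear; lia.
have [_ _ c4 _ _] := ev_addr e4.
have -> : ieval s4 (V 5) = A by rewrite /= m4 //; move: AT f1 f2 f3 f4; clear; lia.
have -> : reval s4 (RLoad eCA) = costP P.
  by rewrite -v2 [reval _ _]/= -[X in rmem s4 X]/(ieval s4 eCA) c4 r4 r3.
set s5 := rstore s4 A (costP P).
have m5 a : (a == 0) || (6 <= a) -> ~~ (A <= a < A + aW) -> imem s5 a = imem s a.
  by move=> ha hA; rewrite /= m4 ?m3 //; move: ha; clear; lia.
have d5 o : o < aW -> o != klen -> imem s5 (A + o) = blk rho P o.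
  move=> ho hne; rewrite /= d4 // m3 ?v1 //; move: f1; clear; lia.
have r5 a : rmem s5 a = if a == A then costP P else rmem s a by rewrite /= r4 r3.
have vb : vblk s5 A rho P by split=> //; rewrite r5 eqxx.
have cS := code_lt D.
have fA : flagged s5 (code rho P).
  by rewrite /flagged -/A -[A]addn0 d5 //; move: f5; clear; lia.
have oth idx o : idx != code rho P -> o < aW -> imem s5 (addr idx + o) = imem s (addr idx + o).
  move=> ne ho; apply: m5; first by rewrite /addr; move: f1 f2 f3 f4; clear; lia.
  apply/negP => /andP[h1 h2].
  have := addr_disj ne ho (_ : addr idx + o - A < aW); rewrite ltn_subLR // -/A subnKC // eqxx.
  by move=> /(_ h2).
have otr idx : idx != code rho P -> rmem s5 (addr idx) = rmem s (addr idx).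
  move=> ne; rewrite r5; case: eqP => // E.
  have W0 : 0 < aW by move: f5; clear; lia.
  by have := addr_disj ne W0 W0; rewrite !addn0 -/A E eqxx.
have W0 : 0 < aW by move: f5; clear; lia.
have fo idx : idx != code rho P -> flagged s5 idx = flagged s idx.
  by move=> ne; rewrite /flagged -[addr idx]addn0 oth.
split; last by split=> //; rewrite -/A r5 eqxx.
split.
- split.
  + by rewrite m5 ?GI_n //; move: AT f1 f2 f3 f4; clear; lia.
  + move=> a ha; rewrite r5; case: eqP => [E|_]; last exact: GI_in.
    by move: ha AT; rewrite E; move: f1 f2 f3 f4; clear; lia.
  + move=> v; rewrite m5 ?GI_q //; first by move: f1 f2; clear; lia.
    by have := ltn_ord v; move: AT f1 f2 f3 f4; clear; lia.
  + by rewrite m5 ?GI_T //; move: AT f1 f2 f3 f4; rewrite /vT; clear; lia.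
  + move=> idx hi; case: (eqVneq idx (code rho P)) => [->|ne].
      by move=> _; exists h, rho, P.
    rewrite fo // => hf; have [h' [rho' [P' [D' [w1 w2] E]]]] := GI_tab g hi hf.
    exists h', rho', P'; split=> //; split; last by rewrite otr.
    by move=> o ho hne; rewrite oth ?w1.
- move=> idx hi hf; case: (eqVneq idx (code rho P)) => [E|ne]; last by rewrite fo // otr.
  rewrite E; split=> //; rewrite -/A r5 eqxx; move: hb.
  move=> /orP[|]; last by rewrite -ltNge => /ltW.
  rewrite -leqNgt leqn0 m3; last by move: AT f1 f2 f3 f4; clear; lia.
  by move: hf; rewrite /flagged E -/A => /negbTE ->.
- move=> a /andP[h1 h2]; rewrite m5 ?h1 ?orbT //.
  by move: h2 AT f1 f2 f3 f4; clear; lia.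
Qed.

End Semantics.

(** * Joining two regions and merging two pieces *)

Section Steps.
Variables (M c : nat).
Local Open Scope nat_scope.

Definition cset (o : nat) (e : iexp) : cmd := IStore (IAdd eCA (INat o)) e.
Definition roff (d : bool) : nat := if d then 1 else 3.
(** Address of the first coordinate of the location with code [e]: terminal [v] has code [v + 1] and
    its data start at [3 v + 2], while for the depot the truncated subtraction yields 0. *)
Definition eX (e : iexp) : iexp := ISub (IAdd (IAdd e e) e) (INat 1).
Definition rdx (e1 e2 : iexp) : rexp := RSub (RLoad (eX e1)) (RLoad (eX e2)).
Definition rdy (e1 e2 : iexp) : rexp :=
  RSub (RLoad (IAdd (eX e1) (INat 1))) (RLoad (IAdd (eX e2) (INat 1))).
Definition rdist (e1 e2 : iexp) : rexp :=
  RSqrt (RAdd (RMul (rdx e1 e2) (rdx e1 e2)) (RMul (rdy e1 e2) (rdy e1 e2))).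

(** Empty slots hold zeros and no slot is used on both sides, so adding the two blocks entry by
    entry yields loads, end points and successors at once; only the flag and the thresholds are then
    rewritten. *)
Definition padd (d : bool) : cmd :=
  let p := V 11 in let q := V 10 in
  let b := roff d in let b' := roff (~~ d) in
  If (BAnd (ball [:: bieq (at_ p b') (at_ q b'); bieq (at_ p b'.+1) (at_ q b'.+1);
                     bieq (at_ p b.+1) (at_ q b)])
     (BAnd (ball [seq BNot (BAnd (bpos (at_ p (ost M k))) (bpos (at_ q (ost M k))))
                 | k <- iota 0 (nslots M c)])
           (ball [seq BILe (IAdd (at_ p (oload i)) (at_ q (oload i))) (IAdd eN eN)
                 | i <- iota 0 M])))
    (Seq (fill 1 eCA (eW M c) (IAdd (ILoad (IAdd p (V 1))) (ILoad (IAdd q (V 1)))))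
    (Seq (cset 0 (INat 1)) (Seq (cset b (at_ p b)) (Seq (cset b.+1 (at_ q b.+1))
    (Seq (cset b' (at_ p b')) (Seq (cset b'.+1 (at_ p b'.+1))
    (Seq (RStore eCA (RAdd (RLoad p) (RLoad q))) (pinsert M c))))))))
    Skip.

(** Every piece is costed as a closed tour through the depot, so joining two of them trades two legs
    to the depot for a direct one. When slot [k1] is empty its end code 0 is the depot, and the cost
    does not change. *)
Definition pmerge (k1 k2 : nat) : cmd :=
  let p := V 11 in let e1 := at_ p (oen M c k1) in let s2 := at_ p (ost M k2) in
  If (bpos s2)
    (Seq (fill 1 eCA (eW M c) (ILoad (IAdd p (V 1))))
    (Seq (IStore (IAdd eCA (IAdd (INat (keylen M c)) e1))
                 (IAdd (ILoad (IAdd eCA (IAdd (INat (keylen M c)) e1))) s2))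
    (Seq (If (bpos (at_ p (ost M k1))) Skip (cset (ost M k1) s2))
    (Seq (cset (oen M c k1) (at_ p (oen M c k2))) (Seq (cset (ost M k2) (INat 0))
    (Seq (cset (oen M c k2) (INat 0))
    (Seq (RStore eCA (RSub (RSub (RAdd (RLoad p) (rdist e1 s2)) (rdist e1 (INat 0)))
                           (rdist (INat 0) s2)))
    (pinsert M c))))))))
    Skip.

End Steps.

(** * Correctness of joining *)

Section StepsCorrect.
Variables (R : realType) (I : instance R) (M c : nat).
Local Notation n := (nterm I).
Local Notation slots := (nslots M c).
Local Notation klen := (keylen M c).
Local Notation GI := (GI I M c). Local Notation rel := (rel I M c). Local Notation has := (has M c).
Local Notation vblk := (vblk M c). Local Notation blk := (blk M c). Local Notation code := (code M c).
Local Notation DerI := (DerI M c).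
Local Notation aW := (aW I M c). Local Notation aQ := (aQ I M c). Local Notation aCA := (aCA I).
Local Notation addr := (addr I M c). Local Notation aS := (aS I M c).
Local Notation flagged := (flagged I M c).
Local Open Scope nat_scope.
Implicit Types (s : state R) (P : pieces I) (rho : region).

Lemma beval_ball s bs : beval s (ball bs) = all (beval s) bs.
Proof. by elim: bs => //= b bs ->. Qed.

Lemma beval_and s a b : beval s (BAnd a b) = beval s a && beval s b.
Proof. by []. Qed.

Lemma beval_bieq s a b : beval s (bieq a b) = (ieval s a == ieval s b).
Proof. by rewrite /= eqn_leq. Qed.

(** The test as a function of key entries alone: it has the same outcome for all families with the
    same keys. *)
Definition condF (d : bool) (f g : nat -> nat) : bool :=
  let b := roff d in let b' := roff (~~ d) in
  [&& [&& f b' == g b', f b'.+1 == g b'.+1 & f b.+1 == g b],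
   all (fun k => ~~ ((0 < f (ost M k)) && (0 < g (ost M k)))) (iota 0 slots) &
   all (fun i => f (oload i) + g (oload i) <= capn I) (iota 0 M)].

Lemma st0 (p : seq 'I_n) : (st p == 0) = (p == [::]).
Proof. by case: p. Qed.

Lemma condFP d rho1 P1 rho2 P2 : reflect [/\ adjacent d rho1 rho2,
    forall k, k < slots -> P1 k = [::] \/ P2 k = [::] &
    forall i, i < M -> load M c (@qv R I) P1 i + load M c (@qv R I) P2 i <= capn I]
  (condF d (blk rho1 P1) (blk rho2 P2)).
Proof.
have rE : [&& blk rho1 P1 (roff (~~ d)) == blk rho2 P2 (roff (~~ d)),
     blk rho1 P1 (roff (~~ d)).+1 == blk rho2 P2 (roff (~~ d)).+1 &
     blk rho1 P1 (roff d).+1 == blk rho2 P2 (roff d)] = adjacent d rho1 rho2.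
  rewrite /adjacent /blk; case: d => /=; rewrite -pair_eqE /= -andbA;
    by case: (rho1 _) => ? ?; case: (rho2 _).
rewrite /condF rE; apply: (iffP and3P) => [[h1 /allP h2 /allP h3]|[h1 h2 h3]]; split=> //.
- move=> k hk; have := h2 k; rewrite mem_iota !blk_st // !lt0n !st0 => /(_ hk).
  by case: eqP => [->|_]; [left|case: eqP => [->|_] //; right].
- by move=> i iM; have := h3 i; rewrite mem_iota !blk_load //; apply.
- apply/allP => k; rewrite mem_iota => /andP[_ hk]; rewrite !blk_st // !lt0n !st0.
  by case: (h2 k hk) => ->; rewrite ?eqxx ?andbF.
- by apply/allP => i; rewrite mem_iota => /andP[_ hi]; rewrite !blk_load // h3.
Qed.

Lemma eq_condF d f g f' g' : (forall o, o < klen -> f o = f' o) -> (forall o, o < klen -> g o = g' o) ->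
  condF d f g = condF d f' g'.
Proof.
move=> hf hg; have r5 e : roff e < klen /\ (roff e).+1 < klen by case: e; rewrite /keylen /=; lia.
have [d1 d2] := r5 d; have [d3 d4] := r5 (~~ d).
rewrite /condF !hf ?hg //; congr [&& _, _ & _]; apply: eq_in_all => k; rewrite mem_iota => /andP[_ hk].
  by rewrite hf ?hg //; rewrite /ost /keylen; move: hk; clear; lia.
by rewrite hf ?hg //; rewrite /oload /keylen; move: hk; clear; lia.
Qed.

Definition fadd (d : bool) (f g : nat -> nat) (o : nat) : nat :=
  if o == (roff (~~ d)).+1 then f o else if o == roff (~~ d) then f o else
  if o == (roff d).+1 then g o else if o == roff d then f o else
  if o == 0 then 1 else f o + g o.

Lemma blk_madd d rho1 P1 rho2 P2 o : (forall k, k < slots -> P1 k = [::] \/ P2 k = [::]) ->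
  blk (glue d rho1 rho2) (madd P1 P2) o = fadd d (blk rho1 P1) (blk rho2 P2) o.
Proof.
move=> hd; rewrite /fadd; case: (ltnP o 5) => h5.
  rewrite /blk h5 /glue; case: d; case: o h5 => [|[|[|[|[|o]]]]] //=.
have [E0 E1 E2] : [/\ (o == 0) = false, forall e, (o == roff e) = false & forall e, (o == (roff e).+1) = false].
  by split=> [|[]|[]]; move: h5; rewrite ?/roff /=; clear; lia.
rewrite E0 !E1 !E2 /blk; have -> : (o < 5) = false by rewrite ltnNge h5.
have loadE i : load M c (@qv R I) (madd P1 P2) i =
    load M c (@qv R I) P1 i + load M c (@qv R I) P2 i.
  by rewrite /load -big_split /=; apply: eq_bigr => k _; rewrite /madd big_cat.
have stE k : k < slots -> st (madd P1 P2 k) = st (P1 k) + st (P2 k) /\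
   (en (madd P1 P2 k) = en (P1 k) + en (P2 k) /\ forall j, nx (madd P1 P2 k) j = nx (P1 k) j + nx (P2 k) j).
  by move=> hk; rewrite /madd; case: (hd k hk) => ->; rewrite ?cats0; split=> [|]; rewrite ?addn0 //;
    split=> [|j]; rewrite ?addn0.
case: (ltnP o (5 + M)) => hM; first exact: loadE.
case: (ltnP o (5 + M + slots)) => hS.
  by have [|->] := stE (o - (5 + M)); [rewrite ltn_subLR|].
case: (ltnP o klen) => hK.
  by have [|_ [-> _]] := stE (o - (5 + M + slots)); [rewrite ltn_subLR|].
by rewrite /nxt -big_split /=; apply: eq_bigr => k _; have [_ [_ ->]] := stE k (ltn_ord k).
Qed.

(** The states met while a candidate is assembled: nothing but its block, its cost and the scratch
    variable 1 differs from [s0]. *)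
Record Cst s0 s (f : nat -> nat) : Prop := {
  Cst_i : forall a, (a == 0) || (2 <= a) -> ~~ (aCA <= a < aQ) -> imem s a = imem s0 a;
  Cst_r : forall a, a != aCA -> rmem s a = rmem s0 a;
  Cst_c : forall o, o < aW -> imem s (aCA + o) = f o }.

Definition updf (f : nat -> nat) (o x : nat) : nat -> nat := fun o' => if o' == o then x else f o'.

Lemma Cst_rel k s0 s f : GI s0 -> Cst s0 s f -> 2 <= k <= vT -> rel k s0 s.
Proof.
have [f1 f2 f3 f4 f5] := addr_facts I M c.
move=> g C /andP[k2 kT]; apply: rel_mod => //.
- by apply: (Cst_i C) => //; move: f1; clear; lia.
- by move=> a ha; apply: (Cst_i C); move: ha f1 f2; clear; lia.
- by move=> a ha; apply: (Cst_r C); move: ha f1 f2 f3 f4; clear; lia.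
- by move=> a /andP[h1 h2]; apply: (Cst_i C); move: h1 h2 k2 f1; clear; lia.
Qed.

Lemma run_cstore s0 s f eo e o x p T (Q : state R -> Prop) : Cst s0 s f -> o < aW ->
  ieval s eo = aCA + o -> ieval s e = x ->
  (forall s1, Cst s0 s1 (updf f o x) -> run p T s1 Q) ->
  run (Seq (IStore eo e) p) (1 + T) s Q.
Proof.
have [f1 f2 f3 f4 f5] := addr_facts I M c.
move=> C oW E1 E2 H; apply: run_seq; apply: run_istore; rewrite E1 E2; apply: H; split.
- move=> a h1 h2 /=; case: eqP => [E|_]; last exact: (Cst_i C).
  by move: h2; rewrite E leq_addr -f2 ltn_add2l oW.
- by move=> a ha /=; apply: (Cst_r C).
- by move=> o' ho' /=; rewrite eqn_add2l /updf (Cst_c C).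
Qed.

Lemma Cst_n s0 s f : GI s0 -> Cst s0 s f -> imem s 0 = n.
Proof.
have [f1 f2 f3 f4 f5] := addr_facts I M c.
by move=> g C; rewrite -(GI_n g); apply: (Cst_i C) => //; move: f1; clear; lia.
Qed.

Lemma Cst_hi s0 s f a : Cst s0 s f -> aQ <= a -> imem s a = imem s0 a.
Proof.
have [f1 f2 f3 f4 f5] := addr_facts I M c.
by move=> C ha; apply: (Cst_i C); move: ha f1 f2; clear; lia.
Qed.

Lemma Cst_lo s0 s f a : Cst s0 s f -> 2 <= a < 20 -> imem s a = imem s0 a.
Proof.
have [f1 f2 f3 f4 f5] := addr_facts I M c.
by move=> C ha; apply: (Cst_i C); move: ha f1 f2; clear; lia.
Qed.

Lemma addr_ge i : aQ <= addr i /\ aCA < addr i.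
Proof. by have [f1 f2 f3 f4 f5] := addr_facts I M c; rewrite /addr; split; lia. Qed.

Lemma run_cfill s0 ex F : GI s0 ->
  (forall o s', o < aW -> (forall a, a != 1 -> ~~ (aCA <= a < aQ) -> imem s' a = imem s0 a) ->
     rmem s' =1 rmem s0 -> imem s' 1 = o -> ieval s' ex = F o) ->
  run (fill 1 eCA (eW M c) ex) (aW * 3 + 2) s0 (fun s => Cst s0 s F).
Proof.
have [f1 f2 f3 f4 f5] := addr_facts I M c.
move=> g H; apply: run_weak (run_fill (d := aCA) (m := aW) (F := F) _ _) (leqnn _) _.
- by move: f1; clear; lia.
- move=> o s' ho hr h1 h2 _; have e0 : imem s' 0 = n.
    by rewrite -(GI_n g); apply: h2 => //; move: f1; clear; lia.
  have [e1 _ e2 _ _] := ev_addr M c e0; split=> // om; apply: H => //.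
- move=> s [h1 h2 h3]; split=> // a ha hb; apply: h2; last by rewrite f2.
  by move: ha; clear; lia.
Qed.

Lemma run_finish s0 s f e x h rho P : GI s0 -> Cst s0 s f -> reval s e = x ->
  (forall o, o < aW -> o != klen -> f o = blk rho P o) -> x = costP M c P -> DerI h rho P ->
  run (Seq (RStore eCA e) (pinsert M c)) (1 + TI I M c) s (fun s' => rel 6 s0 s' /\ has s' rho P (costP M c P)).
Proof.
have [f1 f2 f3 f4 f5] := addr_facts I M c.
move=> g C Ex Ef Ec D; apply: run_seq; apply: run_rstore; rewrite Ex.
have [_ _ -> _ _] := ev_addr M c (Cst_n g C).
set s1 := rstore _ _ _; have C1 : Cst s0 s1 f.
  split=> [a|a ha|o] /=; [exact: (Cst_i C)|by rewrite (negbTE ha); apply: (Cst_r C)|exact: (Cst_c C)].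
have g1 : rel 6 s0 s1 by apply: Cst_rel g C1 _.
apply: run_weak (run_pinsert (rel_GI g1) _ D) (leqnn _) _.
  by split=> [j hj hne|]; [rewrite (Cst_c C1) // Ef|rewrite /= eqxx].
by move=> s' [h1 h2]; split=> //; apply: rel_trans g1 h1.
Qed.

Definition TA := ((aW * 3 + 2) + (1 + (1 + (1 + (1 + (1 + (1 + TI I M c))))))).+1.

(** The table holds some families [Q1] and [Q2], not necessarily the given [P1] and [P2]. Having the
    same keys, they pass the same test, and their union has the same key as that of [P1] and
    [P2]. *)
Lemma run_padd d s ip iq : GI s -> ip < aS -> iq < aS -> flagged s ip -> flagged s iq ->
  imem s 11 = addr ip -> imem s 10 = addr iq ->
  run (padd M c d) TA s (fun s' => rel 6 s s' /\
    forall h1 rho1 P1 h2 rho2 P2, DerI h1 rho1 P1 -> DerI h2 rho2 P2 ->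
      code rho1 P1 = ip -> code rho2 P2 = iq -> adjacent d rho1 rho2 ->
      (forall k, k < slots -> P1 k = [::] \/ P2 k = [::]) ->
      (forall i, i < M -> load M c (@qv R I) P1 i + load M c (@qv R I) P2 i <= capn I) ->
      has s' (glue d rho1 rho2) (madd P1 P2) (rmem s (addr ip) + rmem s (addr iq))%R).
Proof.
have [f1 f2 f3 f4 f5] := addr_facts I M c.
move=> g hip hiq fp fq vp vq.
have [h1 [r1 [Q1 [D1 [w1 x1] E1]]]] := GI_tab g hip fp.
have [h2 [r2 [Q2 [D2 [w2 x2] E2]]]] := GI_tab g hiq fq.
have kW o : o < klen -> o < aW /\ o != klen by move=> h; move: h f5; clear; lia.
pose f o := imem s (addr ip + o); pose g' o := imem s (addr iq + o).
have fE o : o < klen -> f o = blk r1 Q1 o by move=> /kW[a1 a2]; apply: w1.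
have gE o : o < klen -> g' o = blk r2 Q2 o by move=> /kW[a1 a2]; apply: w2.
apply: run_if; rewrite (_ : beval s _ = condF d f g'); last first.
  rewrite /condF beval_and [X in _ && X]beval_and !beval_ball !all_map; congr (_ && (_ && _)).
  - by rewrite /= vp vq !eqn_leq !andbT.
  - by apply: eq_all => k /=; rewrite vp vq.
  - by apply: eq_all => i /=; rewrite vp vq (GI_n g) /capn mul2n addnn.
rewrite (eq_condF d fE gE); case: condFP => [[A1 A2 A3]|N]; last first.
  apply: run_weak (run_skip (Q := eq s) (erefl s)) _ _; first by rewrite /TA; clear; lia.
  move=> s' <-; split; first exact: rel_refl.
  move=> k1 rho1 P1 k2 rho2 P2 D1' D2' C1 C2 B1 B2 B3; case: N.
  have K1 := code_key D1 D1' (etrans E1 (esym C1)); have K2 := code_key D2 D2' (etrans E2 (esym C2)).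
  by apply/condFP; rewrite (eq_condF d K1 K2); apply/condFP.
have D : DerI (maxn h1 h2).+1 (glue d r1 r2) (madd Q1 Q2).
  by apply: DerA => //; [exact: Der_le (leq_maxl _ _) D1|exact: Der_le (leq_maxr _ _) D2].
have cE : costP M c (madd Q1 Q2) = (costP M c Q1 + costP M c Q2)%R.
  rewrite /costP -big_split /=; apply: eq_bigr => k _; rewrite /madd.
  have tc0 : tc (I := I) [::] = 0%R by rewrite /tc /tour_cost /= big_seq1 edistpp.
  by case: (A2 k (ltn_ord k)) => ->; rewrite ?cats0 tc0 ?addr0 ?add0r.
have ap := addr_ge ip; have aq := addr_ge iq.
apply: run_seq; apply: run_weak (run_cfill (F := fun o => f o + g' o) g _) (leqnn _) _.
  move=> o s' oW hs hr h1'; case: (ap) => ap1 ap2; case: (aq) => aq1 aq2.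
  have p11 : imem s' 11 = addr ip by rewrite hs //; move: f1; clear; lia.
  have p10 : imem s' 10 = addr iq by rewrite hs //; move: f1; clear; lia.
  rewrite /= h1' p11 p10 !hs //; move: ap1 ap2 aq1 aq2 f1; clear; lia.
move=> s1 C0.
have r5 e : roff e < aW /\ (roff e).+1 < aW by case: e; move: f5; rewrite /keylen /=; clear; lia.
have [d1 d2] := r5 d; have [d3 d4] := r5 (~~ d).
have eco s' f' o : Cst s s' f' -> ieval s' (IAdd eCA (INat o)) = aCA + o.
  by move=> C; have [_ _ <- _ _] := ev_addr M c (Cst_n g C).
have ep s' f' o : Cst s s' f' -> ieval s' (at_ (V 11) o) = f o.
  move=> C; have p11 : imem s' 11 = addr ip by rewrite (Cst_lo C).
  by rewrite /= p11 (Cst_hi C) //; apply: leq_trans (leq_addr _ _); exact: ap.1.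
have eq_ s' f' o : Cst s s' f' -> ieval s' (at_ (V 10) o) = g' o.
  move=> C; have p10 : imem s' 10 = addr iq by rewrite (Cst_lo C).
  by rewrite /= p10 (Cst_hi C) //; apply: leq_trans (leq_addr _ _); exact: aq.1.
apply: (run_cstore C0 _ (eco _ _ _ C0) (erefl _)); first by move: f5; clear; lia.
move=> s2 C1; apply: (run_cstore C1 d1 (eco _ _ _ C1) (ep _ _ _ C1)).
move=> s3 C2; apply: (run_cstore C2 d2 (eco _ _ _ C2) (eq_ _ _ _ C2)).
move=> s4 C3; apply: (run_cstore C3 d3 (eco _ _ _ C3) (ep _ _ _ C3)).
move=> s5 C4; apply: (run_cstore C4 d4 (eco _ _ _ C4) (ep _ _ _ C4)).
move=> s6 C5; apply: run_weak (run_finish (x := costP M c (madd Q1 Q2)) g C5 _ _ (erefl _) D) (leqnn _) _.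
- rewrite cE -x1 -x2 /= !(Cst_lo C5) // vp vq; congr (_ + _)%R; apply: (Cst_r C5);
  [move: ap.2|move: aq.2]; clear; lia.
- move=> o oW ok; rewrite blk_madd // /fadd /updf -w1 // -w2 //.
  by do 4 (case: eqP => [->|_] //).
- move=> s' [R1 R2]; split=> // k1 rho1 P1 k2 rho2 P2 D1' D2' C1' C2' B1 B2 B3.
  have K1 := code_key D1 D1' (etrans E1 (esym C1')); have K2 := code_key D2 D2' (etrans E2 (esym C2')).
  have Ek : code (glue d r1 r2) (madd Q1 Q2) = code (glue d rho1 rho2) (madd P1 P2).
    apply: eq_code => o ok; rewrite !blk_madd // /fadd K1 // K2 //.
  by rewrite /has -Ek x1 x2 -cE.
Qed.

Definition cdist (a b : nat) : R := edist (codeloc I a) (codeloc I b).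

(** With code 0 standing for the depot, one formula covers empty pieces as well. *)
Lemma tc_cat (p1 p2 : seq 'I_n) : tc (I := I) (p1 ++ p2) =
  (tc p1 + tc p2 + (cdist (en p1) (st p2) - cdist (en p1) 0 - cdist 0 (st p2)))%R.
Proof.
have tcE p : tc (I := I) p = plen (depot I) (rcons (map (fun v => pos v) p) (depot I)).
  by rewrite /tc /tour_cost -plenE -map_comp; congr (plen _ (rcons _ _)); apply: eq_map.
have cl (v : 'I_n) : codeloc I v.+1 = pos v by rewrite /codeloc valK.
have c0 : codeloc I 0 = depot I by [].
rewrite !tcE map_cat; case: p1 => [|v p1]; first by rewrite /cdist /= edistpp addr0; ring.
case: p2 => [|u p2]; first by rewrite cats0 /cdist /= !edistpp addr0; ring.
rewrite /cdist [en _]/= [st _]/= !cl c0 /= rcons_cat plen_cat (plen_rcons (pos v)) /= last_map.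
by ring.
Qed.

End StepsCorrect.

(** * Program for regions with at most one terminal *)

Section MergeLeaf.
Variables (M c : nat).
Local Open Scope nat_scope.
Definition eco (d : bool) (e : iexp) : rexp :=
  if d then RLoad (eX e) else RLoad (IAdd (eX e) (INat 1)).
Definition ltcb (d : bool) (ev ej : iexp) : bexp :=
  BAnd (bpos ej) (BNot (BAnd (BNot (BILe (IAdd eN (INat 1)) ej)) (BRLe (eco d ej) (eco d ev)))).
Definition inregb : bexp :=
  let ev := IAdd (V 6) (INat 1) in
  BAnd (BNot (ltcb true ev (V 13))) (BAnd (ltcb true ev (V 12))
  (BAnd (BNot (ltcb false ev (V 11))) (ltcb false ev (V 10)))).
Definition violb : bexp :=
  let ev := IAdd (V 6) (INat 1) in
  BNot (BAnd (BNot (BAnd (ltcb true ev (V 13)) (BNot (ltcb true ev (V 12)))))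
             (BNot (BAnd (ltcb false ev (V 11)) (BNot (ltcb false ev (V 10)))))).
Definition pbase (p : cmd) : cmd :=
  Seq (fill 1 eCA (eW M c) (INat 0)) (Seq (cset 0 (INat 1)) (Seq (cset 1 (V 13))
  (Seq (cset 2 (V 12)) (Seq (cset 3 (V 11)) (Seq (cset 4 (V 10)) p))))).
Definition pleaf0 : cmd := pbase (Seq (RStore eCA (RNat 0)) (pinsert M c)).
Definition pleaf1 (k : nat) : cmd :=
  let u := IAdd (V 8) (INat 1) in
  pbase (Seq (cset (oload (k %/ c.*2)) (ILoad (IAdd (eQ M c) (V 8)))) (Seq (cset (ost M k) u)
   (Seq (cset (oen M c k) u)
   (Seq (RStore eCA (RAdd (rdist (INat 0) u) (rdist u (INat 0)))) (pinsert M c))))).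
(* A terminal violating [ordered] counts twice, which rules out both leaves. *)
Definition pleaf : cmd :=
  Seq (set 7 (INat 0)) (Seq (loop 6 (INat 0) eN (INat 1)
    (If inregb (Seq (set 7 (IAdd (V 7) (INat 1))) (set 8 (V 6)))
       (If violb (set 7 (IAdd (V 7) (INat 2))) Skip)))
  (Seq (If (BILe (V 7) (INat 0)) pleaf0 Skip)
    (If (bieq (V 7) (INat 1)) (seqs [seq pleaf1 k | k <- iota 0 (nslots M c)]) Skip))).
End MergeLeaf.

(** * Correctness of merging *)

Section MergeLeafCorrect.
Variables (R : realType) (I : instance R) (M c : nat).
Local Notation n := (nterm I).
Local Notation slots := (nslots M c).
Local Notation klen := (keylen M c).
Local Notation GI := (GI I M c). Local Notation rel := (rel I M c). Local Notation has := (has M c).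
Local Notation vblk := (vblk M c). Local Notation blk := (blk M c). Local Notation code := (code M c).
Local Notation DerI := (DerI M c).
Local Notation aW := (aW I M c). Local Notation aQ := (aQ I M c). Local Notation aCA := (aCA I).
Local Notation addr := (addr I M c). Local Notation aS := (aS I M c).
Local Notation flagged := (flagged I M c).
Local Notation Cst := (Cst I M c).
Local Open Scope nat_scope.
Implicit Types (s : state R) (P : pieces I) (rho : region).

Lemma code_addr s x : (forall a, a < 2 + 3 * n -> rmem s a = nth 0%R (input_seq I) a) -> x <= n ->
  rmem s (3 * x - 1) = (codeloc I x).1 /\ rmem s (3 * x - 1 + 1) = (codeloc I x).2.
Proof.
move=> gi xn; have nE : size (enum 'I_n) = n by rewrite size_enum_ord.
case: x xn => [|x] xn; first by rewrite muln0 !gi.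
have -> : 3 * x.+1 - 1 = 2 + 3 * x by clear; lia.
rewrite !gi; [|by move: xn; clear; lia|by move: xn; clear; lia].
have fl (l : seq 'I_n) j (d0 : 'I_n) : j < size l -> forall t, t < 3 ->
  nth 0%R (flatten [seq [:: (pos v).1; (pos v).2; demand v] | v <- l]) (3 * j + t) =
  nth 0%R [:: (pos (nth d0 l j)).1; (pos (nth d0 l j)).2; demand (nth d0 l j)] t.
  elim: l j => // v l IH [|j] hj t ht.
    by rewrite muln0 add0n; case: t ht => [|[|[|t]]].
  by rewrite mulnS -addnA; exact: IH.
pose v := Ordinal xn; have vE : nth v (enum 'I_n) x = v by apply/val_inj; rewrite /= nth_enum_ord.
have -> : codeloc I x.+1 = pos v by rewrite /codeloc (insubT (fun j => j < n) xn).
have h0 := fl (enum 'I_n) x v; rewrite nE vE in h0.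
have i0 t : nth 0%R (input_seq I) (2 + (3 * x + t)) =
  nth 0%R (flatten [seq [:: (pos v).1; (pos v).2; demand v] | v <- enum 'I_n]) (3 * x + t) by [].
split; first by rewrite -{1}[3 * x]addn0 i0 (h0 xn 0 isT).
by rewrite -addnA i0 (h0 xn 1 isT).
Qed.

Lemma ev_dist s e1 e2 x1 x2 :
  (forall a, a < 2 + 3 * n -> rmem s a = nth 0%R (input_seq I) a) ->
  ieval s e1 = x1 -> ieval s e2 = x2 -> x1 <= n -> x2 <= n ->
  reval s (rdist e1 e2) = cdist I x1 x2.
Proof.
move=> gi E1 E2 h1 h2; have [a1 b1] := code_addr gi h1; have [a2 b2] := code_addr gi h2.
have X3 x : x + x + x - 1 = 3 * x - 1 by clear; lia.
by rewrite /= E1 E2 !X3 a1 a2 b1 b2 -!expr2.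
Qed.

(** Isolates the two slots affected by a merge; stated for any commutative operation because costs,
    loads, successors and numbers of occurrences all need it. *)
Lemma big_merge (T : Type) (idx : T) (op : Monoid.com_law idx) (C : pred nat) (F : seq 'I_n -> T)
    P k1 k2 : k1 < slots -> k2 < slots -> k1 != k2 ->
  exists rest, \big[op/idx]_(k < slots | C k) F (mmerge k1 k2 P k) =
     op (if C k1 then F (P k1 ++ P k2) else idx) (op (if C k2 then F [::] else idx) rest) /\
   \big[op/idx]_(k < slots | C k) F (P k) =
     op (if C k1 then F (P k1) else idx) (op (if C k2 then F (P k2) else idx) rest).
Proof.
move=> h1 h2 ne; exists (\big[op/idx]_(k < slots | ((k : nat) != k1) && ((k : nat) != k2)) (if C k then F (P k) else idx)).
have G (Q : nat -> seq 'I_n) : \big[op/idx]_(k < slots | C k) F (Q k) =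
   op (if C k1 then F (Q k1) else idx) (op (if C k2 then F (Q k2) else idx)
   (\big[op/idx]_(k < slots | ((k : nat) != k1) && ((k : nat) != k2)) (if C k then F (Q k) else idx))).
  rewrite big_mkcond (bigD1 (Ordinal h1)) // (bigD1 (Ordinal h2)) /=; last by rewrite -val_eqE /= eq_sym.
  by congr (op _ (op _ _)); apply: eq_bigl => k; rewrite -!val_eqE.
rewrite !G /mmerge eqxx [k2 == k1]eq_sym (negbTE ne) eqxx; split=> //.
by congr (op _ (op _ _)); apply: eq_bigr => k /andP[/negbTE -> /negbTE ->].
Qed.

Lemma costP_merge P k1 k2 : k1 < slots -> k2 < slots -> k1 != k2 ->
  costP M c (mmerge k1 k2 P) = (costP M c P + cdist I (en (P k1)) (st (P k2))
     - cdist I (en (P k1)) 0 - cdist I 0 (st (P k2)))%R.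
Proof.
move=> h1 h2 ne; have [rest [E1 E2]] := big_merge +%R predT (@tc R I) P h1 h2 ne.
have tc0 : tc (I := I) [::] = 0%R by rewrite /tc /tour_cost /= big_seq1 edistpp.
rewrite /costP E1 E2 /= tc_cat tc0; ring.
Qed.

Lemma load_merge P k1 k2 i : k1 < slots -> k2 < slots -> k1 != k2 -> stour c k1 = stour c k2 ->
  load M c (@qv R I) (mmerge k1 k2 P) i = load M c (@qv R I) P i.
Proof.
move=> h1 h2 ne es.
have [rest [E1 E2]] := big_merge addn (fun k => stour c k == i) (fun p => \sum_(v <- p) @qv R I v) P h1 h2 ne.
rewrite /load E1 E2 es; case: ifP => _ //=; rewrite big_cat big_nil add0n addnA //.
Qed.

(** Code 0 is excluded because it is the end code of an empty [p1]. *)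
Lemma nx_cat (p1 p2 : seq 'I_n) j : 0 < j ->
  nx (p1 ++ p2) j = nx p1 j + nx p2 j + (j == en p1) * st p2.
Proof.
move=> j0; elim: p1 => [|v p1 IH] /=; first by rewrite (gtn_eqF j0) mul0n addn0.
case: p1 IH => [|u p1] IH; first by rewrite /= muln0 !add0n addnC.
by rewrite [nx ((u :: p1) ++ p2) j]IH /= !addnA.
Qed.

Lemma nxt_merge P k1 k2 j : k1 < slots -> k2 < slots -> k1 != k2 -> 0 < j ->
  nxt M c (mmerge k1 k2 P) j = nxt M c P j + (j == en (P k1)) * st (P k2).
Proof.
move=> h1 h2 ne j0; have [rest [E1 E2]] := big_merge addn predT (fun p => nx p j) P h1 h2 ne.
rewrite /nxt E1 E2 /= nx_cat //; lia.
Qed.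

Definition fmerge (k1 k2 : nat) (f : nat -> nat) (o : nat) : nat :=
  if o == oen M c k2 then 0 else if o == ost M k2 then 0 else
  if o == oen M c k1 then f (oen M c k2) else
  if o == ost M k1 then (if 0 < f (ost M k1) then f (ost M k1) else f (ost M k2)) else
  if o == klen + f (oen M c k1) then f o + f (ost M k2) else f o.

Lemma blk_merge rho P k1 k2 o : k1 < slots -> k2 < slots -> k1 != k2 ->
  stour c k1 = stour c k2 -> P k2 != [::] -> o != klen ->
  blk rho (mmerge k1 k2 P) o = fmerge k1 k2 (blk rho P) o.
Proof.
move=> h1 h2 ne es p2 ok; rewrite /fmerge !blk_en // !blk_st //.
have K k : k < slots -> klen <= o -> (o == oen M c k) = false /\ (o == ost M k) = false.
  by rewrite /oen /ost /keylen => hk ho; split; move: hk ho; clear; lia.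
case: (leqP klen o) => ho.
  have [-> ->] := K k1 h1 ho; have [-> ->] := K k2 h2 ho.
  rewrite -(subnKC ho) eqn_add2l !blk_nxt nxt_merge //; last first.
    by rewrite subn_gt0 ltn_neqAle eq_sym ok.
  by case: eqP => _; rewrite ?mul1n ?mul0n ?addn0.
have Kn : (o == klen + en (P k1)) = false by move: ho; clear; lia.
rewrite Kn; case: (ltnP o (5 + M)) => h5.
  have [e1 e2 e3 e4] : [/\ (o == oen M c k2) = false, (o == ost M k2) = false,
     (o == oen M c k1) = false & (o == ost M k1) = false].
    by rewrite /oen /ost; split; move: h5; clear; lia.
  rewrite e1 e2 e3 e4 /blk h5; case: ifP => // _; exact: load_merge.
case: (ltnP o (5 + M + slots)) => hs.
  have [k hk oE] : exists2 k, k < slots & o = ost M k.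
    by exists (o - (5 + M)); rewrite /ost ?subnKC // ltn_subLR.
  have nen k' : (o == oen M c k') = false by rewrite /oen; move: hs; clear; lia.
  rewrite !nen oE /ost !eqn_add2l -/(ost M k) !blk_st // /mmerge.
  case: (eqVneq k k2) => [->|n2]; first by rewrite eq_sym (negbTE ne).
  case: (eqVneq k k1) => [_|n1] //.
  by case: (P k1).
have [k hk oE] : exists2 k, k < slots & o = oen M c k.
  exists (o - (5 + M + slots)); rewrite /oen ?subnKC // ltn_subLR //.
have nst k' : k' < slots -> (o == ost M k') = false by rewrite /ost; move: hs; clear; lia.
rewrite !nst // oE /oen !eqn_add2l -/(oen M c k) !blk_en // /mmerge.
case: (eqVneq k k2) => [->|n2]; first by rewrite eq_sym (negbTE ne).
case: (eqVneq k k1) => [_|n1] //.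
case: (P k1) => [//|v p1] /=; case: (P k2) p2 => // u p _.
by rewrite last_cat /=.
Qed.

Definition TM := ((aW * 3 + 2) + (1 + (2 + (1 + (1 + (1 + (1 + TI I M c))))))).+1.

(** As for joining, the stored family may differ from [P]: the emptiness of slot [k2], the new key
    and the change of cost can all be read off the key. *)
Lemma run_pmerge k1 k2 s ip : GI s -> ip < aS -> flagged s ip -> imem s 11 = addr ip ->
  k1 < slots -> k2 < slots -> k1 != k2 -> stour c k1 = stour c k2 ->
  run (pmerge M c k1 k2) TM s (fun s' => rel 6 s s' /\
    forall h rho P, DerI h rho P -> code rho P = ip -> P k2 != [::] ->
      has s' rho (mmerge k1 k2 P) (rmem s (addr ip) + cdist I (en (P k1)) (st (P k2))
        - cdist I (en (P k1)) 0 - cdist I 0 (st (P k2)))%R).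
Proof.
have [f1 f2 f3 f4 f5] := addr_facts I M c.
move=> g hip fp vp h1 h2 ne es.
have [h [r [Q [D [w x] E]]]] := GI_tab g hip fp.
have kW o : o < klen -> o < aW /\ o != klen by move=> hh; move: hh f5; clear; lia.
have [ap1 ap2] := addr_ge I M c ip.
have lt k : k < slots -> ost M k < klen /\ oen M c k < klen.
  by rewrite /ost /oen /keylen => hk; split; move: hk; clear; lia.
have [s1k e1k] := lt k1 h1; have [s2k e2k] := lt k2 h2.
pose F o := imem s (addr ip + o).
have FE o : o < klen -> F o = blk r Q o by move=> /kW[a1 a2]; apply: w.
have enle (p : seq 'I_n) : en p <= n by case: p => [|v p] //; exact: (ltn_ord (last v p)).
have stle (p : seq 'I_n) : st p <= n by case: p => [|v p] //; exact: (ltn_ord v).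
apply: run_if; rewrite (_ : beval s _ = (0 < F (ost M k2))); last by rewrite /= vp.
rewrite FE // blk_st //; case: ifP => hst; last first.
  apply: run_weak (run_skip (Q := eq s) (erefl s)) _ _; first by clear; lia.
  move=> s' <-; split; first exact: rel_refl.
  move=> h' rho P D' C' p2; have K := code_key D D' (etrans E (esym C')) s2k.
  by move: hst; rewrite -(blk_st r Q h2) K blk_st // lt0n st0 p2.
have p2 : Q k2 != [::] by rewrite -st0 -lt0n.
have D2 : DerI h.+1 r (mmerge k1 k2 Q) by apply: DerM.
apply: run_seq; apply: run_weak (run_cfill (F := F) g _) (leqnn _) _.
  move=> o s' oW hs hr h1'.
  have p11 : imem s' 11 = addr ip by rewrite hs //; move: f1; clear; lia.
  rewrite /= h1' p11 !hs //; move: ap1 ap2 f1; clear; lia.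
move=> t0 C0.
have ecoE s' f' o e' : Cst s s' f' -> ieval s' e' = o -> ieval s' (IAdd eCA e') = aCA + o.
  move=> C' Ee; have [_ _ ca _ _] := ev_addr M c (Cst_n g C').
  by rewrite -ca -Ee.
have ep s' f' o : Cst s s' f' -> ieval s' (at_ (V 11) o) = F o.
  move=> C'; have p11 : imem s' 11 = addr ip by rewrite (Cst_lo C').
  by rewrite /= p11 (Cst_hi C') //; apply: leq_trans (leq_addr _ _); exact: ap1.
have e1E s' f' : Cst s s' f' -> ieval s' (IAdd (INat klen) (at_ (V 11) (oen M c k1))) = klen + en (Q k1).
  by move=> C'; rewrite -(blk_en r Q h1) -FE // -(ep _ _ _ C').
have kn : klen + en (Q k1) < aW by have := enle (Q k1); rewrite /aW; clear; lia.
apply: (run_cstore (x := F (klen + en (Q k1)) + F (ost M k2)) C0 kn (ecoE _ _ _ _ C0 (e1E _ _ C0))).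
  rewrite -(ep _ _ (ost M k2) C0) -(Cst_c C0 kn) -(ecoE _ _ _ _ C0 (e1E _ _ C0)) //.
move=> t1 C1; set G1 := updf _ _ _ in C1.
pose G2 := updf G1 (ost M k1) (if 0 < F (ost M k1) then F (ost M k1) else F (ost M k2)).
apply: run_seq; apply: (@run_weak _ _ 2 2 _ (fun s' => Cst s s' G2)) => //.
  apply: run_if; rewrite (_ : beval t1 _ = (0 < F (ost M k1))); last by rewrite -(ep _ _ _ C1).
  case: ifP => hp.
    apply: run_skip; split=> [a ha hb|a ha|o ho]; [exact: (Cst_i C1)|exact: (Cst_r C1)|].
    rewrite (Cst_c C1) // /G2 /updf hp; case: eqP => // ->.
    by rewrite /G1 /updf ifF //; move: s1k; clear; lia.
  apply: run_istore; have s1W := (kW _ s1k).1.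
  rewrite (ecoE _ _ _ (INat (ost M k1)) C1 (erefl _)) (ep _ _ _ C1); split.
  - move=> a ha hb /=; case: eqP => [Ea|_]; last exact: (Cst_i C1).
    by move: hb; rewrite Ea leq_addr -f2 ltn_add2l s1W.
  - by move=> a ha; apply: (Cst_r C1).
  - by move=> o ho /=; rewrite eqn_add2l /G2 /updf hp (Cst_c C1).
move=> t2 C2.
apply: (run_cstore C2 (kW _ e1k).1 (ecoE _ _ _ (INat (oen M c k1)) C2 (erefl _)) (ep _ _ _ C2)) => t3 C3.
apply: (run_cstore C3 (kW _ s2k).1 (ecoE _ _ _ (INat (ost M k2)) C3 (erefl _)) (erefl _)) => t4 C4.
apply: (run_cstore C4 (kW _ e2k).1 (ecoE _ _ _ (INat (oen M c k2)) C4 (erefl _)) (erefl _)) => t5 C5.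
apply: run_weak (run_finish (x := costP M c (mmerge k1 k2 Q)) g C5 _ _ (erefl _) D2) (leqnn _) _.
- have gi a : a < 2 + 3 * n -> rmem t5 a = nth 0%R (input_seq I) a.
    by move=> ha; rewrite (Cst_r C5) ?(GI_in g) //; move: ha f1; clear; lia.
  have vE : ieval t5 (at_ (V 11) (oen M c k1)) = en (Q k1) by rewrite (ep _ _ _ C5) FE // blk_en.
  have uE : ieval t5 (at_ (V 11) (ost M k2)) = st (Q k2) by rewrite (ep _ _ _ C5) FE // blk_st.
  have rE : reval t5 (RLoad (V 11)) = rmem s (addr ip).
    have p11 : imem t5 11 = addr ip by rewrite (Cst_lo C5).
    by rewrite /= p11 (Cst_r C5) //; move: ap2; clear; lia.
  rewrite costP_merge // -x -rE -(ev_dist gi vE uE) // -(ev_dist gi vE (erefl (ieval t5 (INat 0)))) //.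
  by rewrite -(ev_dist gi (erefl (ieval t5 (INat 0))) uE).
- move=> o oW ok; rewrite blk_merge // /fmerge -(FE _ e2k) -(FE _ s2k) -(FE _ s1k) blk_en // -(w o oW ok).
  rewrite /G2 /G1 /updf; do 4 (case: eqP => [_|_]; first by []).
  by case: eqP => [->|_].
- move=> s' [R1 R2]; split=> // h' rho P D' C' pp2.
  have K := code_key D D' (etrans E (esym C')).
  have Ek : code r (mmerge k1 k2 Q) = code rho (mmerge k1 k2 P).
    apply: eq_code => o ok; have ok' := (kW o ok).2.
    by rewrite !blk_merge // /fmerge !K // ; case: ifP => // _; rewrite K.
  have e1 : en (P k1) = en (Q k1) by rewrite -(blk_en rho P h1) -K // blk_en.
  have e2 : st (P k2) = st (Q k2) by rewrite -(blk_st rho P h2) -K // blk_st.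
  by rewrite /has -Ek e1 e2 x -costP_merge.
Qed.

End MergeLeafCorrect.

(** * Correctness of the leaf step *)

Section Leaf.
Variables (R : realType) (I : instance R) (M c : nat).
Local Notation n := (nterm I).
Local Notation slots := (nslots M c).
Local Notation klen := (keylen M c).
Local Notation GI := (GI I M c). Local Notation rel := (rel I M c). Local Notation has := (has M c).
Local Notation vblk := (vblk M c). Local Notation blk := (blk M c). Local Notation code := (code M c).
Local Notation DerI := (DerI M c).
Local Notation aW := (aW I M c). Local Notation aQ := (aQ I M c). Local Notation aCA := (aCA I).
Local Notation addr := (addr I M c). Local Notation aS := (aS I M c).
Local Notation flagged := (flagged I M c).
Local Notation Cst := (Cst I M c).
Local Notation nopiece := (@nopiece R I).
Local Open Scope nat_scope.
Implicit Types (s : state R) (P : pieces I) (rho : region).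

Lemma has_rel k s s' h rho P x y : DerI h rho P -> rel k s s' -> (x <= y)%R -> has s rho P x -> has s' rho P y.
Proof.
move=> D r xy [f l]; have [f' l'] := rel_tab r (code_lt D) f.
by split=> //; apply: le_trans l' (le_trans l xy).
Qed.

Lemma rel_set k s v x : GI s -> 0 < v < k -> k <= vT -> rel k s (istore s v x).
Proof.
have [f1 f2 f3 f4 f5] := addr_facts I M c.
move=> g /andP[v0 vk] kT; have vK : v < 20 by apply: leq_trans vk (leq_trans kT _).
apply: rel_mod => //= [|a ha|a ha].
- by rewrite eq_sym gtn_eqF.
- by case: eqP => // E; move: ha vK f1 f2; rewrite E; clear; lia.
- by case: eqP => // E; move: ha vk; rewrite E; clear; lia.
Qed.

Lemma run_seqs (T : eqType) (xs : seq T) (p : T -> cmd) t k (F : T -> state R -> Prop) s0 s :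
  rel k s0 s ->
  (forall x s', x \in xs -> rel k s0 s' -> run (p x) t s' (fun s'' => rel k s' s'' /\ F x s'')) ->
  (forall x s1 s2, x \in xs -> rel k s1 s2 -> F x s1 -> F x s2) ->
  run (seqs (map p xs)) (size xs * t + 1) s (fun s' => rel k s s' /\ forall x, x \in xs -> F x s').
Proof.
elim: xs s => [|x xs IH] s r H Hm.
  by apply: run_skip; split; [exact: rel_refl (rel_GI r)|].
rewrite [seqs _]/= [size _]/= mulSn -addnA; apply: run_seq.
apply: run_weak (H x s (mem_head _ _) r) (leqnn _) _ => s1 [r1 F1].
have sub y : y \in xs -> y \in x :: xs by rewrite inE orbC => ->.
apply: run_weak (IH s1 (rel_trans r r1) _ _) (leqnn _) _.
- by move=> y s' hy; apply: H; apply: sub.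
- by move=> y s2 s3 hy; apply: Hm; apply: sub.
- move=> s2 [r2 F2]; split; first exact: rel_trans r1 r2.
  move=> y; rewrite inE => /orP[/eqP ->|hy]; last exact: F2.
  by apply: Hm r2 F1; rewrite mem_head.
Qed.

(** Loop rule for facts that persist under [rel]: each iteration establishes its own [F i], and all
    of them hold at the end. *)
Lemma run_rloop v k a0 m w T ea ee ew body (F : nat -> state R -> Prop) s : GI s -> 0 < w ->
  0 < v < k -> k <= vT -> ieval s ea = a0 ->
  (forall s', rel k s s' -> ieval s' ee = a0 + m * w /\ ieval s' ew = w) ->
  (forall i s', i < m -> rel k s s' -> imem s' v = a0 + i * w ->
     run body T s' (fun s'' => rel v s' s'' /\ F i s'')) ->
  (forall i s1 s2, rel k s s1 -> rel k s1 s2 -> F i s1 -> F i s2) ->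
  run (loop v ea ee ew body) (m * (T + 2) + 2) s (fun s' => rel k s s' /\ forall i, i < m -> F i s').
Proof.
move=> g w0 vk kT Ea Ee Hb Hm; have [v0 v1] := andP vk.
have vv : v <= v < 20 by rewrite leqnn /=; apply: leq_trans v1 (leq_trans kT _).
apply: (run_loop (Inv := fun i s' => [/\ rel k s s', imem s' v = a0 + i * w & forall j, j < i -> F j s'])
  w0 Ea).
- split=> //; [exact: rel_set|by rewrite /= eqxx mul0n addn0].
- by move=> i s1 [r1 E1 _]; have [-> _] := Ee s1 r1.
- move=> i s1 im [r1 E1 F1]; apply: run_weak (Hb i s1 im r1 E1) (leqnn _) _ => s2 [r2 F2].
  have r2' : rel k s1 s2 by apply: rel_weak r2; apply: ltnW.
  have r3 : rel k s s2 := rel_trans r1 r2'.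
  have r4 := rel_set (a0 + i.+1 * w) (rel_GI r2) vk kT.
  split; [by rewrite (rel_keep r2)|by have [] := Ee s2 r3|].
  split; [exact: rel_trans r3 r4|by rewrite /= eqxx|].
  move=> j; rewrite ltnS leq_eqVlt => /orP[/eqP ->|ji]; first exact: Hm r3 r4 F2.
  by apply: (Hm _ _ _ r3 r4); exact: (Hm _ _ _ r1 r2' (F1 j ji)).
- by move=> s' [].
Qed.

Definition rr s : region := fun d => if d then (imem s 13, imem s 12) else (imem s 11, imem s 10).

Lemma ev_eco s d e x : (forall a, a < 2 + 3 * n -> rmem s a = nth 0%R (input_seq I) a) ->
  ieval s e = x -> x <= n -> reval s (eco d e) = coord d (codeloc I x).
Proof.
move=> gi E h; have [a b] := code_addr gi h; have X3 : x + x + x - 1 = 3 * x - 1 by clear; lia.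
by case: d; rewrite /= E X3 ?a ?b.
Qed.

Lemma ev_ltcb s d ev ej (v : 'I_n) j : GI s ->
  ieval s ev = v.+1 -> ieval s ej = j -> beval s (ltcb d ev ej) = ltc d v j.
Proof.
move=> g E1 E2; have gi := GI_in g; rewrite /ltcb beval_and.
rewrite (_ : beval s (bpos ej) = (0 < j)); last by rewrite /= E2.
rewrite /ltc; congr andb.
rewrite (_ : beval s (BNot _) = ~~ (~~ (n + 1 <= j) && (reval s (eco d ej) <= reval s (eco d ev))%R));
  last by rewrite -E2 -(GI_n g).
rewrite addn1; case: (ltnP n j) => h; first by [].
rewrite (ev_eco d gi E2 h) (ev_eco d gi E1 (ltn_ord v)) [~~ false]/= andTb orFb -ltNge.
by rewrite {1}/codeloc valK.
Qed.

Definition viol rho (v : 'I_n) : bool :=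
  ~~ (~~ (ltc true v (rho true).1 && ~~ ltc true v (rho true).2) &&
      ~~ (ltc false v (rho false).1 && ~~ ltc false v (rho false).2)).

Lemma ev_inregb s (v : 'I_n) : GI s -> imem s 6 = v ->
  beval s inregb = inreg (rr s) v /\ beval s violb = viol (rr s) v.
Proof.
move=> g h6; have E d k : beval s (ltcb d (IAdd (V 6) (INat 1)) (V k)) = ltc d v (imem s k).
  by apply: ev_ltcb => //=; rewrite h6 addn1.
by split; rewrite /inreg /viol -!E.
Qed.

Lemma violP rho : reflect (ordered I rho) [forall v : 'I_n, ~~ viol rho v].
Proof.
apply: (iffP forallP) => [H d v|H v].
  move: (H v); rewrite /viol negbK => /andP[a b] h.
  by case: d h => h; apply: contraT => h'; [move: a|move: b]; rewrite h h'.
by rewrite /viol negbK; apply/andP; split; apply/negP => /andP[/H ->].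
Qed.

(** Otherwise some [v] would satisfy [v < low <= u < high <= v] in coordinate [d]. *)
Lemma inreg_ordered rho (u : 'I_n) : inreg rho u -> ordered I rho.
Proof.
have tr d (v w : 'I_n) j : ~~ ltc d v j -> ltc d w j -> (coord d (pos w) < coord d (pos v))%R.
  rewrite /ltc; case: (0 < j) => //=; case: (n < j) => //=; rewrite -leNgt => h1 h2.
  exact: lt_le_trans h2 h1.
case/and4P=> a1 a2 a3 a4 d v h; apply: contraT => h'.
have [b1 b2] : ~~ ltc d u (rho d).1 /\ ltc d u (rho d).2 by case: (d).
by have := lt_trans (tr _ _ _ _ b1 h) (tr _ _ _ _ h' b2); rewrite ltxx.
Qed.

Definition fb s : nat -> nat := updf (updf (updf (updf (updf (fun=> 0) 0 1) 1 (imem s 13))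
  2 (imem s 12)) 3 (imem s 11)) 4 (imem s 10).

Lemma blk_nopiece s o : fb s o = blk (rr s) nopiece o.
Proof.
have nop : forall k, nopiece k = [::] by [].
rewrite /fb /updf /blk; case: o => [|[|[|[|[|o]]]]] //=.
case: ifP => _; first by rewrite /load big1 // => k _; rewrite nop big_nil.
by do 2 (case: ifP => // _); rewrite /nxt big1.
Qed.

Lemma blk_single rho k (v : 'I_n) o : k < slots -> o != klen -> blk rho (single k v) o =
  updf (updf (updf (blk rho nopiece) (oload (stour c k)) (@qv R I v)) (ost M k) v.+1) (oen M c k) v.+1 o.
Proof.
move=> hk ok; rewrite /updf /blk /oload /ost /oen.
have tM : stour c k < M.
  by rewrite /stour; case: (posnP c.*2) => c0; [move: hk; rewrite /nslots c0 muln0|rewrite ltn_divLR].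
case: (ltnP o 5) => h5.
  by do 3 (rewrite ifF; last by move: h5; clear; lia).
case: (ltnP o (5 + M)) => hM.
  do 2 (rewrite ifF; last by move: hM; clear; lia).
  rewrite /load; have -> : (o == 5 + stour c k) = (stour c k == o - 5) by move: h5; clear; lia.
  rewrite big_mkcond (bigD1 (Ordinal hk)) //= [X in _ + X]big1 ?addn0 => [|j].
    rewrite /single eqxx big_seq1; case: ifP => // _; rewrite big1 // => j _; exact: big_nil.
  by rewrite -val_eqE /= /single => /negbTE ->; rewrite big_nil; case: ifP.
case: (ltnP o (5 + M + slots)) => hs.
  rewrite ifF; last by move: hs; clear; lia.
  have -> : (o == 5 + M + k) = (o - (5 + M) == k) by move: hM; clear; lia.
  rewrite /single; case: eqP => // _; rewrite ifF //; move: hM tM; clear; lia.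
case: (ltnP o klen) => hK.
  have -> : (o == 5 + M + slots + k) = (o - (5 + M + slots) == k) by move: hs; clear; lia.
  rewrite /single; case: eqP => // _; rewrite !ifF //; move: hs tM hk; clear; lia.
have -> : (o == 5 + M + slots + k) = false by move: hK hk; rewrite /keylen; clear; lia.
have -> : (o == 5 + M + k) = false by move: hs hk; clear; lia.
have -> : (o == 5 + stour c k) = false by move: hM tM; clear; lia.
rewrite /nxt; apply: eq_bigr => j _; rewrite /single; case: eqP => //= _.
by rewrite muln0.
Qed.

Lemma tc_nil : tc (I := I) [::] = 0%R.
Proof. by rewrite /tc /tour_cost /= big_seq1 edistpp. Qed.

Lemma costP_single k (v : 'I_n) : k < slots ->
  costP M c (single k v) = (cdist I 0 v.+1 + cdist I v.+1 0)%R.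
Proof.
move=> hk; rewrite /costP (bigD1 (Ordinal hk)) //= big1 ?addr0 => [|j].
  have cl : codeloc I v.+1 = pos v by rewrite /codeloc valK.
  by rewrite /single eqxx /tc /tour_cost /= big_cons big_seq1 /cdist cl.
by rewrite -val_eqE /= /single => /negbTE ->; exact: tc_nil.
Qed.

Lemma costP_nopiece : costP M c nopiece = 0%R.
Proof. by rewrite /costP big1 // => k _; exact: tc_nil. Qed.

Lemma run_pbase p T s (Q : state R -> Prop) : GI s ->
  (forall s1, Cst s s1 (fb s) -> run p T s1 Q) ->
  run (pbase M c p) ((aW * 3 + 2) + (1 + (1 + (1 + (1 + (1 + T)))))) s Q.
Proof.
have [f1 f2 f3 f4 f5] := addr_facts I M c.
move=> g H; have five : 4 < aW by move: f5; rewrite /keylen; clear; lia.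
have eco' s' f' o : Cst s s' f' -> ieval s' (IAdd eCA (INat o)) = aCA + o.
  by move=> C; have [_ _ <- _ _] := ev_addr M c (Cst_n g C).
have lo s' f' o : Cst s s' f' -> 2 <= o < 20 -> ieval s' (V o) = imem s o.
  by move=> C ho; apply: (Cst_lo C).
apply: run_seq; apply: run_weak (run_cfill (F := fun=> 0) g _) (leqnn _) _ => // s1 C0.
apply: (run_cstore C0 _ (eco' _ _ _ C0) (erefl _)) => [|s2 C1]; first by move: five; clear; lia.
apply: (run_cstore C1 _ (eco' _ _ _ C1) (lo _ _ 13 C1 isT)) => [|s3 C2]; first by move: five; clear; lia.
apply: (run_cstore C2 _ (eco' _ _ _ C2) (lo _ _ 12 C2 isT)) => [|s4 C3]; first by move: five; clear; lia.
apply: (run_cstore C3 _ (eco' _ _ _ C3) (lo _ _ 11 C3 isT)) => [|s5 C4]; first by move: five; clear; lia.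
by apply: (run_cstore C4 five (eco' _ _ _ C4) (lo _ _ 10 C4 isT)) => s6 C5; apply: H.
Qed.

Definition leafok s rho : Prop :=
  (ordered I rho -> (forall v : 'I_n, ~~ inreg rho v) -> has s rho nopiece (costP M c nopiece)) /\
  (forall (v : 'I_n) k, (forall u : 'I_n, inreg rho u = (u == v)) -> k < slots ->
     has s rho (single k v) (costP M c (single k v))).

Lemma leafok_rel k s s' rho : regok I rho -> rel k s s' -> leafok s rho -> leafok s' rho.
Proof.
move=> ro r [h1 h2]; split=> [oo nr|v j vr js].
  by apply: has_rel r (lexx _) (h1 oo nr); apply: Der0.
by apply: has_rel r (lexx _) (h2 v j vr js); apply: Der1.
Qed.

Definition TL0 := (aW * 3 + 2) + (1 + (1 + (1 + (1 + (1 + (1 + TI I M c)))))).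
Definition TL1 := (aW * 3 + 2) + (1 + (1 + (1 + (1 + (1 + (1 + (1 + (1 + (1 + TI I M c))))))))).
Definition TL := 1 + ((n * (3 + 2) + 2) + (TL0.+1 + (slots * TL1 + 1).+1)).

Lemma run_pleaf0 s : GI s -> regok I (rr s) -> ordered I (rr s) -> (forall v : 'I_n, ~~ inreg (rr s) v) ->
  run (pleaf0 M c) TL0 s (fun s' => rel 6 s s' /\ has s' (rr s) nopiece (costP M c nopiece)).
Proof.
move=> g ro oo nr; apply: run_pbase => // s1 C1.
apply: (run_finish (x := 0%R) (h := 0) g C1) => //; last exact: Der0.
  by move=> o _ _; exact: blk_nopiece.
by rewrite costP_nopiece.
Qed.

Lemma run_pleaf1 k s (v : 'I_n) : GI s -> regok I (rr s) -> (forall u : 'I_n, inreg (rr s) u = (u == v)) ->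
  k < slots -> imem s 8 = v ->
  run (pleaf1 M c k) TL1 s (fun s' => rel 6 s s' /\ has s' (rr s) (single k v) (costP M c (single k v))).
Proof.
have [f1 f2 f3 f4 f5] := addr_facts I M c.
move=> g ro vr hk h8; apply: run_pbase => // s1 C1.
have tM : stour c k < M.
  by rewrite /stour; case: (posnP c.*2) => c0; [move: hk; rewrite /nslots c0 muln0|rewrite ltn_divLR].
have ea s' f' o : Cst s s' f' -> ieval s' (IAdd eCA (INat o)) = aCA + o.
  by move=> C; have [_ _ <- _ _] := ev_addr M c (Cst_n g C).
have u8 s' f' : Cst s s' f' -> ieval s' (IAdd (V 8) (INat 1)) = v.+1.
  by move=> C; have e8 := Cst_lo C (isT : 2 <= 8 < 20); rewrite /= e8 h8 addn1.
have q8 : ieval s1 (ILoad (IAdd (eQ M c) (V 8))) = qv v.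
  have [_ _ _ eq_ _] := ev_addr M c (Cst_n g C1).
  have e8 := Cst_lo C1 (isT : 2 <= 8 < 20).
  transitivity (imem s1 (ieval s1 (eQ M c) + imem s1 8)); first by [].
  by rewrite eq_ e8 h8 (Cst_hi C1) ?leq_addr // GI_q.
apply: (run_cstore C1 _ (ea _ _ _ C1) q8) => [|s2 C2].
  by rewrite -/(stour c k) /oload; move: tM f5; rewrite /keylen; clear; lia.
apply: (run_cstore C2 _ (ea _ _ _ C2) (u8 _ _ C2)) => [|s3 C3].
  by rewrite /ost; move: hk f5; rewrite /keylen; clear; lia.
apply: (run_cstore C3 _ (ea _ _ _ C3) (u8 _ _ C3)) => [|s4 C4].
  by rewrite /oen; move: hk f5; rewrite /keylen; clear; lia.
apply: (run_finish (h := 0) (rho := rr s) g C4 (erefl _)); last exact: Der1.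
  move=> o _ ok; rewrite blk_single // /updf -/(stour c k).
  by rewrite blk_nopiece.
have gi a : a < 2 + 3 * n -> rmem s4 a = nth 0%R (input_seq I) a.
  by move=> ha; rewrite (Cst_r C4) ?(GI_in g) //; move: ha f1; clear; lia.
rewrite costP_single // -(ev_dist gi (erefl (ieval s4 (INat 0))) (u8 _ _ C4)) //.
by rewrite -(ev_dist gi (u8 _ _ C4) (erefl (ieval s4 (INat 0)))).
Qed.

Definition wv rho (v : 'I_n) : nat := if inreg rho v then 1 else (viol rho v).*2.
Definition wn rho (j : nat) : nat := if (insub j : option 'I_n) is Some v then wv rho v else 0.

Lemma run_pleaf s : GI s -> regok I (rr s) -> run (pleaf M c) TL s (fun s' => rel 9 s s' /\ leafok s' (rr s)).
Proof.
move=> g ro; apply: run_seq; apply: run_istore; rewrite [ieval _ (INat 7)]/= [ieval _ (INat 0)]/=.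
set s1 := istore s 7 0; have r1 : rel 9 s s1 by apply: rel_set.
have rrE k s' : rel k s s' -> k <= 10 -> rr s' = rr s.
  by move=> r hk; apply/funext => -[]; rewrite /rr !(rel_keep r) //; move: hk; clear; lia.
(* Only terminals of the region have odd weight, so an odd weight among those scanned means that
   variable 8 holds such a terminal. *)
pose Inv i s' := [/\ rel 9 s s', imem s' 6 = i, imem s' 7 = \sum_(j < i) wn (rr s) j, i <= n &
  0 < \sum_(j < i) (odd (wn (rr s) j)) -> exists2 v : 'I_n, imem s' 8 = v & inreg (rr s) v].
apply: run_seq; apply: (run_loop (Inv := Inv) (a0 := 0) (m := n) (w := 1)) => //.
- split=> //; [|by rewrite /= big_ord0|by rewrite big_ord0].
  by exact: rel_trans r1 (rel_set (v := 6) (k := 9) _ (rel_GI r1) isT isT).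
- move=> i s2 [r2 h6 _ _ _]; rewrite h6 !muln1 !add0n; split=> //.
  exact: GI_n (rel_GI r2).
- move=> i s2 im [r2 h6 h7 hi h8]; pose v := Ordinal im.
  have [e1 e2] := @ev_inregb s2 v (rel_GI r2) h6.
  have Rr := rrE _ _ r2 isT; rewrite Rr in e1 e2.
  have wE : wn (rr s) i = wv (rr s) v by rewrite /wn (insubT (fun j => j < n) im).
  have fin s3 : rel 9 s s3 -> imem s3 6 = i -> imem s3 7 = imem s2 7 + wv (rr s) v ->
    (if inreg (rr s) v then imem s3 8 = i else imem s3 8 = imem s2 8) ->
    [/\ imem s3 6 = 0 + i * 1, ieval s3 (INat 1) = 1 & Inv i.+1 (istore s3 6 (0 + i.+1 * 1))].
    move=> r3 k6 k7 k8; rewrite !muln1 !add0n; split=> //; split=> //.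
    + by exact: rel_trans r3 (rel_set (v := 6) (k := 9) _ (rel_GI r3) isT isT).
    + by rewrite /= k7 h7 big_ord_recr /= wE.
    + rewrite big_ord_recr /= wE /wv; case: ifP k8 => iv k8.
        by move=> _; exists v.
      by rewrite odd_double addn0 k8.
  apply: run_if; rewrite e1; case: ifP => iv.
    apply: (@run_weak _ _ (1 + 1) _ _ _ _ _ _ (fun s' h => h)) => //.
    apply: run_seq; apply: run_istore; apply: run_istore; apply: fin; rewrite ?iv //=.
    + have q1 : rel 9 s2 (istore s2 7 (imem s2 7 + 1)) := rel_set (v := 7) (k := 9) _ (rel_GI r2) isT isT.
      exact: rel_trans r2 (rel_trans q1 (rel_set (v := 8) (k := 9) _ (rel_GI q1) isT isT)).
    + by rewrite /wv iv.
  apply: run_if; rewrite e2; case: ifP => vv.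
    apply: run_istore; apply: fin; rewrite ?iv //=; last by rewrite /wv iv vv.
    by exact: rel_trans r2 (rel_set (v := 7) (k := 9) _ (rel_GI r2) isT isT).
  by apply: run_skip; apply: fin; rewrite ?iv //= /wv iv vv addn0.
move=> s2 [r2 _ h7 _ h8].
have Rr := rrE _ _ r2 isT.
have sE (f : nat -> nat) : \sum_(j < n) f (wn (rr s) j) = \sum_(v : 'I_n) f (wv (rr s) v).
  by apply: eq_bigr => v _; rewrite /wn valK.
have h7' : imem s2 7 = \sum_(v : 'I_n) wv (rr s) v by rewrite h7; apply: (sE id).
have no0 : ordered I (rr s) -> (forall v : 'I_n, ~~ inreg (rr s) v) -> imem s2 7 = 0.
  move=> /violP/forallP ov nv; rewrite h7' big1 // => v _; rewrite /wv (negbTE (nv v)).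
  by rewrite (negbTE (ov v)).
have no1 (v : 'I_n) : (forall u : 'I_n, inreg (rr s) u = (u == v)) -> imem s2 7 = 1 /\ imem s2 8 = v.
  move=> vr; have iv : inreg (rr s) v by rewrite vr eqxx.
  have /violP/forallP ov := inreg_ordered iv.
  split; first rewrite h7' (bigD1 v) //= big1 => [|u nu].
  - by rewrite /wv iv.
  - by rewrite /wv vr (negbTE nu) (negbTE (ov u)).
  have [|u -> ] := h8; last by rewrite vr => /eqP ->.
  by rewrite (sE odd) (bigD1 v) //= /wv iv.
pose F0 s' := ordered I (rr s) -> (forall v : 'I_n, ~~ inreg (rr s) v) -> has s' (rr s) nopiece (costP M c nopiece).
apply: run_seq; apply: (@run_weak _ _ TL0.+1 _ _ (fun s' => rel 6 s2 s' /\ F0 s')) => //.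
  apply: run_if; rewrite (_ : beval s2 _ = (imem s2 7 <= 0)) // leqn0; case: eqP => z7; last first.
    apply: run_weak (run_skip (Q := eq s2) (erefl s2)) _ _; first by rewrite /TL0; clear; lia.
    by move=> s' <-; split; [exact: rel_refl (rel_GI r2)|move=> a b; case: z7; exact: no0].
  have z (v : 'I_n) : wv (rr s) v = 0.
    by apply/eqP; move/eqP: z7; rewrite h7' sum_nat_eq0 => /forallP /(_ v).
  have zi (v : 'I_n) : ~~ inreg (rr s) v by apply/negP => iv; move: (z v); rewrite /wv iv.
  have zo : ordered I (rr s).
    by apply/violP/forallP => v; apply/negP => iv; move: (z v); rewrite /wv (negbTE (zi v)) iv.
  rewrite -Rr in ro zi zo; apply: run_weak (run_pleaf0 (rel_GI r2) ro zo zi) (leqnn _) _ => s' [a b].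
  by split=> // _ _; rewrite -Rr.
move=> s3 [r3 F3]; have r23 : rel 9 s s3 by apply: rel_trans r2 (rel_weak _ r3).
have k7 : imem s3 7 = imem s2 7 by rewrite (rel_keep r3).
have k8 : imem s3 8 = imem s2 8 by rewrite (rel_keep r3).
apply: run_if; rewrite beval_bieq (_ : ieval s3 (V 7) = imem s2 7) //; case: eqP => z7; last first.
  apply: run_weak (run_skip (Q := eq s3) (erefl s3)) _ _; first by clear; lia.
  by move=> s' <-; split=> //; split=> // v k vr; case: z7; have [-> _] := no1 v vr.
have [v [v8 vr]] : exists v : 'I_n, imem s2 8 = v /\ forall u : 'I_n, inreg (rr s) u = (u == v).
  have [|v v8 iv] := h8.
    rewrite (sE odd) lt0n; apply/eqP => Z.
    (* The total 1 is odd while violations weigh 2, so some terminal lies in the region. *)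
    have := congr1 odd z7; rewrite h7' /=.
    rewrite (eq_bigr (fun v => odd (wv (rr s) v) + (if inreg (rr s) v then 0 else viol (rr s) v).*2)).
      by rewrite big_split /= Z add0n -(big_morph double doubleD double0) odd_double.
    by move=> v _; rewrite /wv; case: ifP => // _; rewrite odd_double.
  exists v; split=> // u; apply/idP/eqP => [iu|-> //].
  apply/eqP; apply: contraT => nu; move/eqP: z7.
  rewrite h7' (bigD1 v) // (bigD1 u) //= {1}/wv iv {1}/wv iu; clear; lia.
have Rr3 := rrE _ _ r23 isT.
apply: run_weak (run_seqs (t := TL1) (k := 6) (s0 := s3) (F := fun k s' => has s' (rr s) (single k v) (costP M c (single k v)))
   (rel_refl _ (rel_GI r23)) _ _) _ _.
- move=> k s'; rewrite mem_iota => /andP[_ hk] r'.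
  have Rr' : rr s' = rr s by apply: (rrE 9) => //; apply: rel_trans r23 (rel_weak _ r').
  rewrite -Rr'; apply: run_pleaf1; rewrite ?Rr' //; first exact: rel_GI r'.
  by rewrite (rel_keep r') // k8.
- move=> k t1 t2; rewrite mem_iota => /andP[_ hk] r'; apply: (has_rel (h := 0)) r' (lexx _).
  exact: Der1.
- by rewrite size_iota.
- move=> s4 [r4 F4]; split; first by apply: rel_trans r23 (rel_weak _ r4).
  split=> [a b|u k ur hk].
    by apply: has_rel r4 (lexx _) (F3 a b); apply: Der0.
  have -> : u = v by apply/eqP; rewrite -vr ur eqxx.
  by apply: F4; rewrite mem_iota.
Qed.

End Leaf.

(** * Programs for initialization, leaves and rounds *)

Section Rounds.
Variables (M c : nat).
Local Open Scope nat_scope.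
Definition mpairs : seq (nat * nat) :=
  [seq x <- [seq (i, j) | i <- iota 0 (nslots M c), j <- iota 0 (nslots M c)]
  | (x.1 != x.2) && (stour c x.1 == stour c x.2)].
Definition pvisit : cmd :=
  If (bpos (at_ (V 11) 0))
    (Seq (seqs [seq pmerge M c x.1 x.2 | x <- mpairs])
      (loop 10 (eTB M c) (eTE M c) (eW M c)
        (If (bpos (at_ (V 10) 0)) (seqs [seq padd M c d | d <- [:: true; false]]) Skip)))
    Skip.
Definition pround : cmd := loop 11 (eTB M c) (eTE M c) (eW M c) pvisit.
(** The number of rounds. Its factor in front of [2 n] does not depend on the instance, so the
    product unfolds into a fixed sum. *)
Definition eR : iexp :=
  iter (2 * nslots M c).+1 (fun e => IAdd e (IAdd eN eN)) (INat (2 * nslots M c)).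
Definition prounds : cmd := loop 14 (INat 0) eR (INat 1) pround.
Definition lloop (v : nat) (p : cmd) : cmd := loop v (INat 0) (IAdd eN (INat 2)) (INat 1) p.
Definition pleaves : cmd := lloop 13 (lloop 12 (lloop 11 (lloop 10 (pleaf M c)))).

Definition ppow (k : nat) : cmd :=
  foldr (fun _ p => Seq (mul 3 2 (V vT) eB) (Seq (set vT (V 3)) p)) Skip (iota 0 k).
(** Rounds [2 n d] up without a floor operation: [d] is added [2 n] times into the real cell at
    [eCA], then 1 is subtracted as long as the result is positive, and the subtractions are
    counted. *)
Definition pdem : cmd :=
  Seq (RStore eCA (RNat 0))
  (Seq (loop 5 (INat 0) (IAdd eN eN) (INat 1) (RStore eCA (RAdd (RLoad eCA)
     (RLoad (IAdd (IAdd (IAdd (V 6) (V 6)) (V 6)) (INat 4))))))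
  (loop 5 (INat 0) (IAdd eN eN) (INat 1) (If (BRLe (RLoad eCA) (RNat 0)) Skip
    (Seq (RStore eCA (RSub (RLoad eCA) (RNat 1)))
      (IStore (IAdd (eQ M c) (V 6)) (IAdd (ILoad (IAdd (eQ M c) (V 6))) (INat 1))))))).
Definition pinit : cmd :=
  Seq (set vT (eW M c)) (Seq (ppow (keylen M c)) (loop 6 (INat 0) eN (INat 1) pdem)).
End Rounds.

(** * Completeness of the rounds *)

Section RoundsCorrect.
Variables (R : realType) (I : instance R) (M c : nat).
Local Notation n := (nterm I).
Local Notation slots := (nslots M c).
Local Notation klen := (keylen M c).
Local Notation GI := (GI I M c). Local Notation rel := (rel I M c). Local Notation has := (has M c).
Local Notation code := (code M c). Local Notation costP := (costP M c).
Local Notation DerI := (DerI M c).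
Local Notation aW := (aW I M c). Local Notation aQ := (aQ I M c). Local Notation aCA := (aCA I).
Local Notation aB := (aB I). Local Notation aTB := (aTB I M c).
Local Notation addr := (addr I M c). Local Notation aS := (aS I M c).
Local Notation flagged := (flagged I M c).
Local Notation leafok := (@leafok R I M c).
Local Notation load := (load M c (@qv R I)).
Local Notation nopiece := (@nopiece R I).
Local Open Scope nat_scope.
Implicit Types (s : state R) (P : pieces I) (rho : region).

Lemma has_le s rho P x y : (x <= y)%R -> has s rho P x -> has s rho P y.
Proof. by move=> xy [f l]; split=> //; apply: le_trans l xy. Qed.

Lemma DerI_inv k rho P : DerI k rho P -> match k with
  | 0 => regok I rho /\ ((ordered I rho /\ (forall v : 'I_n, ~~ inreg rho v) /\ P = nopiece) \/
     exists (v : 'I_n) k, [/\ (forall u : 'I_n, inreg rho u = (u == v)), k < slots & P = single k v])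
  | h.+1 => [\/ DerI h rho P,
     exists d r1 r2 P1 P2, [/\ DerI h r1 P1, DerI h r2 P2, adjacent d r1 r2,
       (forall k, k < slots -> P1 k = [::] \/ P2 k = [::]) /\
       (forall i, i < M -> load P1 i + load P2 i <= capn I) &
       rho = glue d r1 r2 /\ P = madd P1 P2] |
     exists k1 k2 P0, [/\ DerI h rho P0, k1 < slots, k2 < slots,
        [/\ k1 != k2, stour c k1 = stour c k2 & P0 k2 != [::]] & P = mmerge k1 k2 P0] ]
  end.
Proof.
case => {k rho P}.
- by move=> rho ro oo nr; split=> //; left.
- by move=> rho v k ro vr hk; split=> //; right; exists v, k.
- by move=> h rho P D; apply: Or31.
- by move=> h d r1 r2 P1 P2 D1 D2 a b e; apply: Or32; exists d, r1, r2, P1, P2.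
- by move=> h rho P k1 k2 D a b e f g; apply: Or33; exists k1, k2, P.
Qed.

Definition full h s : Prop := forall rho P, DerI h rho P -> has s rho P (costP P).

Definition fmer s ip (x : nat * nat) s' : Prop := forall h rho P, DerI h rho P -> code rho P = ip ->
  has s rho P (costP P) -> P x.2 != [::] -> has s' rho (mmerge x.1 x.2 P) (costP (mmerge x.1 x.2 P)).
Definition fad s ip iq d s' : Prop := forall h1 r1 P1 h2 r2 P2, DerI h1 r1 P1 -> DerI h2 r2 P2 ->
  code r1 P1 = ip -> code r2 P2 = iq -> has s r1 P1 (costP P1) -> has s r2 P2 (costP P2) ->
  adjacent d r1 r2 -> (forall k, k < slots -> P1 k = [::] \/ P2 k = [::]) ->
  (forall i, i < M -> load P1 i + load P2 i <= capn I) ->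
  has s' (glue d r1 r2) (madd P1 P2) (costP (madd P1 P2)).

Lemma mem_mpairs x : x \in mpairs M c ->
  [/\ x.1 < slots, x.2 < slots, x.1 != x.2 & stour c x.1 = stour c x.2].
Proof.
rewrite mem_filter => /andP[/andP[a /eqP b]] /allpairsP[[i j] [h1 h2 E]]; subst x.
by move: h1 h2; rewrite !mem_iota.
Qed.

Lemma fmer_rel k s ip x s1 s2 : x \in mpairs M c -> rel k s1 s2 -> fmer s ip x s1 -> fmer s ip x s2.
Proof.
move=> /mem_mpairs[a1 a2 a3 a4] r H h rho P D E hs pn.
by apply: has_rel r (lexx _) (H h rho P D E hs pn); apply: DerM D _ _ _ _ _.
Qed.

Lemma fad_rel k s ip iq d s1 s2 : rel k s1 s2 -> fad s ip iq d s1 -> fad s ip iq d s2.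
Proof.
move=> r H h1 r1 P1 h2 r2 P2 D1 D2 E1 E2 b1 b2 a1 a2 a3.
apply: has_rel r (lexx _) (H _ _ _ _ _ _ D1 D2 E1 E2 b1 b2 a1 a2 a3).
by apply: (DerA (h := maxn h1 h2)) => //; [exact: Der_le (leq_maxl _ _) D1|exact: Der_le (leq_maxr _ _) D2].
Qed.

Lemma costP_madd P1 P2 : (forall k, k < slots -> P1 k = [::] \/ P2 k = [::]) ->
  costP (madd P1 P2) = (costP P1 + costP P2)%R.
Proof.
move=> H; rewrite /costP -big_split /=; apply: eq_bigr => k _; rewrite /madd.
by case: (H k (ltn_ord k)) => ->; rewrite ?cats0 tc_nil ?addr0 ?add0r.
Qed.

Definition TMS := size (mpairs M c) * TM I M c + 1.
Definition TAS := aS * ((2 * TA I M c + 1).+1 + 2) + 2.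
Definition TR := aS * ((TMS + TAS).+1 + 2) + 2.

Lemma ev_table k s s' : rel k s s' -> ieval s' (eTB M c) = aTB /\
  (ieval s' (eTE M c) = aTB + aS * aW /\ ieval s' (eW M c) = aW).
Proof.
move=> r; have g := rel_GI r; have [a b _ _ [_ e]] := ev_addr M c (GI_n g).
by split=> //; split=> //; rewrite -(GI_T g) -e.
Qed.

(** One pass tries every pair of entries present at its start. Entries changed meanwhile have only
    become cheaper, so each derivation of level [h.+1] finds premises at least as good as those
    known when the pass began. *)
Lemma run_pround s h : GI s -> full h s ->
  run (pround M c) TR s (fun s' => rel 12 s s' /\ full h.+1 s').
Proof.
move=> g H; have W0 : 0 < aW by rewrite /aW addnS.
pose F ip s' := ip < aS -> (forall x, x \in mpairs M c -> fmer s ip x s') /\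
  (forall iq d, iq < aS -> fad s ip iq d s').
have [e1 _] := ev_table (rel_refl 12 g).
apply: run_weak (run_rloop (F := F) (v := 11) (k := 12) (a0 := aTB) (w := aW) (m := aS)
   (T := (TMS + TAS).+1) g W0 isT isT e1 _ _ _) (leqnn _) _.
- by move=> s' r; have [_] := ev_table r.
- move=> ip s1 hip r1 v1; have g1 := rel_GI r1.
  apply: run_if; rewrite (_ : beval s1 _ = flagged s1 ip); last by rewrite /= v1 addn0 /flagged lt0n.
  case: ifP => fl; last first.
    apply: run_weak (run_skip (Q := eq s1) (erefl s1)) _ _; first by rewrite /TMS; clear; lia.
    move=> s' <-; split; first exact: rel_refl.
    (* An entry still absent when visited was absent at the start of the pass. *)
    have no rho P : code rho P = ip -> ~ has s rho P (costP P).
      by move=> E [f _]; rewrite E in f; have [] := rel_tab r1 hip f; rewrite fl.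
    move=> _; split=> [x _ h' rho P _ E hs|iq d _ h1 r2 P1 h2 r3 P2 _ _ E _ hs].
      by case: (no _ _ E hs).
    by case: (no _ _ E hs).
  apply: run_seq.
  apply: run_weak (run_seqs (t := TM I M c) (k := 6) (s0 := s1) (F := fun x s' => fmer s ip x s')
     (rel_refl 6 g1) _ _) (leqnn _) _.
  + move=> x s2 hx r2; have [a1 a2 a3 a4] := mem_mpairs hx.
    have fl2 := (rel_tab r2 hip fl).1.
    have v2 : imem s2 11 = addr ip by rewrite (rel_keep r2).
    apply: run_weak (run_pmerge (rel_GI r2) hip fl2 v2 a1 a2 a3 a4) (leqnn _) _ => s3 [r3 H3].
    split=> // h' rho P D E hs pn; apply: has_le (H3 h' rho P D E pn).
    have := has_rel D (rel_trans (rel_trans r1 (rel_weak (isT : 6 <= 12) r2)) (rel_refl _ (rel_GI r2))) (lexx _) hs.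
    case=> _; rewrite E => le; rewrite costP_merge //; move: le; lra.
  + by move=> x t1 t2 hx; apply: fmer_rel.
  move=> s2 [r2 F2]; have g2 := rel_GI r2.
  have [e2 _] := ev_table (rel_refl 12 g2).
  pose G iq s' := iq < aS -> forall d, fad s ip iq d s'.
  apply: run_weak (run_rloop (F := G) (v := 10) (k := 11) (a0 := aTB) (w := aW) (m := aS)
    (T := (2 * TA I M c + 1).+1) g2 W0 isT isT e2 _ _ _) (leqnn _) _.
  + by move=> s' r; have [_] := ev_table r.
  + move=> iq s3 hiq r3 v3; have g3 := rel_GI r3.
    have r13 : rel 12 s s3.
      exact: rel_trans r1 (rel_trans (rel_weak (isT : 6 <= 12) r2) (rel_weak (isT : 11 <= 12) r3)).
    apply: run_if; rewrite (_ : beval s3 _ = flagged s3 iq); last by rewrite /= v3 addn0 /flagged lt0n.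
    case: ifP => fq; last first.
      apply: run_weak (run_skip (Q := eq s3) (erefl s3)) _ _; first by clear; lia.
      move=> s' <-; split; first exact: rel_refl.
      move=> _ d h1 r4 P1 h2 r5 P2 _ _ _ E _ [f _]; rewrite E in f.
      by have [] := rel_tab r13 hiq f; rewrite fq.
    apply: run_weak (run_seqs (t := TA I M c) (k := 6) (s0 := s3) (F := fun d s' => fad s ip iq d s')
       (rel_refl 6 g3) _ _) _ _ => //.
    * move=> d s4 _ r4.
      have fp4 := (rel_tab r4 hip (rel_tab r3 hip (rel_tab r2 hip fl).1).1).1.
      have fq4 := (rel_tab r4 hiq fq).1.
      have v4 : imem s4 11 = addr ip by rewrite (rel_keep r4) // (rel_keep r3) // (rel_keep r2).
      have v5 : imem s4 10 = addr iq by rewrite (rel_keep r4).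
      apply: run_weak (run_padd d (rel_GI r4) hip hiq fp4 fq4 v4 v5) (leqnn _) _ => s5 [r5 H5].
      split=> // h1 q1 P1 h2 q2 P2 D1 D2 E1 E2 b1 b2 c1 c2 c3.
      apply: has_le (H5 h1 q1 P1 h2 q2 P2 D1 D2 E1 E2 c1 c2 c3).
      have r14 := rel_trans r13 (rel_weak (isT : 6 <= 12) r4).
      have [_] := has_rel D1 r14 (lexx _) b1; have [_] := has_rel D2 r14 (lexx _) b2.
      rewrite E1 E2 costP_madd // => l2 l1; exact: lerD.
    * by move=> d t1 t2 _; apply: fad_rel.
    * move=> s4 [r4 F4]; split; first exact: rel_weak r4.
      by move=> _ d; apply: F4; case: d.
  + by move=> iq t1 t2 _ r HG hq d; apply: fad_rel r (HG hq d).
  move=> s3 [r3 F3]; split; first exact: rel_trans (rel_weak (isT : 6 <= 11) r2) r3.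
  move=> _; split=> [x hx|iq d hq]; last exact: F3.
  exact: fmer_rel hx r3 (F2 x hx).
- move=> ip t1 t2 _ r HF hp; have [a b] := HF hp; split=> [x hx|iq d hq].
    exact: fmer_rel hx r (a x hx).
  exact: fad_rel r (b iq d hq).
- move=> s' [r' F']; split=> // rho P /DerI_inv[D|[d [r1 [r2 [P1 [P2 [D1 D2 a [b e] [-> ->]]]]]]]|
    [k1 [k2 [P0 [D h1 h2 [a b e] ->]]]]].
  + exact: has_rel D r' (lexx _) (H _ _ D).
  + have [_ K] := F' _ (code_lt D1) (code_lt D1).
    exact: (K _ d (code_lt D2) _ _ _ _ _ _ D1 D2 (erefl _) (erefl _) (H _ _ D1) (H _ _ D2) a b e).
  + have [K _] := F' _ (code_lt D) (code_lt D).
    have hx : (k1, k2) \in mpairs M c.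
      rewrite mem_filter /= a b eqxx /=; apply/allpairsP; exists (k1, k2).
      by rewrite !mem_iota.
    exact: (K _ hx _ _ _ D (erefl _) (H _ _ D) e).
Qed.

Definition nrounds := (2 * slots).+1 * (2 * n) + 2 * slots.

Lemma run_prounds s : GI s -> full 0 s ->
  run (prounds M c) (nrounds * (TR + 2) + 2) s (fun s' => rel 15 s s' /\ full nrounds s').
Proof.
move=> g H; pose Inv i s' := [/\ rel 15 s s', imem s' 14 = i & full i s'].
have full_rel k i s1 s2 : rel k s1 s2 -> full i s1 -> full i s2.
  by move=> r f rho P D; apply: has_rel D r (lexx _) (f _ _ D).
have evR s' : imem s' 0 = n -> ieval s' (eR M c) = nrounds.
  move=> h0; rewrite /eR /nrounds; elim: (2 * slots).+1 => [|k IH]; first by rewrite mul0n.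
  by rewrite iterS [ieval _ _]/= IH h0 mulSn; clear; lia.
apply: (run_loop (Inv := Inv) (a0 := 0) (m := nrounds) (w := 1)) => //.
- have r0 : rel 15 s (istore s 14 0) := rel_set (v := 14) (k := 15) _ g isT isT.
  by split=> //; apply: full_rel r0 H.
- move=> i s1 [r1 h1 _]; rewrite h1 !muln1 !add0n evR //; exact: GI_n (rel_GI r1).
- move=> i s1 im [r1 h1 f1]; apply: run_weak (run_pround (rel_GI r1) f1) (leqnn _) _ => s2 [r2 f2].
  have r12 : rel 15 s s2 by apply: rel_trans r1 (rel_weak _ r2).
  have r3 : rel 15 s2 (istore s2 14 (0 + i.+1 * 1)) := rel_set (v := 14) (k := 15) _ (rel_GI r2) isT isT.
  split=> //; first by rewrite (rel_keep r2) // h1 muln1.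
  split; [exact: rel_trans r12 r3|by rewrite /= muln1 add0n|exact: full_rel r3 f2].
- by move=> s' [].
Qed.

Definition mkreg (i j k l : nat) : region := fun d => if d then (i, j) else (k, l).

Lemma regok_mkreg i j k l : i < n + 2 -> j < n + 2 -> k < n + 2 -> l < n + 2 -> regok I (mkreg i j k l).
Proof. by rewrite !addn2 !ltnS => a b e f [] /=. Qed.

Definition TLV T := (n + 2) * (T + 2) + 2.

Lemma run_lloop v k p T s (F : nat -> state R -> Prop) : GI s -> 0 < v < k -> k <= vT ->
  (forall i s', i < n + 2 -> rel k s s' -> imem s' v = i ->
     run p T s' (fun s'' => rel v s' s'' /\ F i s'')) ->
  (forall i s1 s2, rel k s1 s2 -> F i s1 -> F i s2) ->
  run (lloop v p) (TLV T) s (fun s' => rel k s s' /\ forall i, i < n + 2 -> F i s').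
Proof.
move=> g vk kT H Hm; apply: (run_rloop (a0 := 0) (w := 1)) => //.
- by move=> s' r; rewrite /= (GI_n (rel_GI r)) muln1.
- by move=> i s' hi r; rewrite muln1 add0n; apply: H.
- by move=> i s1 s2 _; apply: Hm.
Qed.

Lemma run_pleaves s : GI s ->
  run (pleaves M c) (TLV (TLV (TLV (TLV (TL I M c))))) s (fun s' => rel 14 s s' /\ full 0 s').
Proof.
move=> g.
pose F4 i j k l s' := [&& i < n + 2, j < n + 2, k < n + 2 & l < n + 2] -> leafok s' (mkreg i j k l).
have F4r k0 i j k l s1 s2 : rel k0 s1 s2 -> F4 i j k l s1 -> F4 i j k l s2.
  by move=> r H b; move: (b) => /and4P[b1 b2 b3 b4]; apply: leafok_rel r (H b); apply: regok_mkreg.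
apply: run_weak (run_lloop (v := 13) (k := 14) (F := fun i s' => forall j, j < n + 2 -> forall k, k < n + 2 ->
   forall l, l < n + 2 -> F4 i j k l s') g isT isT _ _) (leqnn _) _.
- move=> i s1 hi r1 v1.
  apply: run_weak (run_lloop (v := 12) (k := 13) (F := fun j s' => forall k, k < n + 2 ->
    forall l, l < n + 2 -> F4 i j k l s') (rel_GI r1) isT isT _ _) (leqnn _) (fun _ h => h).
  + move=> j s2 hj r2 v2.
    apply: run_weak (run_lloop (v := 11) (k := 12) (F := fun k s' =>
      forall l, l < n + 2 -> F4 i j k l s') (rel_GI r2) isT isT _ _) (leqnn _) (fun _ h => h).
    * move=> k s3 hk r3 v3.
      apply: run_weak (run_lloop (v := 10) (k := 11) (F := fun l s' => F4 i j k l s') (rel_GI r3) isT isT _ _)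
        (leqnn _) (fun _ h => h).
      - move=> l s4 hl r4 v4.
        have E : rr s4 = mkreg i j k l.
          apply/funext => -[]; rewrite /rr /mkreg.
            by rewrite (rel_keep r4) // (rel_keep r3) // (rel_keep r2) // v1 (rel_keep r4) // (rel_keep r3) // v2.
          by rewrite (rel_keep r4) // v3 v4.
        have ro : regok I (rr s4) by rewrite E; apply: regok_mkreg.
        apply: run_weak (run_pleaf (rel_GI r4) ro) (leqnn _) _ => s5 [r5 L5].
        by split; [exact: rel_weak r5|move=> _; rewrite -E].
      - by move=> l t1 t2 r; apply: F4r r.
    * by move=> k t1 t2 r H l hl; apply: F4r r (H l hl).
  + by move=> j t1 t2 r H k hk l hl; apply: F4r r (H k hk l hl).
- by move=> i t1 t2 r H j hj k hk l hl; apply: F4r r (H j hj k hk l hl).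
move=> s' [r' F']; split=> // rho P /DerI_inv[ro D].
have [w1 w2] := ro true; have [w3 w4] := ro false.
have E : rho = mkreg (rho true).1 (rho true).2 (rho false).1 (rho false).2.
  by apply/funext => -[]; rewrite /mkreg; case: (rho _).
have n2 x : x <= n.+1 -> x < n + 2 by rewrite addn2 ltnS.
have [L1 L2] : leafok s' rho.
  by rewrite E; apply: F'; rewrite ?n2.
case: D => [[oo [nr ->]]|[v [k [vr hk ->]]]]; [exact: L1|exact: L2].
Qed.

Lemma input_demand (v : 'I_n) : nth 0%R (input_seq I) (3 * v + 4) = demand v.
Proof.
have fl (l : seq 'I_n) j (d0 : 'I_n) : j < size l ->
  nth 0%R (flatten [seq [:: (pos v).1; (pos v).2; demand v] | v <- l]) (3 * j + 2) = demand (nth d0 l j).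
  elim: l j => // u l IH [|j] hj //.
  by rewrite mulnS -addnA; exact: IH.
have -> : 3 * v + 4 = (3 * v + 2).+2 by rewrite !addnS.
transitivity (nth 0%R (flatten [seq [:: (pos v).1; (pos v).2; demand v] | v <- enum 'I_n]) (3 * v + 2)).
  by [].
by rewrite (fl _ _ v) ?size_enum_ord // nth_ord_enum.
Qed.

(** State during initialization: [qd] gives the rounded demands written so far, and the table is
    still blank. *)
Definition Jst s (qd : nat -> nat) : Prop :=
  [/\ imem s 0 = n, forall a, a < 2 + 3 * n -> rmem s a = nth 0%R (input_seq I) a,
      imem s vT = aS * aW, forall j, j < n -> imem s (aQ + j) = qd j &
      forall a, aTB <= a -> imem s a = 0].

Lemma Jst_set s qd v x : 0 < v < 19 -> Jst s qd -> Jst (istore s v x) qd.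
Proof.
have [f1 f2 f3 f4 f5] := addr_facts I M c.
move=> /andP[v0 v1] [h1 h2 h3 h4 h5]; split=> //=.
- by rewrite eq_sym gtn_eqF.
- by case: eqP => // E; rewrite -E in v1.
- by move=> j hj; rewrite ifF ?h4 //; move: v1 f1 f2; clear; lia.
- by move=> a ha; rewrite ifF ?h5 //; move: ha v1 f1 f2 f3 f4; clear; lia.
Qed.

Lemma Jst_acc s qd x : Jst s qd -> Jst (rstore s aCA x) qd.
Proof.
have [f1 f2 f3 f4 f5] := addr_facts I M c.
move=> [h1 h2 h3 h4 h5]; split=> //= a ha; rewrite ifF ?h2 //; move: ha f1; clear; lia.
Qed.

Definition qn (j : nat) : nat := if (insub j : option 'I_n) is Some v then qv v else 0.

Lemma Jst_GI s : Jst s qn -> GI s.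
Proof.
move=> [h1 h2 h3 h4 h5]; split=> // [v|idx hi].
  by rewrite h4 // /qn valK.
by rewrite /flagged h5 // /addr leq_addr.
Qed.

Definition TD := 1 + (((2 * n) * (1 + 2) + 2) + ((2 * n) * (3 + 2) + 2)).

(** With [x = 2 n d], after [i] steps of the second loop the accumulator is [x - minn i (qv v)],
    which is positive exactly as long as [i < qv v]. Since [d <= 1], [2 n] steps are enough. *)
Lemma run_pdem s (v : 'I_n) : Jst s (fun j => if j < v then qn j else 0) -> imem s 6 = v ->
  run (pdem M c) TD s (fun s' => Jst s' (fun j => if j < v.+1 then qn j else 0) /\ imem s' 6 = v).
Proof.
have [f1 f2 f3 f4 f5] := addr_facts I M c.
pose x := ((capn I)%:R * demand v)%R.
have qle : qv v <= capn I /\ (x <= (qv v)%:R)%R /\ forall k, k < qv v -> ~ (x <= k%:R)%R.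
  have hh : seq.has (fun k => (x <= k%:R :> R)%R) (iota 0 (capn I).+1).
    apply/hasP; exists (capn I); first by rewrite mem_iota /= add0n ltnSn.
    by rewrite -[X in (_ <= X)%R]mulr1 ler_wpM2l //; case/andP: (demand_bounds v).
  have h1 : qv v <= capn I by rewrite -ltnS -[X in _ < X](size_iota 0) -has_find.
  split=> //; split; first by have := nth_find 0 hh; rewrite nth_iota.
  move=> k kq hk; have := before_find 0 kq; rewrite nth_iota ?add0n ?hk //.
  by apply: leq_trans kq (leq_trans h1 _).
have [q1 [q2 q3]] := qle.
move=> J0 h6; apply: run_seq; apply: run_rstore.
have [_ _ -> _ _] : _ := ev_addr M c (let: And5 a _ _ _ _ := J0 in a).
rewrite [reval _ _]/=; set s1 := rstore _ _ _.
have J1 : Jst s1 (fun j => if j < v then qn j else 0) by apply: Jst_acc.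
have ev2 s' qd : Jst s' qd -> ieval s' (IAdd eN eN) = 2 * n.
  by move=> [h0 _ _ _ _]; rewrite /= h0 mul2n addnn.
have eca s' qd : Jst s' qd -> ieval s' eCA = aCA.
  by move=> [h0 _ _ _ _]; have [_ _ -> _ _] := ev_addr M c h0.
pose Inv1 i s' := [/\ Jst s' (fun j => if j < v then qn j else 0), imem s' 6 = v, imem s' 5 = i &
  rmem s' aCA = (i%:R * demand v)%R].
apply: run_seq; apply: (run_loop (Inv := Inv1) (a0 := 0) (m := 2 * n) (w := 1)) => //.
- by split=> //; [exact: Jst_set|rewrite /= eqxx mul0r].
- by move=> i s2 [J2 _ h5 _]; rewrite h5 (ev2 _ _ J2) !muln1 !add0n.
- move=> i s2 _ [J2 k6 k5 ka]; apply: run_rstore; rewrite (eca _ _ J2).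
  have J3 := Jst_acc (reval s2 (RAdd (RLoad eCA) (RLoad (IAdd (IAdd (IAdd (V 6) (V 6)) (V 6)) (INat 4))))) J2.
  split; [by rewrite /= k5 muln1|by []|split=> //=].
  + by apply: Jst_set => //; exact: J3.
  + by rewrite muln1 add0n.
  + have E : reval s2 (RLoad eCA) = (i%:R * demand v)%R by rewrite -ka -(eca _ _ J2).
    rewrite eqxx -[rmem s2 (_ + 22)]/(reval s2 (RLoad eCA)) E k6.
    have [_ gi _ _ _] := J2.
    have -> : v + v + v + 4 = 3 * v + 4 by clear; lia.
    rewrite gi; last by move: (ltn_ord v); clear; lia.
    by rewrite input_demand -natr1 mulrDl mul1r.
move=> s2 [J2 k6 k5 ka].
pose Inv2 i s' := [/\ Jst s' (fun j => if j < v then qn j else if j == v then minn i (qv v) else 0),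
  imem s' 6 = v, imem s' 5 = i & rmem s' aCA = (x - (minn i (qv v))%:R)%R].
apply: (run_loop (Inv := Inv2) (a0 := 0) (m := 2 * n) (w := 1)) => //.
- split=> //; last by rewrite min0n subr0.
  have [a1 a2 a3 a4 a5] := Jst_set (v := 5) 0 isT J2; split=> // j hj.
  by rewrite a4 // min0n; case: ifP => // _; case: ifP.
- by move=> i s3 [J3 _ h5 _]; rewrite h5 (ev2 _ _ J3) !muln1 !add0n.
- move=> i s3 _ [J3 l6 l5 la].
  have fin s4 : Jst s4 (fun j => if j < v then qn j else if j == v then minn i.+1 (qv v) else 0) ->
      imem s4 6 = v -> imem s4 5 = i -> rmem s4 aCA = (x - (minn i.+1 (qv v))%:R)%R ->
      [/\ imem s4 5 = 0 + i * 1, ieval s4 (INat 1) = 1 & Inv2 i.+1 (istore s4 5 (0 + i.+1 * 1))].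
    move=> b1 b2 b3 b4; rewrite !muln1 !add0n; split=> //; split=> //; exact: Jst_set.
  apply: run_if; rewrite (_ : beval s3 _ = (x <= (minn i (qv v))%:R)%R); last first.
    by rewrite -subr_le0 -la /= -[rmem s3 (_ + 22)]/(reval s3 (RLoad eCA)) /reval -(eca _ _ J3).
  case: ifP => hx.
    have qi : qv v <= i.
      by rewrite leqNgt; apply/negP => iq; move: hx; rewrite (minn_idPl (ltnW iq)); exact: q3.
    have E : minn i (qv v) = minn i.+1 (qv v) by rewrite (minn_idPr qi) (minn_idPr (leqW qi)).
    apply: (@run_weak _ _ 1 2 _ _ _ _ _ (fun _ h => h)) => //.
    by apply: run_skip; apply: fin; rewrite -?E.
  have iq : i < qv v.
    by rewrite ltnNge; apply/negP => qi; move: hx; rewrite (minn_idPr qi) q2.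
  have E1 : minn i (qv v) = i by apply/minn_idPl; apply: ltnW.
  have E2 : minn i.+1 (qv v) = i.+1 by apply/minn_idPl.
  apply: (@run_weak _ _ (1 + 1) 2 _ _ _ _ _ (fun _ h => h)) => //.
  apply: run_seq; apply: run_rstore; rewrite (eca _ _ J3); apply: run_istore.
  set s4 := rstore _ _ _; have J4 := Jst_acc (reval s3 (RSub (RLoad eCA) (RNat 1))) J3.
  have eq4 : ieval s4 (IAdd (eQ M c) (V 6)) = aQ + v.
    have [h0 _ _ _ _] := J4; have [_ _ _ eq_ _] := ev_addr M c h0.
    by rewrite -eq_ -l6.
  have val4 : ieval s4 (IAdd (ILoad (IAdd (eQ M c) (V 6))) (INat 1)) = i.+1.
    transitivity (imem s4 (ieval s4 (IAdd (eQ M c) (V 6))) + 1); first by [].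
    have [_ _ _ h4 _] := J4; rewrite eq4 h4 // ltnn eqxx E1 addn1 //.
  rewrite eq4 val4; have [c1 c2 c3 c4 c5] := J4; apply: fin.
  + split=> //=.
    * by rewrite ifF //; move: f1 f2; clear; lia.
    * by rewrite ifF // ?/vT; move: f1 f2; clear; lia.
    * move=> j hj; rewrite eqn_add2l; case: eqP => [->|/eqP ne]; first by rewrite ltnn E2.
      by rewrite c4 // (negbTE ne).
    * move=> a ha; rewrite ifF ?c5 //; move: ha (ltn_ord v) f3 f4; clear; lia.
  + by rewrite /= ifF //; move: f1 f2; clear; lia.
  + by rewrite /= ifF //; move: f1 f2; clear; lia.
  + rewrite /= eqxx -[rmem s3 (_ + 22)]/(reval s3 (RLoad eCA)) [reval _ _]/= -[X in rmem s3 X]/(ieval s3 eCA).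
    by rewrite (eca _ _ J3) la E1 E2 -[in RHS]natr1 opprD addrA.
- move=> s3 [[a1 a2 a3 a4 a5] l6 _ _]; split=> //; split=> // j hj; rewrite a4 //.
  rewrite (ltnS j) (leq_eqVlt j); case: (ltngtP j v) => //= ->.
  by rewrite /qn valK; exact: (minn_idPr q1).
Qed.

Definition TINI := 1 + ((klen * (aB * 3 + 4) + 1) + (n * (TD + 2) + 2)).

Lemma run_ppow (l : seq nat) s : imem s 0 = n ->
  run (foldr (fun _ p => Seq (mul 3 2 (V vT) eB) (Seq (set vT (V 3)) p)) Skip l)
   (size l * (aB * 3 + 4) + 1) s (fun s' =>
  [/\ rmem s' =1 rmem s, forall a, (a == 0) || (20 <= a) -> imem s' a = imem s a &
      imem s' vT = aB ^ size l * imem s vT]).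
Proof.
elim: l s => [|j l IH] s h0; first by apply: run_skip; split=> //; rewrite expn0 mul1n.
apply: (@run_weak _ _ ((aB * 3 + 3) + (1 + (size l * (aB * 3 + 4) + 1)))
  _ _ _ _ _ _ (fun s' h => h)); last by rewrite /= mulSn; clear; lia.
apply: run_seq; apply: run_weak (run_mul (K := 5) (va := imem s vT) (vb := aB) _ _ _ _) (leqnn _) _ => //.
  move=> s' hr hs; have e0 : imem s' 0 = n by rewrite hs.
  by have [_ -> _ _ _] := ev_addr M c e0; rewrite /= hs.
move=> s1 [hr hs h3]; apply: run_seq; apply: run_istore.
set s2 := istore _ _ _; have e2 : imem s2 0 = n by rewrite /= hs.
apply: run_weak (IH s2 e2) (leqnn _) _ => s3 [g1 g2 g3]; split.
- by move=> a; rewrite g1 /= hr.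
- move=> a ha; rewrite g2 //= ifF; last by apply/eqP => E; move: ha; rewrite E.
  by rewrite hs //; move: ha; clear; lia.
- by rewrite g3 /= h3 expnSr mulnA.
Qed.

Lemma run_pinit : run (pinit M c) TINI (input_state I) GI.
Proof.
have [f1 f2 f3 f4 f5] := addr_facts I M c.
apply: run_seq; apply: run_istore; set s1 := istore _ _ _.
have h1 : imem s1 0 = n by [].
have := run_ppow (iota 0 klen) h1; rewrite size_iota => K.
apply: run_seq; apply: run_weak K (leqnn _) _ => s2 [g1 g2 g3].
have zi a : 20 <= a -> imem s2 a = 0.
  move=> ha; rewrite g2 ?ha ?orbT //; rewrite /= !ifF //; by apply/eqP => E; rewrite E in ha.
have J2 : Jst s2 (fun=> 0).
  split=> [|a _||j hj|a ha].
  - by rewrite g2.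
  - by rewrite g1.
  - by rewrite g3.
  - by apply: zi; move: f1 f2; clear; lia.
  - by apply: zi; move: ha f1 f2 f3 f4; clear; lia.
apply: (run_loop (Inv := fun i s' => [/\ Jst s' (fun j => if j < i then qn j else 0), imem s' 6 = i & i <= n])
  (a0 := 0) (m := n) (w := 1)) => //.
- by split=> //; apply: Jst_set.
- by move=> i s3 [[h0 _ _ _ _] h6 _]; rewrite h6 /= h0 !muln1.
- move=> i s3 hi [J3 h6 _]; apply: run_weak (run_pdem (v := Ordinal hi) J3 h6) (leqnn _) _ => s4 [J4 k6].
  by rewrite !muln1 !add0n; split=> //; split=> //; apply: Jst_set.
- move=> s3 [[h0 h2 h3 h4 h5] _ _]; apply: Jst_GI; split=> // j hj.
  by rewrite h4 // hj.
Qed.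

End RoundsCorrect.

(** * Programs for selecting and writing a solution *)

Section Output.
Variables (M c : nat).
Local Open Scope nat_scope.
(** Keys of the whole plane in which only the first slot of each tour is used, so that each tour is
    one piece. *)
Definition pvalid : seq bexp :=
  let p := V 11 in
  [:: bpos (at_ p 0); bieq (at_ p 1) (INat 0); bieq (at_ p 2) (IAdd eN (INat 1));
      bieq (at_ p 3) (INat 0); bieq (at_ p 4) (IAdd eN (INat 1))] ++
  [seq bieq (at_ p (ost M k)) (INat 0) | k <- iota 0 (nslots M c) & k %% c.*2 != 0].
Definition pbest : cmd :=
  Seq (set 12 (INat 0)) (loop 11 (eTB M c) (eTE M c) (eW M c)
    (If (BAnd (ball pvalid) (BNot (BAnd (bpos (V 12)) (BRLe (RLoad (V 12)) (RLoad (V 11))))))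
       (set 12 (V 11)) Skip)).
(** One visit: variable 15 holds the current terminal and then its successor. Once it is 0 the step
    idles, so [n] repetitions complete any tour. *)
Definition pstep (i : nat) : cmd :=
  If (bpos (V 15)) (Seq (IStore (V 14) (V 15)) (Seq (IStore (V 13) (IAdd (ILoad (V 13)) (INat 1)))
    (Seq (IStore (IAdd (eO M c) (V 15)) (INat i)) (Seq (set 14 (IAdd (V 14) (INat 1)))
      (set 15 (ILoad (IAdd (V 12) (IAdd (INat (keylen M c)) (V 15))))))))) Skip.
Definition ptour (i : nat) : cmd :=
  Seq (IStore (V 13) (INat 0)) (Seq (set 14 (IAdd (V 13) (INat 1)))
  (Seq (set 15 (at_ (V 12) (ost M (i * c.*2)))) (Seq (loop 16 (INat 0) eN (INat 1) (pstep i))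
  (set 13 (V 14))))).
(** Addresses are computed from [n] in cell 0, and the loop counter is cell 1. So the cells from 20
    on are copied by a loop, those from 1 to 19 by straight-line code, and cell 0 last. *)
Definition pcopy : cmd :=
  Seq (loop 1 (INat 20) (IAdd (IAdd eN eN) (INat (M + 21))) (INat 1)
    (IStore (V 1) (ILoad (IAdd (eO M c) (V 1)))))
  (Seq (seqs [seq set j (ILoad (IAdd (eO M c) (INat j))) | j <- iota 1 19])
    (set 0 (ILoad (IAdd (eO M c) (INat 0))))).
Definition pout : cmd :=
  Seq (set 13 (IAdd (IAdd (eO M c) eN) (INat 1))) (Seq (IStore (eO M c) (INat M))
  (Seq (seqs [seq ptour i | i <- iota 0 M]) pcopy)).
Definition pmain : cmd :=
  Seq (pinit M c) (Seq (pleaves M c) (Seq (prounds M c) (Seq pbest (If (bpos (V 12)) pout Skip)))).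
End Output.

(** * Correctness of the output *)

Section OutputCorrect.
Variables (R : realType) (I : instance R) (M c : nat).
Local Notation n := (nterm I).
Local Notation slots := (nslots M c).
Local Notation klen := (keylen M c).
Local Notation GI := (GI I M c). Local Notation rel := (rel I M c). Local Notation has := (has M c).
Local Notation code := (code M c). Local Notation costP := (costP M c). Local Notation blk := (blk M c).
Local Notation DerI := (DerI M c).
Local Notation aW := (aW I M c). Local Notation aQ := (aQ I M c). Local Notation aCA := (aCA I).
Local Notation aO := (aO I M c).
Local Notation aB := (aB I). Local Notation aTB := (aTB I M c).
Local Notation addr := (addr I M c). Local Notation aS := (aS I M c).
Local Notation flagged := (flagged I M c).
Local Open Scope nat_scope.
Implicit Types (s : state R) (P : pieces I) (rho : region).

Definition validf (f : nat -> nat) : bool :=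
  [&& 0 < f 0, f 1 == 0, f 2 == n + 1, f 3 == 0 & f 4 == n + 1] &&
  all (fun k => f (ost M k) == 0) [seq k <- iota 0 slots | k %% c.*2 != 0].
Definition valid s idx : bool := validf (fun o => imem s (addr idx + o)).

Definition TBE := 1 + (aS * (2 + 2) + 2).

Lemma run_pbest s : GI s -> run (pbest M c) TBE s (fun s' => [/\ rmem s' =1 rmem s,
  forall a, a != 11 -> a != 12 -> imem s' a = imem s a &
  (imem s' 12 = 0 /\ forall idx, idx < aS -> ~~ valid s idx) \/
  exists b, [/\ b < aS, valid s b, imem s' 12 = addr b & forall idx, idx < aS -> valid s idx ->
     (rmem s (addr b) <= rmem s (addr idx))%R]]).
Proof.
have [f1 f2 f3 f4 f5] := addr_facts I M c.
move=> g; have W0 : 0 < aW by rewrite /aW addnS.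
have A20 idx : 20 < addr idx by have [] := addr_ge I M c idx; move: f1 f2; clear; lia.
apply: run_seq; apply: run_istore; set s1 := istore _ _ _.
pose Inv i s' := [/\ rmem s' =1 rmem s, forall a, a != 11 -> a != 12 -> imem s' a = imem s a,
  imem s' 11 = addr i &
  (imem s' 12 = 0 /\ forall idx, idx < i -> ~~ valid s idx) \/
  exists b, [/\ b < i, valid s b, imem s' 12 = addr b & forall idx, idx < i -> valid s idx ->
     (rmem s (addr b) <= rmem s (addr idx))%R]].
have ev s' : (forall a, a != 11 -> a != 12 -> imem s' a = imem s a) ->
    [/\ ieval s' (eTB M c) = aTB, ieval s' (eTE M c) = aTB + aS * aW & ieval s' (eW M c) = aW].
  move=> h; have h0 : imem s' 0 = n by rewrite h // (GI_n g).
  by have [a b _ _ [_ e]] := ev_addr M c h0; split=> //; rewrite -(GI_T g) -h // -e.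
apply: (run_loop (Inv := Inv) (a0 := aTB) (m := aS) (w := aW)) => //.
- by have [|-> _ _] := ev s1 _ => // a a1 a2; rewrite /= (negbTE a2).
- split=> //=; [by move=> a /negbTE -> /negbTE ->|by rewrite /addr mul0n addn0|by left].
- by move=> i s2 [_ h1 -> _]; have [_ -> _] := ev s2 h1.
- move=> i s2 hi [hr h1 h2 h3].
  have vE : beval s2 (ball (pvalid M c)) = valid s i.
    rewrite beval_ball /pvalid all_cat all_map /valid /validf; congr andb.
      rewrite -[LHS]/([&& beval s2 (bpos (at_ (V 11) 0)), beval s2 (bieq (at_ (V 11) 1) (INat 0)),
        beval s2 (bieq (at_ (V 11) 2) (IAdd eN (INat 1))), beval s2 (bieq (at_ (V 11) 3) (INat 0)),
        beval s2 (bieq (at_ (V 11) 4) (IAdd eN (INat 1))) & true]) andbT !beval_bieq.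
      have E o : ieval s2 (at_ (V 11) o) = imem s (addr i + o).
        by rewrite /= h2 h1 //; move: (A20 i); clear; lia.
      have -> : beval s2 (bpos (at_ (V 11) 0)) = (0 < imem s (addr i + 0)) by rewrite -E.
      by rewrite !E [ieval s2 (IAdd _ _)]/= h1 // (GI_n g).
    apply: eq_all => k; rewrite /preim [LHS]beval_bieq /= h2 h1 //; move: (A20 i); clear; lia.
  have fin s3 : rmem s3 =1 rmem s -> (forall a, a != 11 -> a != 12 -> imem s3 a = imem s a) ->
      imem s3 11 = addr i -> 
      ((imem s3 12 = 0 /\ forall idx, idx < i.+1 -> ~~ valid s idx) \/
  exists b, [/\ b < i.+1, valid s b, imem s3 12 = addr b & forall idx, idx < i.+1 -> valid s idx ->
     (rmem s (addr b) <= rmem s (addr idx))%R]) ->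
     [/\ imem s3 11 = aTB + i * aW, ieval s3 (eW M c) = aW & Inv i.+1 (istore s3 11 (aTB + i.+1 * aW))].
    move=> k1 k2 k3 k4; have [_ _ ew] := ev s3 k2; split=> //; split=> //=.
    by move=> a a1 a2; rewrite (negbTE a1) k2.
  apply: run_if; rewrite beval_and vE.
  rewrite (_ : beval s2 (BNot _) = ~~ ((0 < imem s2 12) && (rmem s (imem s2 12) <= rmem s (addr i))%R));
    last by rewrite -!hr -h2.
  have lt1 idx : idx < i.+1 -> idx < i \/ idx = i.
    by rewrite ltnS leq_eqVlt => /orP[/eqP|]; [right|left].
  case: (boolP (valid s i)) => vi /=; last first.
    apply: run_skip; apply: fin => //; case: h3 => [[z h3]|[b [b1 b2 b3 b4]]]; [left|right].
      by split=> // idx /lt1[/h3|->].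
    exists b; split=> //; first exact: ltnW.
    by move=> idx /lt1[h|->]; [exact: b4|rewrite (negbTE vi)].
  case: ifP => hb.
    apply: run_istore; apply: fin => //=.
      by move=> a a1 a2; rewrite (negbTE a2) h1.
    right; exists i; split=> // idx /lt1[h|-> //] vx.
    case: h3 => [[z h3]|[b [b1 b2 b3 b4]]]; first by rewrite (negbTE (h3 idx h)) in vx.
    move: hb; rewrite b3 (leq_trans _ (A20 b)) //= -ltNge => /ltW hb.
    exact: le_trans hb (b4 idx h vx).
  apply: run_skip; apply: fin => //.
  move/negbT: hb; rewrite negbK => /andP[z1 z2]; right.
  case: h3 => [[z _]|[b [b1 b2 b3 b4]]]; first by rewrite z in z1.
  exists b; split=> //; first exact: ltnW.
  by move=> idx /lt1[h|->] vx; [exact: b4|rewrite -b3].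
- by move=> s2 [hr h1 _ h3]; split.
Qed.

Section Emit.
Variables (ps : nat -> seq 'I_n) (s0 : state R) (A : nat).
Hypothesis A_ge : aTB <= A.
Hypothesis st_ps : forall i, i < M -> imem s0 (A + ost M (i * c.*2)) = st (ps i).
Hypothesis nx_ps : forall i a (v : 'I_n) b, i < M -> ps i = a ++ v :: b ->
  imem s0 (A + (klen + v.+1)) = st b.
Hypothesis perm_ps : perm_eq (flatten (map ps (iota 0 M))) (enum 'I_n).

Definition cds (p : seq 'I_n) : seq nat := [seq (val v).+1 | v <- p].
Definition W i : seq nat := flatten [seq size (ps k) :: cds (ps k) | k <- iota 0 i].
Local Notation C0 := (aO + n + 1).

Lemma size_cds p : size (cds p) = size p.
Proof. exact: size_map. Qed.

Lemma flatS i : flatten (map ps (iota 0 i.+1)) = flatten (map ps (iota 0 i)) ++ ps i.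
Proof. by rewrite -addn1 iotaD map_cat flatten_cat /= cats0. Qed.

Lemma WS i : W i.+1 = W i ++ (size (ps i) :: cds (ps i)).
Proof. by rewrite /W -addn1 iotaD map_cat flatten_cat /= cats0. Qed.

Lemma size_W i : size (W i) = i + size (flatten (map ps (iota 0 i))).
Proof.
elim: i => // i IH; rewrite WS size_cat IH flatS size_cat [size (_ :: _)]/= size_cds.
by rewrite addnS addSn addnA.
Qed.

Lemma size_ps i : i <= M -> size (flatten (map ps (iota 0 i))) <= n.
Proof.
move=> iM; have E : size (flatten (map ps (iota 0 M))) = n.
  by rewrite (perm_size perm_ps) size_enum_ord.
apply: (@leq_trans (size (flatten (map ps (iota 0 M))))); last by rewrite E.
by rewrite -(subnKC iM) iotaD map_cat flatten_cat size_cat leq_addr.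
Qed.

Lemma ps_inj i j v : i < M -> j < M -> v \in ps i -> v \in ps j -> i = j.
Proof.
have ufl : uniq (flatten (map ps (iota 0 M))) by rewrite (perm_uniq perm_ps) enum_uniq.
by move=> hi hj a b; apply: (@flatten_slot _ _ ps (iota 0 M) i j v ufl); rewrite ?mem_iota.
Qed.

Definition emitted i s : Prop := [/\ forall a, aTB <= a -> imem s a = imem s0 a,
  imem s 0 = n /\ imem s 12 = A, imem s aO = M,
  forall k v, k < i -> v \in ps k -> imem s (aO + (val v).+1) = k &
  forall j, j < size (W i) -> imem s (C0 + j) = nth 0 (W i) j].

Lemma emitted_set i s v x : emitted i s -> 13 <= v < 20 -> emitted i (istore s v x).
Proof.
have [f1 f2 f3 f4 f5] := addr_facts I M c.
move=> [h1 [h2 h2'] h3 h4 h5] /andP[v1 v2].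
have N a : (a < 13) || (20 <= a) -> (a == v) = false by move: v1 v2; clear; lia.
split=> /= [a ha|||k u hk hu|j hj]; rewrite ?N //; first exact: h1.
all: try by move: f1 f2 f3 f4 f5 ; clear; lia.
- by move: ha f1 f2 f3 f4; clear; lia.
- exact: h4.
- exact: h5.
Qed.

Definition TT := 1 + (1 + (1 + ((n * (6 + 2) + 2) + 1))).

Lemma run_ptour i s : i < M -> emitted i s -> imem s 13 = C0 + size (W i) ->
  run (ptour M c i) TT s (fun s' => emitted i.+1 s' /\ imem s' 13 = C0 + size (W i.+1)).
Proof.
have [f1 f2 f3 f4 f5] := addr_facts I M c.
move=> iM e h13; pose L := size (W i); pose p := ps i.
have sp := size_ps iM.
have Lp : L + size p < n + M.
  by rewrite -/p -/L; move: iM sp; have := size_W i.+1; rewrite WS size_cat [size (_ :: _)]/= size_cds -/p -/L; clear; lia.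
have [D DE] : exists D, D = C0 + L by exists (C0 + L).
have h13' : imem s 13 = D by rewrite h13 DE.
have D1 : aO + n < D by rewrite DE; clear; lia.
have D2 : D + size p + 1 < aTB by rewrite DE; move: Lp f4; clear; lia.
have D3 : 20 <= aO by move: f1 f2 f3; clear; lia.
have D20 : 20 <= D by move: D1 D3; clear; lia.
(* [mid q s]: the visits [q] have been written after the header cell at [D]. *)
pose mid (q : seq 'I_n) s' := [/\ emitted i s', imem s' 13 = D, imem s' 14 = D + 1 + size q,
  imem s' D = size q /\ (forall v, v \in q -> imem s' (aO + (val v).+1) = i) &
  forall u, u < size q -> imem s' (D + 1 + u) = nth 0 (cds q) u].
have em_store s' a x : emitted i s' -> D <= a < aTB -> emitted i (istore s' a x).
  move=> [h1 [h2 h2'] h3 h4 h5] /andP[a1 a2]; split=> /= [b hb||||].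
  - by rewrite ifF ?h1 //; move: hb a2; clear; lia.
  - by rewrite !ifF //; move: a1 D1 D3; clear; lia.
  - by rewrite ifF //; move: a1 D1; clear; lia.
  - move=> k u hk hu; rewrite ifF ?(h4 k) //; move: a1 D1 (ltn_ord u); rewrite /=; clear; lia.
  - by move=> j hj; rewrite ifF ?h5 //; move: a1 hj; rewrite DE /L; clear; lia.
apply: run_seq; apply: run_istore; rewrite [ieval s (V 13)]/= h13'.
set s1 := istore _ _ _; have e1 : emitted i s1.
  by apply: em_store => //; move: D2; clear; lia.
have k13 : imem s1 13 = D by rewrite /= ifF ?h13' //; move: D1 D3; clear; lia.
have kD : imem s1 D = 0 by rewrite /= eqxx.
apply: run_seq; apply: run_istore; set s2 := istore _ _ _.
have s2E : s2 = istore s1 14 (D + 1) by rewrite -k13.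
have e2 : emitted i s2 by rewrite s2E; apply: emitted_set.
have e12 : imem s2 12 = A by have [_ []] := e2.
have vst : ieval s2 (at_ (V 12) (ost M (i * c.*2))) = st p.
  have [h1 _ _ _ _] := e2.
  transitivity (imem s2 (imem s2 12 + ost M (i * c.*2))); first by [].
  by rewrite e12 h1 ?st_ps //; apply: leq_trans A_ge (leq_addr _ _).
apply: run_seq; apply: run_istore; rewrite vst; set s3 := istore _ _ _.
have s3E : s3 = istore (istore s1 14 (D + 1)) 15 (st p) by rewrite /s3 s2E.
have midset q s' v x : 15 <= v < 20 -> mid q s' -> mid q (istore s' v x).
  move=> hv [b1 b2 b3 [b4 b4'] b5]; have /andP[v1 v2] := hv.
  have N a : (a < 15) || (20 <= a) -> imem (istore s' v x) a = imem s' a.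
    by move=> ha /=; rewrite ifF //; move: ha v1 v2; clear; lia.
  split.
  - by apply: emitted_set => //; rewrite v2 andbT (leq_trans _ v1).
  - by rewrite N.
  - by rewrite N.
  - split=> [|w hw]; first by rewrite N ?D20 ?orbT.
    by rewrite N ?b4' //; move: D3; clear; lia.
  - by move=> u hu; rewrite N ?b5 //; move: D20; clear; lia.
have mid0 : mid [::] s3.
  apply: midset => //; rewrite s2E; split.
  - exact: emitted_set.
  - exact: k13.
  - by rewrite /= addn0.
  - split=> //; have E : imem (istore s1 14 (D + 1)) D = (if D == 14 then D + 1 else imem s1 D) by [].
    by rewrite E kD ifF //; move: D20; clear; lia.
  - by [].
apply: run_seq.
apply: (run_loop (Inv := fun t s' => [/\ mid (take t p) s', imem s' 15 = st (drop t p) & imem s' 16 = t])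
  (a0 := 0) (m := n) (w := 1)) => //.
- by split; [rewrite take0; apply: midset|rewrite drop0|].
- by move=> t s4 [[[_ [h0 _] _ _ _] _ _ _ _] _ h16]; rewrite h16 /= h0 !muln1.
- move=> t s4 ht [mq h15 h16]; have [m1 m2 m3 [m4 m4'] m5] := mq.
  have szt : size (take t p) <= size p by rewrite size_take_min geq_minr.
  have fin s5 : mid (take t.+1 p) s5 -> imem s5 15 = st (drop t.+1 p) -> imem s5 16 = t ->
      [/\ imem s5 16 = 0 + t * 1, ieval s5 (INat 1) = 1 & [/\ mid (take t.+1 p) (istore s5 16 (0 + t.+1 * 1)),
        imem (istore s5 16 (0 + t.+1 * 1)) 15 = st (drop t.+1 p) &
        imem (istore s5 16 (0 + t.+1 * 1)) 16 = t.+1]].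
    by move=> b1 b6 b7; rewrite !muln1 !add0n; split=> //; split=> //; exact: midset.
  apply: run_if; rewrite (_ : beval s4 _ = (0 < st (drop t p))); last by rewrite -h15.
  case: (ltnP t (size p)) => tp; last first.
    have E1 : take t.+1 p = take t p by rewrite (take_oversize tp) take_oversize // leqW.
    have E2 : drop t.+1 p = drop t p by rewrite (drop_oversize tp) drop_oversize // leqW.
    have s0' : st (drop t p) = 0 by rewrite drop_oversize.
    rewrite s0' ltnn; apply: (@run_weak _ _ 1 5 _ _ _ _ _ (fun _ h => h)) => //; apply: run_skip.
    by apply: fin; rewrite ?E1 ?E2.
  have [v pE] : exists v, p = take t p ++ v :: drop t.+1 p.
    case E : (drop t p) => [|v b]; first by have := size_drop t p; rewrite E /=; move: tp; clear; lia.
    exists v; have := drop_drop p 1 t; rewrite E add1n /= drop0 => <-; by rewrite -E cat_take_drop.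
  have szq : size (take t p) = t by rewrite size_takel // ltnW.
  have dE : drop t p = v :: drop t.+1 p by rewrite {1}pE drop_size_cat.
  have tE : take t.+1 p = rcons (take t p) v.
    by rewrite {1}pE -cat_rcons take_size_cat // size_rcons szq.
  have v15 : imem s4 15 = v.+1 by rewrite h15 dE.
  rewrite -h15 v15 ltn0Sn.
  apply: (@run_weak _ _ (1 + (1 + (1 + (1 + 1)))) 5 _ _ _ _ _ (fun _ h => h)) => //.
  have vn := ltn_ord v.
  have n14 : D + 1 + t < aTB by move: D2 tp; clear; lia.
  apply: run_seq; apply: run_istore; rewrite [ieval s4 (V 14)]/= [ieval s4 (V 15)]/= m3 v15 szq.
  set t1 := istore _ _ _.
  have g1 : emitted i t1 by apply: em_store => //; move: n14; clear; lia.
  have K a : a < D + 1 + t -> imem t1 a = imem s4 a.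
    by move=> ha; rewrite /= ifF //; move: ha; clear; lia.
  have t13 : imem t1 13 = D by rewrite K //; move: D20; clear; lia.
  have tD : imem t1 D = t by rewrite K ?m4 //; clear; lia.
  apply: run_seq; apply: run_istore.
  have -> : ieval t1 (V 13) = D by exact: t13.
  have -> : ieval t1 (IAdd (ILoad (V 13)) (INat 1)) = t.+1.
    by transitivity (imem t1 (imem t1 13) + 1); [|rewrite t13 tD addn1].
  set t2 := istore _ _ _; have g2 : emitted i t2 by apply: em_store => //; move: D2; clear; lia.
  have K2 a : a != D -> imem t2 a = imem t1 a by move=> /negbTE /= ->.
  have low a : a < 20 -> imem t2 a = imem s4 a.
    by move=> ha; rewrite K2 ?K //; move: ha D20; clear; lia.
  have [_ [t20 _] _ _ _] := g2; have [_ _ _ _ [eo _]] := ev_addr M c t20.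
  apply: run_seq; apply: run_istore.
  have -> : ieval t2 (IAdd (eO M c) (V 15)) = aO + v.+1.
    by transitivity (ieval t2 (eO M c) + imem t2 15); [|rewrite eo low // v15].
  set t3 := istore _ _ _.
  have K3 a : a != aO + v.+1 -> imem t3 a = imem t2 a by move=> /negbTE /= ->.
  have g3 : emitted i t3.
    have [h1 [h2 h2'] h3 h4 h5] := g2; split=> [a ha||||j hj].
    - by rewrite K3 ?h1 //; move: ha vn f4; clear; lia.
    - by rewrite !K3 //; move: D3; clear; lia.
    - by rewrite K3 //; clear; lia.
    (* A terminal belongs to one tour only, so what was written for earlier tours is not
       overwritten. *)
    - move=> k u hk hu; case: (eqVneq u v) => [E|ne].
        have vi : v \in ps i by rewrite -/p pE mem_cat mem_head orbT.
        by rewrite E in hu; move: (hk); rewrite (ps_inj (ltn_trans hk iM) iM hu vi) ltnn.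
      by rewrite K3 ?(h4 k) //; move: ne; rewrite -val_eqE /=; clear; lia.
    - by rewrite K3 ?h5 //; move: vn; clear; lia.
  apply: run_seq; apply: run_istore; apply: run_istore.
  rewrite [ieval _ (INat 14)]/= [ieval _ (INat 15)]/=; set x14 := ieval t3 (IAdd _ _); set t4 := istore t3 14 x14.
  have l3 a : a < 20 -> imem t3 a = imem s4 a.
    by move=> ha; rewrite K3 ?low //; move: ha D3; clear; lia.
  have x14E : x14 = D + 1 + t.+1.
    by rewrite addnS -[(D + 1 + t).+1]addn1 -szq -m3 -l3.
  have -> : ieval t4 (ILoad (IAdd (V 12) (IAdd (INat klen) (V 15)))) = st (drop t.+1 p).
    transitivity (imem t4 (imem t4 12 + (klen + imem t4 15))); first by [].
    have g4 : emitted i t4 := emitted_set x14 g3 (isT : 13 <= 14 < 20).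
    have [h1 [_ h12] _ _ _] := g4; rewrite h12.
    have -> : imem t4 15 = v.+1 by rewrite -v15 -l3.
    by rewrite h1 ?(nx_ps iM pE) //; apply: leq_trans A_ge (leq_addr _ _).
  have hi a : 20 <= a -> imem (istore t4 15 (st (drop t.+1 p))) a = imem t3 a.
    move=> ha; transitivity (if a == 15 then st (drop t.+1 p) else if a == 14 then x14 else imem t3 a).
      by [].
    by rewrite !ifF //; move: ha; clear; lia.
  apply: fin.
  + rewrite tE; split.
    * by apply: emitted_set => //; apply: emitted_set.
    * exact: etrans (l3 13 isT) m2.
    * by transitivity x14; [|rewrite x14E size_rcons szq].
    * split; first by rewrite (hi _ D20) K3 ?size_rcons ?szq; [rewrite /= eqxx|move: vn D1; clear; lia].
      move=> u; rewrite mem_rcons inE => /orP[/eqP ->|hu]; rewrite hi; try by move: D3; clear; lia.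
        by rewrite /= eqxx.
      rewrite /=; case: eqP => // /eqP ne; rewrite ifF; last by move: D1 (ltn_ord u); rewrite /=; clear; lia.
      by rewrite ifF ?m4' //; move: D1 (ltn_ord u); rewrite /=; clear; lia.
    * move=> u; rewrite size_rcons szq ltnS /cds map_rcons nth_rcons size_map szq => hu.
      rewrite hi; last by move: D20; clear; lia.
      rewrite K3; last by move: vn D1; clear; lia.
      rewrite K2; last by clear; lia.
      rewrite /= eqn_add2l; case: (ltngtP u t) hu => [ut _|//|_ _]; last by [].
      by rewrite m5 // szq.
  + by [].
  + exact: etrans (l3 16 isT) h16.
- move=> s4 [[m1 m2 m3 [m4 m4'] m5] h15 h16].
  have szp : size p <= n.
    by move: sp; rewrite flatS size_cat -/p; clear; lia.
  rewrite take_oversize // in m3 m4 m4' m5.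
  apply: run_istore; rewrite [ieval _ _]/= [ieval _ (V 14)]/= m3.
  have sW : size (W i.+1) = L + (size p).+1 by rewrite WS size_cat [size (_ :: _)]/= size_cds.
  split; last by rewrite sW; transitivity (D + 1 + size p); [|rewrite DE; clear; lia].
  have := emitted_set (v := 13) (D + 1 + size p) m1 isT; set s5 := istore _ _ _ => e5.
  have hi a : 20 <= a -> imem s5 a = imem s4 a.
    by move=> ha; rewrite /= ifF //; move: ha; clear; lia.
  have [h1 h2 h3 h4 h5] := e5; split=> //.
    move=> k u; rewrite ltnS leq_eqVlt => /orP[/eqP -> hu|]; last exact: h4.
    by rewrite hi ?m4' //; move: D3; clear; lia.
  move=> j; rewrite sW WS nth_cat -/L; case: (ltnP j L) => [hj _|hj jl]; first exact: h5.
  have hj' : C0 + j = D + (j - L) by rewrite DE; move: hj; clear; lia.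
  rewrite hi hj'; last by move: D1 D3; clear; lia.
  case: (j - L) (subnKC hj) => [|u] E; first by rewrite addn0 m4.
  by rewrite -[u.+1]add1n addnA m5 //; move: jl; rewrite -E; clear; lia.
Qed.

Definition TOUT := 1 + (1 + ((M * TT + 1) + (((2 * n + M + 1) * (1 + 2) + 2) + ((19 + 1) + 1)))).

Lemma run_sets (l : seq nat) s : imem s 0 = n -> all (fun j => 0 < j < 20) l ->
  run (seqs [seq set j (ILoad (IAdd (eO M c) (INat j))) | j <- l]) (size l + 1) s
  (fun s' => (forall a, a \notin l -> imem s' a = imem s a) /\
             forall j, j \in l -> imem s' j = imem s (aO + j)).
Proof.
have [f1 f2 f3 f4 f5] := addr_facts I M c.
elim: l s => [|j l IH] s h0; first by move=> _; apply: run_skip.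
rewrite [all _ _]/= => /andP[/andP[j0 j1] al].
rewrite [seqs _]/= [size _]/= addSn -add1n; apply: run_seq; apply: run_istore.
have -> : ieval s (ILoad (IAdd (eO M c) (INat j))) = imem s (aO + j).
  by have [_ _ _ _ [<- _]] := ev_addr M c h0.
rewrite [ieval _ _]/=; set s1 := istore _ _ _.
have h1 : imem s1 0 = n by rewrite /= ifF //; move: j0; clear; lia.
have K a : a != j -> imem s1 a = imem s a by move=> /negbTE /= ->.
apply: run_weak (IH s1 h1 al) (leqnn _) _ => s2 [g1 g2]; split=> [a|k].
  by rewrite inE negb_or => /andP[a1 a2]; rewrite g1 // K.
have hiE b : imem s1 (aO + b) = imem s (aO + b) by rewrite K //; move: j1 f1 f2 f3; clear; lia.
rewrite inE; case: (boolP (k \in l)) => kl; first by rewrite g2 // hiE.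
by rewrite orbF => /eqP E; subst k; rewrite g1 // /s1 /= eqxx.
Qed.

Lemma run_pout (asg : 'I_n -> 'I_M) : (forall v, v \in ps (asg v)) ->
  imem s0 0 = n -> imem s0 12 = A ->
  run (pout M c) TOUT s0 (fun s' => outputs s' (Solution (fun i : 'I_M => map Some (ps i)) asg)).
Proof.
have [f1 f2 f3 f4 f5] := addr_facts I M c.
move=> hasg h0 h12; apply: run_seq; apply: run_istore; rewrite [ieval _ (INat 13)]/=.
have [_ _ _ _ [eo _]] := ev_addr M c h0.
have -> : ieval s0 (IAdd (IAdd (eO M c) eN) (INat 1)) = C0 by rewrite -eo /= h0.
set s1 := istore _ _ _; have h1 : imem s1 0 = n by [].
have [_ _ _ _ [eo1 _]] := ev_addr M c h1.
apply: run_seq; apply: run_istore; rewrite eo1 [ieval _ _]/=; set s2 := istore _ _ _.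
have D3 : 20 <= aO by move: f1 f2 f3; clear; lia.
have e2 : emitted 0 s2.
  split=> //= [a ha||]; rewrite ?eqxx // !ifF //; move: D3 f4; try move: ha; clear; lia.
have v13 : imem s2 13 = C0 + size (W 0) by rewrite /= addn0 ifF //; move: D3; clear; lia.
have tours m i s : i + m = M -> emitted i s -> imem s 13 = C0 + size (W i) ->
    run (seqs [seq ptour M c i | i <- iota i m]) (m * TT + 1) s (emitted M).
  elim: m i s => [|m IH] i s im e h.
    by apply: run_skip; rewrite -im addn0.
  rewrite [seqs _]/= mulSn -addnA; apply: run_seq.
  have iM : i < M by rewrite -im addnS ltnS leq_addr.
  apply: run_weak (run_ptour iM e h) (leqnn _) _ => s' [e' h'].
  by apply: IH e' h'; rewrite addSn -addnS.
apply: run_seq; apply: run_weak (tours M 0 s2 _ e2 v13) (leqnn _) _ => // s3 e3.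
have [_ [h3 _] o3 a3 w3] := e3.
pose out j := imem s3 (aO + j).
(* The target of the copy ends below the output area, so the source stays intact. *)
have big : 2 * n + M + 21 <= aO by move: f1 f2 f3 f5; rewrite /keylen; clear; lia.
pose Inv i s' := [/\ imem s' 0 = n, forall a, aO <= a -> imem s' a = imem s3 a, imem s' 1 = 20 + i &
   forall j, 20 <= j < 20 + i -> i <= 2 * n + M + 1 -> imem s' j = out j].
apply: run_seq; apply: (run_loop (Inv := Inv) (a0 := 20) (m := 2 * n + M + 1) (w := 1)) => //.
- split=> //= [a ha|j]; first by rewrite ifF //; move: ha D3; clear; lia.
  by rewrite addn0 => /andP[ja]; rewrite ltnNge ja.
- by move=> i s4 [k0 _ k1 _]; rewrite k1 /= k0 !muln1; split=> //; clear; lia.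
- move=> i s4 hi [k0 k1 k2 k3]; have [_ _ _ _ [eo4 _]] := ev_addr M c k0.
  apply: run_istore; rewrite [ieval s4 (V 1)]/= k2.
  have -> : ieval s4 (ILoad (IAdd (eO M c) (V 1))) = out (20 + i).
    transitivity (imem s4 (ieval s4 (eO M c) + imem s4 1)); first by [].
    by rewrite eo4 k2 k1 ?leq_addr.
  rewrite !muln1; split; [exact: k2|by []|].
  split=> //=.
  + by move=> a ha; rewrite !ifF ?k1 //; move: ha hi big; clear; lia.
  + move=> j /andP[j1 j2] _; rewrite ifF; last by move: j1; clear; lia.
    case: eqP => [->//|/eqP ne]; apply: k3; last exact: ltnW.
    by rewrite j1 /=; move: j2 ne; clear; lia.
move=> s4 [k0 k1 _ k3].
have al : all (fun j => 0 < j < 20) (iota 1 19) by [].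
have := run_sets k0 al; rewrite size_iota => RS.
apply: run_seq; apply: run_weak RS (leqnn _) _ => s5 [g1 g2].
have k5 : imem s5 0 = n by rewrite g1.
have [_ _ _ _ [eo5 _]] := ev_addr M c k5.
apply: run_istore; rewrite [ieval _ (INat 0)]/=; set x := ieval _ _.
have xE : x = out 0.
  transitivity (imem s5 (ieval s5 (eO M c) + 0)); first by [].
  rewrite eo5 g1 ?k1 ?leq_addr // mem_iota; move: D3; clear; lia.
set s6 := istore _ _ _.
have O j : j < 2 * n + M + 1 -> imem s6 j = out j.
  move=> hj; rewrite /s6 /= xE; case: eqP => [->//|/eqP j0].
  case: (ltnP j 20) => j20.
    rewrite g2 ?k1 ?leq_addr // mem_iota; move: j0 j20; clear; lia.
  rewrite g1; last by rewrite mem_iota; move: j20; clear; lia.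
  by apply: k3 => //; rewrite j20 /=; move: hj; clear; lia.
set S := Solution _ _.
have scE : solution_code S = M :: [seq val (asg v) | v <- enum 'I_n] ++ W M.
  rewrite /solution_code /W; congr (_ :: _ ++ flatten _).
  rewrite -val_enum_ord -map_comp; apply: eq_map => k /=.
  by rewrite size_map -map_comp.
have szW : size (W M) = M + n by rewrite size_W (perm_size perm_ps) size_enum_ord.
rewrite /outputs scE; apply: (@eq_from_nth _ 0); rewrite size_mkseq // => j hj.
have hj' : j < 2 * n + M + 1.
  by move: hj; rewrite /= size_cat size_map size_enum_ord szW; clear; lia.
rewrite nth_mkseq // (O _ hj') {hj}.
case: j hj' => [|j] hj; first by rewrite /out addn0.
rewrite /= nth_cat size_map size_enum_ord; case: ltnP => hn.
  have v0 := Ordinal hn; rewrite (nth_map (Ordinal hn)) ?size_enum_ord //.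
  have -> : nth (Ordinal hn) (enum 'I_n) j = Ordinal hn by apply/val_inj; rewrite /= nth_enum_ord.
  by rewrite /out (a3 (asg (Ordinal hn)) (Ordinal hn)).
rewrite /out -w3; last by rewrite szW; move: hj hn; clear; lia.
by congr (imem s3 _); move: hn; clear; lia.
Qed.

End Emit.
End OutputCorrect.

(** * Derivable families of the whole plane as feasible solutions *)

Section Sound.
Variables (R : realType) (I : instance R) (M c : nat).
Local Notation n := (nterm I).
Local Notation slots := (nslots M c).
Local Notation klen := (keylen M c).
Local Notation DerI := (DerI M c).
Local Open Scope nat_scope.
Implicit Types (P : pieces I) (rho : region).

Lemma big_stride (T : Type) (idx : T) (op : Monoid.com_law idx) m d (G : nat -> T) : 0 < d ->
  (forall k, k < m * d -> k %% d != 0 -> G k = idx) ->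
  \big[op/idx]_(k < m * d) G k = \big[op/idx]_(i < m) G (i * d).
Proof.
move=> d0; elim: m => [|m IH] H; first by rewrite mul0n !big_ord0.
rewrite big_ord_recr /= -IH; last first.
  by move=> k hk; apply: H; apply: leq_trans hk _; rewrite leq_mul2r leqnSn orbT.
rewrite -!(big_mkord predT G) mulSnr (@big_cat_nat _ _ _ (m * d)) ?leq_addr //; congr (op _ _).
transitivity (\big[op/idx]_(0 + m * d <= k < m * d + d) G k); first by rewrite add0n.
rewrite big_addn addKn big_mkord (bigD1 (Ordinal d0)) //= add0n big1 ?Monoid.mulm1 // => i ne.
have i0 : (i : nat) != 0 by move: ne; rewrite -val_eqE.
apply: H; first by rewrite mulSnr addnC ltn_add2l.
by rewrite addnC modnMDl modn_small.
Qed.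

(** Orderedness is carried along because the count needs it in [DerA]: the shared threshold then
    separates the two parts inside the outer thresholds, and their indicator functions add up to
    that of the glued region. *)
Lemma Der_cnt h rho P : DerI h rho P -> ordered I rho /\
  forall v : 'I_n, \sum_(k < slots) count_mem v (P k) = inreg rho v.
Proof.
elim => {h rho P}.
- by move=> rho _ oo nr; split=> // v; rewrite (negbTE (nr v)) big1.
- move=> rho v k _ vr hk; split=> [|u]; first by apply: (inreg_ordered (u := v)); rewrite vr.
  rewrite (bigD1 (Ordinal hk)) //= big1 => [|j]; first by rewrite /single eqxx /= vr eq_sym !addn0.
  by rewrite -val_eqE /= /single => /negbTE ->.
- by [].
- move=> h d r1 r2 P1 P2 _ [z1 c1] _ [z2 c2] /andP[/eqP a1 /eqP a2] _ _.
  split=> [e v|v].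
    rewrite /glue; case: eqP => [->|_]; last exact: z1.
    by move=> /z1; rewrite a2; apply: z2.
  have -> : \sum_(k < slots) count_mem v (madd P1 P2 k) = inreg r1 v + inreg r2 v.
    by rewrite -c1 -c2 -big_split /=; apply: eq_bigr => k _; rewrite /madd count_cat.
  have := z1 d v; have := z2 d v; rewrite /inreg /glue.
  case: d a1 a2 => /= a1 a2; rewrite -a2 -a1;
    case: (ltc _ v (r1 _).1); case: (ltc _ v (r1 _).1); case: (ltc _ v (r1 _).2); case: (ltc _ v (r1 _).2);
    case: (ltc _ v (r2 _).2) => //= h1 h2; by [have := h1 isT|have := h2 isT].
- move=> h rho P k1 k2 _ [oo cP] h1 h2 ne _ _; split=> // v; rewrite -cP.
  have [rest [-> ->]] := big_merge addn predT (fun p : seq 'I_n => count_mem v p) P h1 h2 ne.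
  by rewrite /= count_cat !addnA addn0.
Qed.

Lemma nx_notin (p : seq 'I_n) (v : 'I_n) : v \notin p -> nx p v.+1 = 0.
Proof.
elim: p => //= u p IH; rewrite inE negb_or => /andP[ne h]; rewrite IH // addn0.
by rewrite eqSS val_eqE (negbTE ne).
Qed.

Lemma nx_split (a b : seq 'I_n) (v : 'I_n) : v \notin a -> v \notin b -> nx (a ++ v :: b) v.+1 = st b.
Proof.
move=> + hb; elim: a => [_|u a IH] /=; first by rewrite eqxx mul1n nx_notin // addn0.
rewrite inE negb_or => /andP[ne h]; rewrite IH //.
by rewrite eqSS val_eqE (negbTE ne).
Qed.

(** [v] occurs once in the whole family, so a single term of the sum defining [nxt] survives. *)
Lemma nxt_split P k0 a (v : 'I_n) b : k0 < slots -> \sum_(k < slots) count_mem v (P k) = 1 ->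
  P k0 = a ++ v :: b -> nxt M c P v.+1 = st b.
Proof.
move=> hk C E; move: C; rewrite (bigD1 (Ordinal hk)) //=.
set S := \sum_(k < slots | _) _ => C.
have C' : count_mem v a + (count_mem v b).+1 + S = 1 by rewrite -C E count_cat /= eqxx add1n.
have [a0 [b0 r0]] : count_mem v a = 0 /\ (count_mem v b = 0 /\ S = 0).
  by move: C'; move: (count_mem v a) (count_mem v b) (S) => x y z; clear; lia.
rewrite /nxt (bigD1 (Ordinal hk)) //= E nx_split; last first.
- by rewrite -has_pred1 has_count b0.
- by rewrite -has_pred1 has_count a0.
rewrite big1 ?addn0 // => k nk; apply: nx_notin; rewrite -has_pred1 has_count.
by move/eqP: r0; rewrite /S sum_nat_eq0 => /forallP /(_ k); rewrite nk /= => /eqP ->.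
Qed.

Lemma qv_ge (v : 'I_n) : ((capn I)%:R * demand v <= (qv v)%:R :> R)%R.
Proof.
have hh : seq.has (fun k => ((capn I)%:R * demand v <= k%:R :> R)%R) (iota 0 (capn I).+1).
  apply/hasP; exists (capn I); first by rewrite mem_iota /= add0n ltnSn.
  by rewrite -[X in (_ <= X)%R]mulr1 ler_wpM2l //; case/andP: (demand_bounds v).
have h1 : qv v <= capn I by rewrite -ltnS -[X in _ < X](size_iota 0) -has_find.
by have := nth_find 0 hh; rewrite nth_iota.
Qed.

Section Whole.
Hypothesis c_gt0 : 0 < c.
Variables (h : nat) (P : pieces I).
Hypothesis D : DerI h (whole I) P.
Hypothesis P0 : forall k, k < slots -> k %% c.*2 != 0 -> P k = [::].
Local Notation ps := (fun i => P (i * c.*2)).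

Lemma cnt1 v : \sum_(k < slots) count_mem v (P k) = 1.
Proof.
by have [_ ->] := Der_cnt D; rewrite /inreg /whole /ltc /= ltnSn.
Qed.

Lemma cnt_ps v : \sum_(i < M) count_mem v (ps i) = 1.
Proof.
rewrite -(cnt1 v) /nslots (@big_stride _ _ _ M c.*2 (fun k => count_mem v (P k))) ?double_gt0 //.
by move=> k hk hm; rewrite P0.
Qed.

Lemma perm_ps : perm_eq (flatten (map ps (iota 0 M))) (enum 'I_n).
Proof.
apply/allP => v _ /=; apply/eqP; transitivity 1; last by rewrite count_uniq_mem ?enum_uniq // mem_enum.
rewrite -(cnt_ps v) -(big_mkord predT (fun i => count_mem v (ps i))) /index_iota subn0.
by elim: (iota 0 M) => [|i l IH] /=; rewrite ?big_nil // big_cons count_cat IH.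
Qed.

Lemma exists_ps v : exists i : 'I_M, v \in ps i.
Proof.
have : v \in flatten (map ps (iota 0 M)) by rewrite (perm_mem perm_ps) mem_enum.
case/flattenP => _ /mapP[i + ->]; rewrite mem_iota /= => iM vi.
by exists (Ordinal iM).
Qed.

Lemma slot_lt i : i < M -> i * c.*2 < slots.
Proof. by move=> iM; rewrite /nslots ltn_mul2r double_gt0 c_gt0. Qed.

Lemma cost_ps (asg : 'I_n -> 'I_M) :
  cost (Solution (fun i : 'I_M => map Some (ps i)) asg) = costP M c P.
Proof.
rewrite /cost /costP /nslots (@big_stride _ _ _ M c.*2 (fun k => tc (P k))) ?double_gt0 //.
by move=> k hk hm; rewrite P0 // tc_nil.
Qed.

(** Rounding never lowers a demand, so a rounded load of at most [2 n] gives a true load of at most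
    1 after division by [2 n]. *)
Lemma feasible_ps (asg : 'I_n -> 'I_M) : (forall v, v \in ps (asg v)) ->
  feasible (Solution (fun i : 'I_M => map Some (ps i)) asg).
Proof.
move=> ha; split=> [v|k]; first by apply: map_f; exact: ha.
have k0 := slot_lt (ltn_ord k).
have upk : uniq (ps k).
  apply: count_mem_uniq => v; have := cnt_ps v; rewrite (bigD1 k) //= -has_pred1 has_count.
  by case: (count _ _) => [|[|m]].
have asgE v : (asg v == k) = (v \in ps k).
  apply/eqP/idP => [<-//|vk]; apply/val_inj.
  exact: (ps_inj perm_ps (ltn_ord _) (ltn_ord _) (ha v) vk).
rewrite /= (eq_bigl (fun v => v \in ps k)) // -big_uniq //.
have ld : \sum_(v <- ps k) qv v <= capn I.
  have [_ /(_ k (ltn_ord k))] := Der_bounds D; apply: leq_trans.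
  rewrite /load (bigD1 (Ordinal k0)) ?leq_addr //=.
  by rewrite /stour mulnK ?double_gt0.
case: (posnP n) => [n0|n0].
  rewrite big1 ?ler01 // => v _; by have := ltn_ord v; rewrite {2}n0.
have cp : (0 < (capn I)%:R :> R)%R by rewrite ltr0n /capn muln_gt0.
rewrite -(ler_pM2l cp) mulr1 mulr_sumr; apply: (@le_trans _ _ (\sum_(v <- ps k) (qv v)%:R)%R).
  by apply: ler_sum => v _; exact: qv_ge.
by rewrite -natr_sum ler_nat.
Qed.

End Whole.
End Sound.

(** * Correctness and running time of the whole program *)

Section Main.
Variables (R : realType) (M c : nat).
Hypothesis c_gt0 : (0 < c)%N.
Local Open Scope nat_scope.
Local Notation slots := (nslots M c).
Local Notation klen := (keylen M c).

Definition TMAIN (I : instance R) : nat :=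
  TINI I M c + (TLV I (TLV I (TLV I (TLV I (TL I M c)))) +
   ((nrounds I M c * (TR I M c + 2) + 2) + (TBE I M c + (TOUT I M).+1))).

Lemma eq_validf (I : instance R) f g : (forall o, o < klen -> f o = g o) ->
  validf I M c f = validf I M c g.
Proof.
move=> H; have H5 o : o < 5 -> f o = g o.
  by move=> ho; apply: H; apply: leq_trans ho _; rewrite /keylen; clear; lia.
rewrite /validf !H5 //; congr andb; apply: eq_in_all => k; rewrite mem_filter mem_iota => /and3P[_ _ hk].
by rewrite H // /ost /keylen; move: hk; clear; lia.
Qed.

(** The selected entry stands for a derivable family of the whole plane, hence for a feasible
    solution. It costs no more than the entry under the key of [P], which after all rounds costs no
    more than [P]. *)
Lemma run_pmain (I : instance R) : run (pmain M c) (TMAIN I) (input_state I) (fun s' =>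
  forall (P : pieces I) h, DerI M c h (whole I) P -> h <= nrounds I M c ->
  (forall k, k < slots -> k %% c.*2 != 0 -> P k = [::]) ->
  exists S : solution (nterm I), [/\ outputs s' S, feasible S & (cost S <= costP M c P)%R]).
Proof.
have [f1 f2 f3 f4 f5] := addr_facts I M c.
apply: run_seq; apply: run_weak (run_pinit I M c) (leqnn _) _ => s1 g1.
apply: run_seq; apply: run_weak (run_pleaves g1) (leqnn _) _ => s2 [r2 h2].
apply: run_seq; apply: run_weak (run_prounds (rel_GI r2) h2) (leqnn _) _ => s3 [r3 h3].
have g3 := rel_GI r3.
apply: run_seq; apply: run_weak (run_pbest g3) (leqnn _) _ => s4 [q1 q2 q3].
have big idx : 20 < addr I M c idx.
  by have [] := addr_ge I M c idx; move: f1 f2; clear; lia.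
have vE idx rho (P : pieces I) : vblk M c s3 (addr I M c idx) rho P -> valid I M c s3 idx = validf I M c (blk M c rho P).
  by move=> [v1 _]; apply: eq_validf => o ho; apply: v1; move: ho f5; clear; lia.
have good (P : pieces I) h : DerI M c h (whole I) P -> h <= nrounds I M c ->
    (forall k, k < slots -> k %% c.*2 != 0 -> P k = [::]) ->
    [/\ code M c (whole I) P < aS I M c, valid I M c s3 (code M c (whole I) P) &
      (rmem s3 (addr I M c (code M c (whole I) P)) <= costP M c P)%R].
  move=> D hh P0; have D' := Der_le hh D; have [fl le] := h3 _ _ D'; have lt := code_lt D.
  split=> //; have [h' [rho' [P' [D2 v2 E]]]] := GI_tab g3 lt fl.
  rewrite (vE _ _ _ v2) (eq_validf I (code_key D2 D E)) /validf.
  have -> : all (fun k => blk M c (whole I) P (ost M k) == 0) [seq k <- iota 0 slots | k %% c.*2 != 0].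
    apply/allP => k; rewrite mem_filter mem_iota => /and3P[hm _ hk].
    by rewrite blk_st // P0.
  by rewrite /blk /= addn1 !eqxx.
apply: run_if; rewrite (_ : beval s4 _ = (0 < imem s4 12)) //.
case: q3 => [[z nv]|[b [b1 b2 b3 b4]]].
  rewrite z /=; apply: run_weak (run_skip (Q := eq s4) (erefl s4)) _ _.
    by rewrite /TOUT; clear; lia.
  move=> s' _ P h D hh P0; have [lt vv _] := good P h D hh P0.
  by rewrite (negbTE (nv _ lt)) in vv.
rewrite b3 (leq_trans _ (big b)) //.
have fb : flagged I M c s3 b.
  by rewrite /flagged -lt0n; move: b2 => /andP[/and5P[+ _ _ _ _] _]; rewrite addn0.
have [h' [rho [P [D vb E]]]] := GI_tab g3 b1 fb.
move: b2; rewrite (vE _ _ _ vb) => /andP[/and5P[_ w1 w2 w3 w4] /allP wk].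
have rE : rho = whole I.
  have E1 : (rho true).1 = 0 := eqP w1.
  have E2 : (rho true).2 = nterm I + 1 := eqP w2.
  have E3 : (rho false).1 = 0 := eqP w3.
  have E4 : (rho false).2 = nterm I + 1 := eqP w4.
  apply/funext => -[]; rewrite /whole.
    by rewrite [rho true]surjective_pairing E1 E2 addn1.
  by rewrite [rho false]surjective_pairing E3 E4 addn1.
subst rho.
have P0 k : k < slots -> k %% c.*2 != 0 -> P k = [::].
  move=> hk hm; apply/eqP; rewrite -st0 -(blk_st (whole I) P hk); apply: wk.
  by rewrite mem_filter hm mem_iota.
have [v1 vc] := vb.
have hi a : imem s4 (addr I M c b + a) = imem s3 (addr I M c b + a).
  by apply: q2; move: (big b); clear; lia.
have st4 i : i < M -> imem s4 (addr I M c b + ost M (i * c.*2)) = st (P (i * c.*2)).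
  move=> iM; have hk := slot_lt c_gt0 iM.
  rewrite hi v1 ?blk_st //; move: hk f5; rewrite /ost /keylen; clear; lia.
have nx4 i a (v : 'I_(nterm I)) d : i < M -> P (i * c.*2) = a ++ v :: d ->
    imem s4 (addr I M c b + (klen + v.+1)) = st d.
  move=> iM Ep; have vn := ltn_ord v.
  rewrite hi v1; [|by rewrite /aW; move: vn; clear; lia|by clear; lia].
  by rewrite blk_nxt (nxt_split (slot_lt c_gt0 iM) (cnt1 D v) Ep).
have Age : aTB I M c <= addr I M c b by rewrite /addr leq_addr.
have [asg hasg] := choice (exists_ps c_gt0 D P0).
have n4 : imem s4 0 = nterm I by rewrite q2 // (GI_n g3).
have := run_pout Age st4 nx4 (perm_ps c_gt0 D P0) hasg n4 b3.
move=> RO; apply: run_weak RO (leqnn _) _ => s5 out Q k DQ hk Q0.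
exists (Solution (fun i : 'I_M => map Some (P (i * c.*2))) asg); split; [exact: out|exact: (feasible_ps c_gt0 D P0 hasg)|].
rewrite (cost_ps c_gt0 P0) -vc; have [lt vv le] := good Q k DQ hk Q0.
exact: le_trans (b4 _ lt vv) le.
Qed.

Definition isP (f : instance R -> nat) : Prop := exists p : {poly nat}, forall I, f I <= p.[nterm I]%R.

Lemma isP_c k : isP (fun=> k).
Proof. by exists k%:P%R => I; rewrite hornerC. Qed.

Lemma isP_n : isP (@nterm R).
Proof. by exists 'X%R => I; rewrite hornerX. Qed.

Lemma isP_D f g : isP f -> isP g -> isP (fun I => f I + g I).
Proof. by move=> [p hp] [q hq]; exists (p + q)%R => I; rewrite hornerD; exact: leq_add. Qed.

Lemma isP_M f g : isP f -> isP g -> isP (fun I => f I * g I).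
Proof. by move=> [p hp] [q hq]; exists (p * q)%R => I; rewrite hornerM; exact: leq_mul. Qed.

Lemma isP_S f : isP f -> isP (fun I => (f I).+1).
Proof.
by move=> /isP_D /(_ (isP_c 1)) [p hp]; exists p => I; rewrite -addn1; exact: hp.
Qed.

Lemma isP_X f k : isP f -> isP (fun I => f I ^ k).
Proof.
move=> hf; elim: k => [|k IH]; first exact: isP_c.
by have [p hp] := isP_M hf IH; exists p => I; rewrite expnS; exact: hp.
Qed.

(** [M] and [c] are constants, and the only exponent is [klen], which depends on them alone. *)
Lemma isP_TMAIN : isP TMAIN.
Proof.
rewrite /TMAIN /TINI /TD /TLV /TL /TL0 /TL1 /nrounds /TR /TMS /TAS /TM /TA /TI /TK /TBE /TOUT /TT /aS /aB /aW.
repeat first [exact: isP_c | exact: isP_n |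
  lazymatch goal with
  | |- isP (fun I => @?f I + @?g I) => apply: (@isP_D f g)
  | |- isP (fun I => @?f I * @?g I) => apply: (@isP_M f g)
  | |- isP (fun I => (@?f I).+1) => apply: (@isP_S f)
  | |- isP (fun I => @?f I ^ ?k) => apply: (@isP_X f k)
  end].
Qed.

End Main.

(** * Comparison with a feasible solution of few tours *)

Section Opt.
Variable R : realType.

Lemma exists_lower (l : seq R) : exists m : R, forall x, x \in l -> m <= x.
Proof.
elim: l => [|y l [m IH]]; first by exists 0.
exists (Num.min y m) => x; rewrite inE ge_min => /orP[/eqP ->|/IH ->]; first by rewrite lexx.
by rewrite orbT.
Qed.

Lemma exists_pos_lower (l : seq R) : (forall x, x \in l -> 0 < x) ->
  exists2 d : R, 0 < d & forall x, x \in l -> d <= x.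
Proof.
elim: l => [|y l IH] H; first by exists 1.
have [|d d0 Hd] := IH; first by move=> x hx; apply: H; rewrite inE hx orbT.
exists (Num.min y d); first by rewrite lt_min H ?mem_head.
by move=> x; rewrite inE ge_min => /orP[/eqP ->|/Hd ->]; rewrite ?lexx ?orbT.
Qed.

Lemma edist_gt0 (p q : R * R) : p != q -> 0 < edist p q.
Proof.
move=> ne; rewrite lt_def sqrtr_ge0 andbT; apply: contra ne => /eqP E.
have [a b] := edist_coord p q; rewrite E in a b.
move: a b; rewrite !normr_le0 !subr_eq0 => /eqP e1 /eqP e2.
by rewrite [p]surjective_pairing [q]surjective_pairing e1 e2.
Qed.

Definition sim (lam mx my : R) (p : R * R) : R * R := (lam * (p.1 - mx), lam * (p.2 - my)).

Lemma edist_sim lam mx my p q : 0 <= lam -> edist (sim lam mx my p) (sim lam mx my q) = lam * edist p q.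
Proof.
move=> l0; rewrite /Pilot.Defs.edist /=.
have -> : (lam * (p.1 - mx) - lam * (q.1 - mx)) ^+ 2 + (lam * (p.2 - my) - lam * (q.2 - my)) ^+ 2 =
  lam ^+ 2 * ((p.1 - q.1) ^+ 2 + (p.2 - q.2) ^+ 2) by ring.
by rewrite sqrtrM ?sqr_ge0 // sqrtr_sqr ger0_norm.
Qed.

Lemma tlen_sim n lam mx my (lo : option 'I_n -> R * R) s : 0 <= lam ->
  tlen (sim lam mx my \o lo) s = lam * tlen lo s.
Proof.
move=> l0; have H p t : plen (sim lam mx my p) (map (sim lam mx my) t) = lam * plen p t.
  elim: t p => [|q t IH] p /=; first by rewrite mulr0.
  by rewrite IH edist_sim // mulrDr.
by rewrite /tlen -H map_rcons -map_comp.
Qed.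

(** There are finitely many locations, so their nonzero distances have a positive lower bound [d],
    and scaling by [2 / d] separates them; a translation makes the coordinates nonnegative. *)
Lemma normalize n (lo : option 'I_n -> R * R) : exists lam mx my, [/\ 0 < lam,
  forall x, 0 <= (sim lam mx my (lo x)).1 /\ 0 <= (sim lam mx my (lo x)).2 &
  forall x y, lo x = lo y \/ 2 <= edist (sim lam mx my (lo x)) (sim lam mx my (lo y))].
Proof.
have [mx hx] := exists_lower [seq (lo x).1 | x <- enum [set: option 'I_n]].
have [my hy] := exists_lower [seq (lo x).2 | x <- enum [set: option 'I_n]].
pose l := [seq edist (lo z.1) (lo z.2) | z <- enum [set z : option 'I_n * option 'I_n | lo z.1 != lo z.2]].
have [|d d0 hd] := @exists_pos_lower l.
  by move=> x /mapP[z]; rewrite mem_enum inE => hz ->; apply: edist_gt0.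
have l0 : 0 < 2 / d by rewrite divr_gt0.
exists (2 / d), mx, my; split=> // [x|x y].
  split; apply: mulr_ge0; rewrite ?(ltW l0) // subr_ge0; [apply: hx|apply: hy];
    by apply: map_f; rewrite mem_enum inE.
case: (eqVneq (lo x) (lo y)) => [->|ne]; [by left|right].
have hl : d <= edist (lo x) (lo y).
  by apply: hd; apply/mapP; exists (x, y) => //; rewrite mem_enum inE.
rewrite edist_sim ?(ltW l0) // -[X in X <= _](divfK (lt0r_neq0 d0)).
by rewrite ler_wpM2l // ltW.
Qed.

(** Applied to two points of one unit cell; with separation 2 it shows that a cell holds at most one
    terminal. *)
Lemma edist_lt2 (p q : R * R) : `|p.1 - q.1| < 1 -> `|p.2 - q.2| < 1 -> edist p q < 2.
Proof.
rewrite !ltr_norml => /andP[a1 a2] /andP[b1 b2]; rewrite ltNge; apply/negP => h.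
have E : edist p q ^+ 2 = (p.1 - q.1) ^+ 2 + (p.2 - q.2) ^+ 2.
  by rewrite sqr_sqrtr // addr_ge0 ?sqr_ge0.
have h1 : (p.1 - q.1) ^+ 2 < 1 by rewrite expr2; nra.
have h2 : (p.2 - q.2) ^+ 2 < 1 by rewrite expr2; nra.
have h3 : 4 <= edist p q ^+ 2 by rewrite expr2; nra.
by move: h3; rewrite E leNgt => /negP; apply; lra.
Qed.

Lemma trunc_close (x y : R) : 0 <= x -> 0 <= y -> Num.trunc x = Num.trunc y -> `|x - y| < 1.
Proof.
move=> x0 y0 E; have /andP[a1 a2] := truncn_itv x0; have /andP[b1 b2] := truncn_itv y0.
rewrite -E in b1 b2; rewrite -natr1 in a2; rewrite -natr1 in b2; rewrite ltr_norml; apply/andP; split; lra.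
Qed.

Local Open Scope nat_scope.

Lemma prefix_cross (T : Type) (q : T -> nat) (s : seq T) B : B < \sum_(v <- s) q v ->
  exists s1 x s2, [/\ s = s1 ++ x :: s2, \sum_(v <- s1) q v <= B & B < \sum_(v <- s1) q v + q x].
Proof.
elim: s B => [|x s IH] B; rewrite ?big_nil // big_cons => H.
case: (ltnP B (q x)) => h; first by exists [::], x, s; rewrite big_nil add0n.
have [|s1 [y [s2 [-> a b]]]] := IH (B - q x); first by rewrite ltn_subLR.
exists (x :: s1), y, s2; rewrite big_cons; split=> //; first by rewrite -leq_subRL.
by rewrite -addnA -ltn_subLR.
Qed.

(* A tour of load at most 3N is cut where the load first exceeds 2N, or has the
   crossing terminal isolated when that one weighs at least N. *)
Lemma split2 (T : eqType) (q : T -> nat) (s : seq T) N : \sum_(v <- s) q v <= 3 * N ->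
  (forall v, q v <= 2 * N) -> exists s1 s2, [/\ perm_eq (s1 ++ s2) s, subseq s1 s, subseq s2 s,
    \sum_(v <- s1) q v <= 2 * N & \sum_(v <- s2) q v <= 2 * N].
Proof.
move=> h3 hq; case: (leqP (\sum_(v <- s) q v) (2 * N)) => h2.
  by exists s, [::]; rewrite cats0 perm_refl subseq_refl sub0seq big_nil.
have [s1 [x [s2 [E a b]]]] := prefix_cross h2.
move: h3; rewrite E big_cat big_cons /= => h3.
case: (leqP N (q x)) => hx.
  exists [:: x], (s1 ++ s2); rewrite perm_catCA perm_refl sub1seq mem_cat mem_head orbT big_seq1 hq big_cat /=.
  split=> //; first by apply: cat_subseq (subseq_refl _) (subseq_cons _ _).
  by move: h3 hx; clear; lia.
exists s1, (x :: s2); rewrite perm_refl prefix_subseq suffix_subseq a big_cons; split=> //.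
by move: h3 b hx; clear; lia.
Qed.

Lemma big_pairs (T : Type) (idx : T) (op : Monoid.law idx) (G : nat -> T) m :
  \big[op/idx]_(j < 2 * m) G j = \big[op/idx]_(i < m) op (G (2 * i)) (G (2 * i).+1).
Proof.
elim: m => [|m IH]; first by rewrite muln0 !big_ord0.
by rewrite mulnS !add2n !big_ord_recr /= IH Monoid.mulmA.
Qed.

Lemma count_flatten_iota (T : Type) (p : pred T) (s : nat -> seq T) N :
  count p (flatten (map s (iota 0 N))) = \sum_(j < N) count p (s j).
Proof.
elim: N => [|N IH]; first by rewrite big_ord0.
by rewrite -{1}(addn1 N) iotaD map_cat flatten_cat count_cat /= cats0 ?add0n IH big_ord_recr.
Qed.

Lemma tcE (I : instance R) s : tc (I := I) s = tlen (@loc R I) s.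
Proof. by rewrite /tc /tour_cost -plenE /tlen -map_comp. Qed.

Lemma tlen_subseq n (lo : option 'I_n -> R * R) s t : subseq s t -> (tlen lo s <= tlen lo t)%R.
Proof.
move=> h; apply: plen_subseq; rewrite -!cats1; apply: cat_subseq (subseq_refl _).
exact: map_subseq.
Qed.

Section Opt1.
Variables (I : instance R) (OPT : solution (nterm I)).
Hypothesis F : feasible OPT.
Local Notation n := (nterm I).

Definition served (k : 'I_(ntours OPT)) : seq 'I_n :=
  [seq v <- undup (pmap id (tour_of k)) | assign OPT v == k].

Lemma mem_served k v : (v \in served k) = (assign OPT v == k).
Proof.
rewrite mem_filter mem_undup; case: eqP => //= <-.
have := F.1 v; elim: (tour_of _) => //= x w IH; rewrite inE => /orP[/eqP <-|h] /=.
  by rewrite inE eqxx.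
by case: x => [u|] /=; rewrite ?inE IH ?orbT.
Qed.

Lemma uniq_served k : uniq (served k).
Proof. by rewrite filter_uniq ?undup_uniq. Qed.

Lemma tlen_served k : (tlen (@loc R I) (served k) <= tour_cost (tour_of k))%R.
Proof.
rewrite /tour_cost -plenE; apply: plen_subseq; rewrite -!cats1; apply: cat_subseq (subseq_refl _).
rewrite map_comp; apply: map_subseq; apply: (@subseq_trans _ (map Some (pmap id (tour_of k)))).
  by apply: map_subseq; apply: subseq_trans (filter_subseq _ _) (undup_subseq _).
elim: (tour_of k) => //= -[v|] w IH /=; first by rewrite eqxx.
exact: subseq_trans IH (subseq_cons _ _).
Qed.

(** The total demand contributes at most [2 n], and rounding at most 1 for each of at most [n]
    terminals. *)
Lemma load_served k : \sum_(v <- served k) qv v <= 3 * n.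
Proof.
have q1 (v : 'I_n) : ((qv v)%:R <= (capn I)%:R * demand v + 1 :> R)%R.
  case E : (qv v) => [|j].
    by rewrite addr_ge0 ?mulr_ge0 //; case/andP: (demand_bounds v) => /ltW.
  have jq : j < qv v by rewrite E.
  have jc : j < (capn I).+1.
    by apply: leq_trans jq _; rewrite /qv -[X in _ <= X](size_iota 0) find_size.
  have := before_find 0 jq; rewrite nth_iota // add0n => /negbT; rewrite -ltNge => /ltW h.
  by rewrite -natr1 lerD2r.
rewrite -(@ler_nat R) natr_sum.
apply: (@le_trans _ _ (\sum_(v <- served k) ((capn I)%:R * demand v + 1))%R).
  by apply: ler_sum => v _; apply: q1.
rewrite big_split /= -mulr_sumr big_const_seq count_predT iter_addr_0.
have d1 : (\sum_(v <- served k) demand v <= 1)%R.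
  by rewrite big_uniq ?uniq_served //= (eq_bigl _ _ (mem_served k)); exact: F.2.
have sz : size (served k) <= n.
  by rewrite -(card_uniqP (uniq_served k)) -[X in _ <= X]card_ord max_card.
have -> : (3 * n)%:R = ((capn I)%:R * 1 + n%:R :> R)%R by rewrite mulr1 -natrD /capn -mulSnr.
by apply: lerD; [rewrite ler_wpM2l|rewrite ler_nat].
Qed.

End Opt1.

(** The tours are padded with empty ones up to [m], reordered by [structure] and cut into two
    subsequences each. A subsequence is no longer than its tour and has no more runs, so each half
    costs at most the reordered tour and the bound on runs still applies. *)
Lemma opt_der (eps : R) : (0 < eps)%R -> exists c, 0 < c /\
  forall m (I : instance R) (OPT : solution (nterm I)), feasible OPT -> ntours OPT <= m ->
  exists (P : pieces I) h, [/\ DerI (2 * m) c h (whole I) P, h <= nrounds I (2 * m) c,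
    (forall k, k < nslots (2 * m) c -> k %% c.*2 != 0 -> P k = [::]) &
    (costP (2 * m) c P <= 2 * (1 + eps) * cost OPT)%R].
Proof.
(* The successor makes [c] positive, so that every tour has slots. *)
move=> eps0; have [c0 Hc] := structure eps0; exists c0.+1; split=> // m I OPT F hm.
have [lam [mx [my [l0 pos2 sep]]]] := normalize (@loc R I).
set lo := sim lam mx my \o @loc R I.
pose ss0 (i : 'I_m) : seq 'I_(nterm I) :=
  if (insub (val i) : option 'I_(ntours OPT)) is Some k then served k else [::].
(* Coordinates and shifts are both below [2 ^ B], hence shifted coordinates are below [2 ^ B.+1]. *)
have [B hB] : exists B, forall x : option 'I_(nterm I), forall d, Num.trunc (coord d (lo x)) < 2 ^ B.
  exists (\max_(x : option 'I_(nterm I)) (Num.trunc (lo x).1 + Num.trunc (lo x).2)) => x d.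
  apply: leq_ltn_trans (ltn_expl _ (isT : 1 < 2)).
  apply: leq_trans (leq_bigmax x); case: d; [exact: leq_addr|exact: leq_addl].
have sep' x y : lo x = lo y \/ (2 <= edist (lo x) (lo y))%R.
  by case: (sep x y) => h; [left; rewrite /lo /= h|right].
have [a [b [ss' [aB bB pm len rn]]]] := Hc _ lo m ss0 B pos2 sep'.
have [f1 hf1] : exists f1 : 'I_m -> seq 'I_(nterm I) * seq 'I_(nterm I), forall i,
   [/\ perm_eq ((f1 i).1 ++ (f1 i).2) (ss' i), subseq (f1 i).1 (ss' i), subseq (f1 i).2 (ss' i),
   \sum_(v <- (f1 i).1) qv v <= capn I & \sum_(v <- (f1 i).2) qv v <= capn I].
  suff /choice[f hf] : forall i, exists p : seq 'I_(nterm I) * seq 'I_(nterm I),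
     [/\ perm_eq (p.1 ++ p.2) (ss' i), subseq p.1 (ss' i), subseq p.2 (ss' i),
     \sum_(v <- p.1) qv v <= capn I & \sum_(v <- p.2) qv v <= capn I] by exists f.
  move=> i; have ld : \sum_(v <- ss' i) qv v <= 3 * nterm I.
    rewrite (perm_big _ (pm i)) /= /ss0; case: insubP => [k _ _|_]; first exact: load_served.
    by rewrite big_nil.
  have qc (v : 'I_(nterm I)) : qv v <= 2 * nterm I.
    rewrite -/(capn I) -ltnS -[X in _ < X](size_iota 0) -has_find; apply/hasP; exists (capn I).
      by rewrite mem_iota /= add0n ltnSn.
    by rewrite -[X in (_ <= X)%R]mulr1 ler_wpM2l //; case/andP: (demand_bounds v).
  by have [s1 [s2 h]] := split2 ld qc; exists (s1, s2).
pose ss (j : nat) : seq 'I_(nterm I) :=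
  if (insub j./2 : option 'I_m) is Some i then (if odd j then (f1 i).2 else (f1 i).1) else [::].
have ssE (i : 'I_m) : ss (2 * i) = (f1 i).1 /\ ss (2 * i).+1 = (f1 i).2.
  by rewrite /ss mul2n /= uphalf_double doubleK odd_double valK.
have ssP j : j < 2 * m -> exists i : 'I_m, subseq (ss j) (ss' i) /\ \sum_(v <- ss j) qv v <= capn I.
  move=> hj; have hi : j./2 < m.
    by rewrite -ltn_double -[m.*2]mul2n; apply: leq_ltn_trans hj; rewrite -[X in _ <= X]odd_double_half leq_addl.
  exists (Ordinal hi); rewrite /ss (insubT (fun j => j < m) hi).
  by have [_ t1 t2 t3 t4] := hf1 (Ordinal hi); case: odd.
have cnt v : \sum_(i < m) count_mem v (ss' i) = 1.
  have am : assign OPT v < m by apply: leq_trans (ltn_ord _) hm.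
  have E i : count_mem v (ss' i) = (i == Ordinal am).
    rewrite (permP (pm i)) /ss0; case: insubP => [k _ ki|].
      rewrite count_uniq_mem ?uniq_served // mem_served //; congr nat_of_bool.
      by rewrite -!val_eqE /= -ki eq_sym.
    rewrite -leqNgt => hi; case: eqP => // Ei; move: hi; rewrite Ei /= leqNgt ltn_ord //.
  by rewrite (bigD1 (Ordinal am)) //= E eqxx big1 // => i /negbTE ni; rewrite E ni.
have ss_perm : perm_eq (flatten (map ss (iota 0 (2 * m)))) (enum 'I_(nterm I)).
  apply/allP => v _ /=; apply/eqP; transitivity 1; last by rewrite count_uniq_mem ?enum_uniq // mem_enum.
  transitivity (\sum_(i < m) count_mem v (ss' i)); last exact: cnt.
  transitivity (\sum_(j < 2 * m) count_mem v (ss j)).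
    exact: count_flatten_iota.
  rewrite (big_pairs _ (fun j => count_mem v (ss j))); apply: eq_bigr => i _.
  by have [-> ->] := ssE i; have [/permP <- _ _ _ _] := hf1 i; rewrite count_cat.
have ss_load j : j < 2 * m -> \sum_(v <- ss j) qv v <= capn I.
  by move=> hj; have [i []] := ssP j hj.
pose f (d : bool) (v : 'I_(nterm I)) : nat := Num.trunc (coord d (lo (Some v))) + (if d then a else b).
have f_mono d (u v : 'I_(nterm I)) : (coord d (pos u) <= coord d (pos v))%R -> f d u <= f d v.
  move=> h; rewrite leq_add2r; apply: le_truncn; move: h.
  by case: d => h; rewrite /coord /lo /= ler_pM2l // lerD2r.
have f_inj (u v : 'I_(nterm I)) : f true u = f true v -> f false u = f false v -> u = v.
  move=> /addIn e1 /addIn e2; have [p1 p2] := pos2 (Some u); have [p3 p4] := pos2 (Some v).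
  case: (sep (Some u) (Some v)) => [|h]; first exact: pos_inj.
  have := edist_lt2 (trunc_close p1 p3 e1) (trunc_close p2 p4 e2).
  by rewrite ltNge h.
have f_lt d v : f d v < 2 ^ B.+1.
  by rewrite /f expnS mul2n -addnn -addSn; apply: leq_add; [exact: hB|case: d; exact: ltnW].
have f_runs h h' q1 q2 : h <= B -> h' = h \/ h' = h.+1 -> q1 < 2 ^ (B.+1 - h) -> q2 < 2 ^ (B.+1 - h') ->
   forall j, j < 2 * m -> runs (fun v => rect h h' q1 q2 (f true v) (f false v)) false (ss j) <= c0.+1.
  move=> e1 e2 e3 e4 j hj; have [i [sb _]] := ssP j hj.
  exact: leq_trans (runs_subseq _ _ sb) (leqW (rn _ _ _ _ e1 e2 e3 e4 i)).
have [P [h [D hh Pi P0]]] := dp_complete ss_perm ss_load (isT : 0 < c0.+1) f_mono f_inj f_lt f_runs.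
exists P, h; split=> //.
rewrite /costP /nslots (@big_stride _ _ _ (2 * m) c0.+1.*2 (fun k => tc (P k))) ?double_gt0 //; last first.
  by move=> k hk hk'; rewrite P0 // tc_nil.
rewrite (eq_bigr (fun i : 'I_(2 * m) => tc (ss i))) => [|i _]; last by rewrite Pi.
rewrite (big_pairs _ (fun j => tc (ss j))).
have lg : (0 <= lam)%R := ltW l0.
apply: (@le_trans _ _ (\sum_(i < m) 2 * tlen (@loc R I) (ss' i))%R).
  apply: ler_sum => i _; have [-> ->] := ssE i; have [_ t1 t2 _ _] := hf1 i.
  by rewrite !tcE mulr_natl mulr2n; apply: lerD; apply: tlen_subseq.
rewrite -mulr_sumr -mulrA ler_pM2l // -(ler_pM2l l0) mulr_sumr.
rewrite (eq_bigr (fun i => tlen lo (ss' i))) => [|i _]; last by rewrite tlen_sim.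
apply: le_trans len _; rewrite mulrCA ler_pM2l ?addr_gt0 // mulr_sumr -?mulr_sumr.
have -> : (\sum_i tlen lo (ss0 i) = lam * \sum_i tlen (@loc R I) (ss0 i))%R.
  by rewrite mulr_sumr; apply: eq_bigr => i _; rewrite tlen_sim.
rewrite ler_pM2l //; have tn : tlen (@loc R I) [::] = 0%R by rewrite -tcE tc_nil.
rewrite /cost.
pose g (j : nat) : R := if (insub j : option 'I_(ntours OPT)) is Some k then tlen (@loc R I) (served k) else 0%R.
rewrite (eq_bigr (fun i : 'I_m => g i)) => [|i _]; last by rewrite /ss0 /g; case: insub.
rewrite -(big_mkord predT g) (@big_cat_nat _ _ _ (ntours OPT)) //= [X in (_ + X)%R]big_nat_cond.
rewrite [X in (_ + X)%R]big1 ?addr0 => [|j /andP[/andP[hj _] _]]; last first.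
  by rewrite /g insubF // ltnNge hj.
by rewrite big_mkord; apply: ler_sum => k _; rewrite /g valK; exact: tlen_served.
Qed.

End Opt.

Theorem theorem5 (R : realType) :
  exists K eps0 : R, 0 < eps0 /\
  forall eps : R, 0 < eps < eps0 ->
  exists (alg : cmd) (p : {poly nat}),
  forall I : instance R,
  exists (t : nat) (s : state R),
    [/\ exec alg (input_state I) t s,
        (t <= p.[nterm I])%N
      & forall OPT : solution (nterm I),
        optimal OPT -> (ntours OPT)%:R <= 2 * Gamma eps ->
        exists S : solution (nterm I),
          [/\ outputs s S, feasible S & cost S <= (2 + K * eps) * cost OPT]].
Proof.
(* [2 * (1 + eps) = 2 + 2 * eps], whence the constant 2. *)
exists 2, 1; split=> // eps /andP[eps0 _].
(* [m] bounds the number of tours in terms of [eps] alone, so the program and its polynomial are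
   chosen before the instance. *)
have [c [c_gt0 Hc]] := opt_der eps0; pose m := Num.bound `|2 * Gamma eps|.
have [p hp] := @isP_TMAIN R (2 * m) c.
exists (pmain (2 * m) c), p => I.
have [t [s [ex le out]]] := @run_pmain R (2 * m) c c_gt0 I.
exists t, s; split=> //; first exact: leq_trans le (hp I).
move=> OPT [F _] hG.
have hm : (ntours OPT <= m)%N.
  apply: ltnW; rewrite -(ltr_nat R); apply: le_lt_trans hG (le_lt_trans (ler_norm _) _).
  by apply: archi_boundP; exact: normr_ge0.
have [P [h [D hh P0 cP]]] := Hc m I OPT F hm.
have [S [oS fS cS]] := out P h D hh P0.
exists S; split=> //; apply: le_trans cS (le_trans cP _).
by rewrite mulrDr mulr1.
Qed.
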